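(* Let $n\ge 2$ and let $X_1,\dots,X_n$ be i.i.d. random variables with a probability density $f\in BVC[0,1]$ (so the $X_i$ take values in $[0,1]$). Let $Q=\sum_{i=1}^n (X_i-\overline X)^2$, $q=\sup Q$ and $t_k=k\pi/q$, $k\in\mathbb N$. Then for $0\le x\le q$ the cdf of $Q$ is $$F_Q(x)=2\pi^{-3/2}\sqrt n\int_{-\infty}^{\infty}\sum_{k=1}^\infty \operatorname{Im}\Big(\sqrt{-it_k}\,\big(\psi^*(t_k,u)\big)^n\Big)\frac{1-\cos(t_kx)}{k}\,du ,$$ and also $$F_Q(x)=2\pi^{-3/2}\sqrt n\int_0^1\sum_{k=1}^\infty \operatorname{Im}\Big(\sqrt{-it_k}\,\big(\psi^*(t_k,-u)\big)^n\Big)\frac{1-\cos(t_kx)}{k}\,du$$ $$\qquad+2\pi^{-3/2}\sqrt n\int_0^\infty\sum_{k=1}^\infty \operatorname{Im}\Big(\big(\psi(t_k,y)\big)^n+\big(\psi(t_k,-y-\sqrt{-it_k})\big)^n\Big)\frac{1-\cos(t_kx)}{k}\,dy .$$ Moreover, the density $f_Q$ of $Q$ is square integrable on $(0,q)$ for all $n\ge 3$, and for all $n\ge 4$ it is obtained by differentiating (in $x$) under the integral sign in these representations.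
   Context: $BVC[a,b]$ denotes the class of functions $f:[a,b]\to\mathbb R$ that are continuous on $[a,b]$ and (absolutely continuous) with derivative $f'\in\mathcal L^1(a,b)$. For $n$ i.i.d. random variables with values in $[0,1]$, $q=\sup Q$ equals $n/4$ if $n$ is even and $(n^2-1)/(4n)$ if $n$ is odd. Square roots of complex numbers are principal branches, so for $t>0$, $\sqrt{-it}=(1-i)\sqrt{t/2}$. For $t\in\mathbb R$, $z\in\mathbb C$ and $X$ with density $f$: $\psi(t,z)=\mathbb E\exp\!\big(-(z+\sqrt{-it}\,X)^2\big)$, and $\psi^*(t,u)=\psi(t,u\sqrt{-it})=\mathbb E\exp\!\big(it(X+u)^2\big)$ for $u\in\mathbb R$ (the characteristic function of $(X+u)^2$). *)

(* Defs.v *)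
From HB Require Import structures.
From mathcomp Require Import all_boot all_order all_algebra.
From mathcomp Require Import all_classical all_reals all_analysis.
From mathcomp.real_closed Require Import complex.
Set Implicit Arguments. Unset Strict Implicit. Unset Printing Implicit Defensive.
Import Order.TTheory GRing.Theory Num.Theory.
Import numFieldNormedType.Exports.
Local Open Scope classical_set_scope.
Local Open Scope ring_scope.

Section Defs.
Context {R : realType}.

Definition abs_cont (a b : R) (f : R -> R) : Prop :=
  forall e : R, 0 < e -> exists2 d : R, 0 < d &
    forall (m : nat) (u v : 'I_m -> R),
      (forall i, a <= u i /\ u i <= v i /\ v i <= b) ->
      (forall i j, i != j -> v i <= u j \/ v j <= u i) ->
      \sum_(i < m) (v i - u i) < d ->
      \sum_(i < m) `|f (v i) - f (u i)| < e.

Definition BVC (a b : R) (f : R -> R) : Prop :=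
  {within `[a, b], continuous f} /\ abs_cont a b f.

Definition is_density_of d (T : measurableType d) (P : probability T R)
    (Y : T -> R) (g : R -> R) : Prop :=
  measurable_fun setT g /\
  forall A : set R, measurable A ->
    P (Y @^-1` A) = (\int[lebesgue_measure]_(x in A) (g x)%:E)%E.

Definition mutually_independent d (T : measurableType d) (P : probability T R)
    (n : nat) (X : 'I_n -> T -> R) : Prop :=
  forall B : 'I_n -> set R, (forall i, measurable (B i)) ->
    P (\bigcap_(i in [set: 'I_n]) (X i @^-1` B i)) =
    (\prod_(i < n) P (X i @^-1` B i))%E.

Definition Qfun (n : nat) (x : 'I_n -> R) : R :=
  \sum_(i < n) (x i - (\sum_(j < n) x j) / n%:R) ^+ 2.

Definition cdf_of d (T : measurableType d) (P : probability T R) (Y : T -> R)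
    (x : R) : R := fine (P [set w | Y w <= x]).

(** q = sup Q *)
Definition qsup (n : nat) : R :=
  if odd n then (n%:R ^+ 2 - 1) / (4 * n%:R) else n%:R / 4.

Definition tk (n k : nat) : R := k%:R * pi / qsup n.

Definition cexp (w : R[i]) : R[i] :=
  Complex (expR (complex.Re w) * cos (complex.Im w)) (expR (complex.Re w) * sin (complex.Im w)).

(** principal square root of -i t *)
Definition sqrt_mit (t : R) : R[i] :=
  Complex (Num.sqrt (`|t| / 2)) (- Num.sg t * Num.sqrt (`|t| / 2)).

Definition cintegral (A : set R) (g : R -> R[i]) : R[i] :=
  Complex (Rintegral lebesgue_measure A (fun x => complex.Re (g x)))
          (Rintegral lebesgue_measure A (fun x => complex.Im (g x))).

(** psi(t,z) = E exp(-(z + sqrt(-it) X)^2) for X with density f on [0,1] *)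
Definition psi (f : R -> R) (t : R) (z : R[i]) : R[i] :=
  cintegral `[0, 1] (fun x =>
    Complex (f x) 0 * cexp (- (z + sqrt_mit t * Complex x 0) ^+ 2)).

(** psi*(t,u) = psi(t, u sqrt(-it)) = E exp(it (X+u)^2) *)
Definition psistar (f : R -> R) (t u : R) : R[i] :=
  psi f t (Complex u 0 * sqrt_mit t).

Definition sum1 (a : nat -> R) : R := limn (fun N => \sum_(1 <= k < N) a k).

(** the representation  int_D sum_{k>=1} a u k du  is meaningful: the series
    converges for every u in D, and its sum is Lebesgue integrable on D *)
Definition SI_ok (D : set R) (a : R -> nat -> R) : Prop :=
  (forall u, D u -> cvgn (fun N => \sum_(1 <= k < N) a u k)) /\
  lebesgue_measure.-integrable D (fun u => (sum1 (a u))%:E).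

Definition SI (D : set R) (a : R -> nat -> R) : R :=
  Rintegral lebesgue_measure D (fun u => sum1 (a u)).

Definition cst (n : nat) : R := 2 / (pi * Num.sqrt pi) * Num.sqrt n%:R.

Definition a1 (f : R -> R) (n : nat) (w : nat -> R) (u : R) (k : nat) : R :=
  complex.Im (sqrt_mit (tk n k) * psistar f (tk n k) u ^+ n) * w k.

Definition a2 (f : R -> R) (n : nat) (w : nat -> R) (u : R) (k : nat) : R :=
  complex.Im (sqrt_mit (tk n k) * psistar f (tk n k) (- u) ^+ n) * w k.

Definition a3 (f : R -> R) (n : nat) (w : nat -> R) (y : R) (k : nat) : R :=
  complex.Im (psi f (tk n k) (Complex y 0) ^+ n
      + psi f (tk n k) (- Complex y 0 - sqrt_mit (tk n k)) ^+ n) * w k.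

Definition wcdf (n : nat) (x : R) (k : nat) : R := (1 - cos (tk n k * x)) / k%:R.
Definition wpdf (n : nat) (x : R) (k : nat) : R := tk n k * sin (tk n k * x) / k%:R.

Definition both_reprs (f : R -> R) (n : nat) (w : nat -> R) (v : R) : Prop :=
  (SI_ok setT (a1 f n w) /\ v = cst n * SI setT (a1 f n w)) /\
  (SI_ok `[0, 1] (a2 f n w) /\ SI_ok `[0, +oo[ (a3 f n w) /\
   v = cst n * SI `[0, 1] (a2 f n w) + cst n * SI `[0, +oo[ (a3 f n w)).

End Defs.

(* Main.v *)
(** Write [s] for the square root of [-it], [c] for the mean of the sample and
    [phi t = E exp(itQ)].  Since the sum of the [(z + s X_i)^2] equals
    [n (z + s c)^2 - itQ], independence gives
    [psi(t, z)^n = E (exp(itQ) exp(-n (z + s c)^2))].  By Fubini, integrating along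
    the line [z = s u] leaves a Fresnel integral, independent of [c], so that [s] times
    the integral of [psi*(t, u)^n] is [sqrt(pi / n) phi(t)].  For the second
    representation let [H(c)] be the integral of [exp(-n (y + s c)^2)] over [y >= 0]:
    the three integrals contribute [H(c - 1) - H(c)], [H(c)] and [H(1 - c)], and
    [H(c) + H(-c) = sqrt(pi / n)].

    As [f] is continuous and of bounded variation, Abel summation against the bounded
    primitive of [exp(itx^2)] yields [|psi|^n <= C t^(-n/2) / (1 + u^2)].  This justifies
    the exchange of sum and integral, and bounds [phi(t)] by [C t^((1-n)/2)].  Both
    representations thereby reduce to [2/pi] times the sum of the [Im phi(t_k) w_k].
    For the cdf, [sum_k sin(ka)(1 - cos(kb))/k] converges boundedly to [pi/2] if [a < b]
    and to [0] if [a > b]; take [a = pi Q/q] and [b = pi x/q], the exceptional values of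
    [Q] being null because [phi(t)] tends to [0].

    For [n >= 4] the differentiated series converges uniformly and integrates to the cdf.
    For [n = 3], [Q] is the squared norm of a planar vector with bounded density, and the
    area of an annulus is proportional to the increment of the squared radius, so the cdf
    of [Q] is Lipschitz and its density bounded. *)

Require Import Defs.
From HB Require Import structures.
From mathcomp Require Import all_boot all_order all_algebra.
From mathcomp Require Import all_classical all_reals all_analysis.
From mathcomp.real_closed Require Import complex.
From mathcomp Require Import measurable_realfun.
From mathcomp Require Import ring lra zify.
Import Order.TTheory GRing.Theory Num.Theory.
Import numFieldNormedType.Exports.
Set Implicit Arguments.
Unset Strict Implicit.
Unset Printing Implicit Defensive.
Local Open Scope classical_set_scope.
Local Open Scope ring_scope.

(** * Differentiation, and the kernel sum_k sin(ka)(1 - cos(kb))/k *)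

(** All thresholds on [n] come from one rate. Up to a constant and a factor [1 / (1 + u^2)], the
    terms of the series are bounded by |w_k| t_k^((1-n)/2). The cdf has |w_k| <= 2/k, so [n >= 2]
    yields k^(-3/2). After differentiation w_k is merely bounded, the same rate needs [n >= 4], and
    [n = 3] leaves 1/k, for which absolute convergence fails; its density is therefore found without
    the series.

    Fubini cannot be applied directly on the whole line, because |exp(int(c + u)^2)| = 1 is not
    integrable in u. It is applied on segments; the decay of psi* makes the line integral absolutely
    convergent, and the decay of H controls the missing tails.

    No contour is moved. The integrand of H depends on y + s c only, so differentiating in c is s
    times differentiating in y, and H'(c) = - s exp(intc^2). Thus H is an explicit Fresnel
    primitive, and H(c) + H(-c) is constant because H' is even.

    The density hypothesis places the X_i in [0, 1] only almost surely, whereas the kernels are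
    controlled only there; the variables are first truncated, which changes no law. *)

Section Calculus.
Context {R : realType}.
Implicit Types (f g : R -> R) (x a b c : R).

Lemma der_cst (c x : R) : is_derive x 1 (fun=> c) 0.
Proof. exact: is_derive_cst. Qed.

Lemma der_id (x : R) : is_derive x 1 (fun y : R => y) 1.
Proof. exact: is_derive_id. Qed.

Lemma derD f g x (df dg : R) : is_derive x 1 f df -> is_derive x 1 g dg ->
  is_derive x 1 (fun y => f y + g y) (df + dg).
Proof. by move=> hf hg; have := is_deriveD hf hg. Qed.

Lemma derN f x (df : R) : is_derive x 1 f df ->
  is_derive x 1 (fun y => - f y) (- df).
Proof. by move=> hf; have := is_deriveN hf. Qed.

Lemma derM f g x (df dg : R) : is_derive x 1 f df -> is_derive x 1 g dg ->
  is_derive x 1 (fun y => f y * g y) (f x * dg + g x * df).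
Proof. by move=> hf hg; have := is_deriveM hf hg. Qed.

Lemma derX f n x (df : R) : is_derive x 1 f df ->
  is_derive x 1 (fun y => f y ^+ n) (n%:R * f x ^+ n.-1 * df).
Proof. by move=> hf; have := is_deriveX n hf; rewrite exprfctE. Qed.

Lemma derV f x (df : R) : f x != 0 -> is_derive x 1 f df ->
  is_derive x 1 (fun y => (f y)^-1) (- f x ^- 2 * df).
Proof.
move=> fx0 hf; have [df1 df2] := hf.
apply: DeriveDef; first exact: derivableV.
by rewrite deriveV// df2.
Qed.

Lemma der_sin f x (df : R) : is_derive x 1 f df ->
  is_derive x 1 (fun y => sin (f y)) (cos (f x) * df).
Proof. by move=> hf; have := is_derive1_comp (is_derive_sin (f x)) hf. Qed.

Lemma der_cos f x (df : R) : is_derive x 1 f df ->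
  is_derive x 1 (fun y => cos (f y)) (- sin (f x) * df).
Proof. by move=> hf; have := is_derive1_comp (is_derive_cos (f x)) hf. Qed.

Lemma der_exp f x (df : R) : is_derive x 1 f df ->
  is_derive x 1 (fun y => expR (f y)) (expR (f x) * df).
Proof. by move=> hf; have := is_derive1_comp (is_derive_expR (f x)) hf. Qed.

Lemma der_comp f g x (a b : R) : is_derive (g x) 1 f a -> is_derive x 1 g b ->
  is_derive x 1 (fun y => f (g y)) (a * b).
Proof. by move=> hf hg; have := is_derive1_comp hf hg. Qed.

Lemma der_continuous f x (df : R) : is_derive x 1 f df -> {for x, continuous f}.
Proof.
by move=> [h _]; apply/differentiable_continuous/derivable1_diffP.
Qed.

Lemma der_ge f (df : R -> R) a b : a <= b ->
  (forall x, a <= x <= b -> is_derive x 1 f (df x)) ->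
  (forall x, a <= x <= b -> 0 <= df x) -> f a <= f b.
Proof.
move=> ab hd h0.
have [||c] := @MVT_segment _ f df a b ab.
- move=> x /[!in_itv]/= /andP[ax xb]; apply: hd; lra.
- apply: continuous_in_subspaceT => x; rewrite inE/= in_itv/= => xab.
  exact: der_continuous (hd _ xab).
rewrite in_itv/= => cab fab; rewrite -subr_ge0 fab mulr_ge0 ?h0//; lra.
Qed.

Lemma der_eq f a b : (forall x, is_derive x 1 f 0) -> f a = f b.
Proof. by move=> h; apply: is_derive_0_is_cst => x; exact: h. Qed.

Lemma cont_within f (A : set R) : continuous f -> {within A, continuous f}.
Proof. by move=> h; apply: continuous_subspaceT. Qed.

Lemma integrable_itvcc f a b : {within `[a, b], continuous f} ->
  lebesgue_measure.-integrable `[a, b] (EFin \o f).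
Proof.
move=> cf; apply: continuous_compact_integrable => //; exact: segment_compact.
Qed.

Lemma Rintegral_FTC f F a b : a <= b -> continuous f ->
  (forall x, is_derive x 1 F (f x)) ->
  \int[lebesgue_measure]_(x in `[a, b]) f x = F b - F a.
Proof.
move=> ab cf hF; case: (ltgtP a b) ab => // [altb _|-> _]; last first.
  by rewrite set_itv1 Rintegral_set1 subrr.
have cF : continuous F by move=> x; exact: der_continuous (hF x).
rewrite /Rintegral (@continuous_FTC2 _ f F)//.
- exact: cont_within.
- split=> [x _||]; first by have [] := hF x.
  + by apply: cvg_at_right_filter; exact: cF.
  + by apply: cvg_at_left_filter; exact: cF.
- by move=> x _; rewrite derive1E; exact: derive_val.
Qed.

End Calculus.

(** [der1] applies the differentiation rule dictated by the shape of the function. [der] starts from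
    an unknown derivative, so its last goal compares the computed value with the claimed one; after
    [eapply der_continuous], repeating [der1] proves continuity. *)
Ltac der1 := first
  [ notypeclasses refine (der_cst _ _) | notypeclasses refine (der_id _)
  | notypeclasses refine (derN _) | notypeclasses refine (derD _ _)
  | notypeclasses refine (derX _ _) | notypeclasses refine (derM _ _)
  | notypeclasses refine (der_sin _) | notypeclasses refine (der_cos _)
  | notypeclasses refine (der_exp _) ].
Ltac der := notypeclasses refine (is_derive_eq _ _); [repeat der1 | rewrite /=].

Section DirichletSums.
Context {R : realType}.
Implicit Types (t a b : R) (N k : nat).

(** 1/2 + [cos_sum N t] is half the Dirichlet kernel sin((N + 1/2) t) / sin(t/2). Its primitive
    leads to [sin_sum], a partial sum of the sawtooth series with value (pi - t)/2 on (0, 2 pi). *)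
Definition cos_sum N t := \sum_(1 <= k < N.+1) cos (k%:R * t).
Definition sin_sum N t := \sum_(1 <= k < N.+1) sin (k%:R * t) / k%:R.

Lemma cos_sumE N t :
  2 * sin (t / 2) * cos_sum N t = sin ((N%:R + 2^-1) * t) - sin (t / 2).
Proof.
rewrite /cos_sum; elim: N => [|N IH].
  by rewrite big_geq// mulr0 add0r mulrC subrr.
rewrite big_nat_recr//= mulrDr IH.
have -> : (N.+1%:R + 2^-1) * t = N.+1%:R * t + t / 2 by ring.
have -> : (N%:R + 2^-1) * t = N.+1%:R * t - t / 2.
  by rewrite -natr1; field.
rewrite sinB sinD; ring.
Qed.

Lemma der_sin_sum N t : is_derive t 1 (sin_sum N) (cos_sum N t).
Proof.
rewrite /sin_sum /cos_sum; elim: N => [|N IH].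
  rewrite big_geq//.
  rewrite [X in is_derive _ _ X](_ : _ = fun=> 0) //.
    by apply: der_cst.
  by apply/funext => u; rewrite big_geq.
rewrite big_nat_recr//=.
rewrite [X in is_derive _ _ X](_ : _ = (fun u => (\sum_(1 <= k < N.+1)
   sin (k%:R * u) / k%:R) + sin (N.+1%:R * u) / N.+1%:R)); last first.
  by apply/funext => u; rewrite big_nat_recr.
apply: derD => //; der.
have : (N.+1%:R : R) != 0 by []. move=> ?; field. by [].
Qed.

(** A crude slope is enough. On [0, pi/4] one has cos >= 1/2, because cos(2u) = 2 cos(u)^2 - 1 is
    still nonnegative; the doubling formula then carries the bound to [0, pi/2]. *)
Lemma sin_ge t : 0 <= t <= pi / 2 -> t / 4 <= sin t.
Proof.
move=> /andP[t0 tp].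
have cosge (u : R) : 0 <= u <= pi / 4 -> 2^-1 <= cos u.
  move=> /andP[u0 up].
  have c0 : 0 <= cos u.
    apply: cos_ge0_pihalf; have := @pi_gt0 R; lra.
  have : 0 <= cos (u *+ 2).
    apply: cos_ge0_pihalf; have := @pi_gt0 R; lra.
  rewrite cos_mulr2n => h; rewrite leNgt; apply/negP => h2.
  have : cos u ^+ 2 < 2^-1 ^+ 2 by rewrite ltr_pXn2r ?nnegrE//; lra.
  lra.
have singe (u : R) : 0 <= u <= pi / 4 -> u / 2 <= sin u.
  move=> /andP[u0 up].
  have := @der_ge _ (fun v => sin v - v / 2) (fun v => cos v - 2^-1) 0 u u0.
  rewrite sin0 mul0r subr0 subr_ge0; apply.
    move=> x _; der. ring.
  move=> x xu; rewrite subr_ge0; apply: cosge; lra.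
have -> : t = (t / 2) *+ 2 by rewrite -mulr_natr; field.
rewrite sin_mulr2n.
have h1 := cosge (t / 2); have h2 := singe (t / 2).
have {}h1 := h1 ltac:(lra); have {}h2 := h2 ltac:(lra).
nra.
Qed.

Lemma sin_sum_pi N : sin_sum N pi = 0.
Proof.
rewrite /sin_sum big1_seq// => k _.
have -> : sin (k%:R * pi) = 0 :> R.
  elim: k => [|k IH]; first by rewrite mul0r sin0.
  by rewrite -natr1 mulrDl mul1r sinDpi IH oppr0.
by rewrite mul0r.
Qed.

(** The error has derivative sin((N + 1/2) u) / (2 sin(u/2)). Adding cos((N + 1/2) u) B(u)
    integrates this by parts: the sum [E] has derivative cos((N + 1/2) u) B'(u), with B decreasing.
    So E - B and - (E + B) are nondecreasing, and E(pi) = 0 gives |E(t)| <= B(t). *)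
Lemma sin_sum_approx N t : 0 < t <= pi ->
  `|sin_sum N t - (pi - t) / 2| <= 2 / ((2 * N%:R + 1) * sin (t / 2)).
Proof.
move=> /andP[t0 tpi].
have N0 : 0 < 2 * N%:R + 1 :> R by have : 0 <= N%:R :> R by []; lra.
have sgt (u : R) : t <= u <= pi -> 0 < sin (u / 2).
  move=> /andP[tu up]; apply: sin_gt0_pi; have := @pi_gt0 R; lra.
pose B (u : R) := ((2 * N%:R + 1) * sin (u / 2))^-1.
pose E (u : R) := sin_sum N u - (pi - u) / 2 + cos ((N%:R + 2^-1) * u) * B u.
pose dB (u : R) := - ((2 * N%:R + 1) * sin (u / 2)) ^- 2 *
  ((2 * N%:R + 1) * (cos (u / 2) / 2)).
have hB u : t <= u <= pi -> is_derive u 1 B (dB u).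
  move=> /sgt su; notypeclasses refine (is_derive_eq _ _).
    notypeclasses refine (derV _ _); first by rewrite mulf_neq0 ?gt_eqF.
    by repeat der1.
  by rewrite /dB; congr (_ * _); ring.
pose dE (u : R) := cos ((N%:R + 2^-1) * u) * dB u.
have hE u : t <= u <= pi -> is_derive u 1 E (dE u).
  move=> tu; have su := sgt _ tu.
  notypeclasses refine (is_derive_eq _ _).
    notypeclasses refine (derD (derD (der_sin_sum _ _) _) (derM _ (hB _ tu))).
    - by repeat der1.
    - by repeat der1.
  have /(congr1 (fun z => z / (2 * sin (u / 2)))) := cos_sumE N u.
  rewrite mulrAC mulfV ?mul1r; last by rewrite mulf_neq0 ?gt_eqF.
  move=> ->; rewrite /dE /B; field.
  by rewrite !gt_eqF.
have E0 : E pi = 0.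
  rewrite /E sin_sum_pi subrr mul0r subrr add0r.
  have -> : (N%:R + 2^-1) * pi = N%:R * pi + pi / 2 :> R by ring.
  rewrite cosDpihalf.
  have -> : sin (N%:R * pi) = 0 :> R.
    elim: (N) => [|k IH]; first by rewrite mul0r sin0.
    by rewrite -natr1 mulrDl mul1r sinDpi IH oppr0.
  by rewrite oppr0 mul0r.
have Bge u : t <= u <= pi -> 0 <= B u.
  by move=> /sgt su; rewrite invr_ge0 mulr_ge0 ?ltW.
have dBle u : t <= u <= pi -> dB u <= 0.
  move=> tu; have su := sgt _ tu; rewrite /dB mulNr oppr_le0.
  apply: mulr_ge0; first by rewrite invr_ge0 exprn_ge0// mulr_ge0 ?ltW.
  apply: mulr_ge0; first exact: ltW.
  apply: divr_ge0 => //.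
  by rewrite cos_ge0_pihalf//; have := @pi_gt0 R; lra.
have h1 : E t - B t <= E pi - B pi.
  apply: (@der_ge _ (fun u => E u - B u) (fun u => dE u - dB u)) => //.
    by move=> x /[dup] /hE ? /hB ?; apply: derD => //; apply: derN.
  move=> x /dBle h; rewrite /dE -[X in _ - X]mul1r -mulrBl mulr_le0// subr_le0; exact: cos_le1.
have h2 : - (E t + B t) <= - (E pi + B pi).
  apply: (@der_ge _ (fun u => - (E u + B u)) (fun u => - (dE u + dB u))) => //.
    by move=> x /[dup] /hE ? /hB ?; apply: derN; apply: derD.
  move=> x /dBle h; rewrite oppr_ge0 /dE -{2}[dB x]mul1r -mulrDl.
  by rewrite mulr_ge0_le0// -lerBlDr sub0r cos_geN1.
have b1 := Bge t ltac:(lra); have b2 := Bge pi ltac:(lra).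
have -> : 2 / ((2 * N%:R + 1) * sin (t / 2)) = 2 * B t by [].
have hc : `|cos ((N%:R + 2^-1) * t) * B t| <= B t.
  by rewrite normrM (ger0_norm b1) ler_piMl// cos_max.
move: hc; rewrite ler_norml => /andP[c1 c2].
rewrite ler_norml; move: h1 h2; rewrite E0 /E => h1 h2.
by apply/andP; split; lra.
Qed.

Lemma normr_sin_le t : `|sin t| <= `|t|.
Proof.
wlog t0 : t / 0 <= t => [h|].
  have [|/ltW t0] := leP 0 t; first exact: h.
  by rewrite -normrN -sinN -(normrN t); apply: h; rewrite oppr_ge0.
rewrite (ger0_norm t0) ler_norml; apply/andP; split.
  have := @der_ge _ (fun v => sin v + v) (fun v => cos v + 1) 0 t t0.
  rewrite sin0 addr0 -lerBlDr sub0r; apply; last first.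
  by move=> x _; have := cos_geN1 x; lra.
have := @der_ge _ (fun v => v - sin v) (fun v => 1 - cos v) 0 t t0.
rewrite sin0 subr0 subr_ge0; apply; last first.
by move=> x _; have := cos_le1 x; lra.
Qed.

Lemma sin_sumN N t : sin_sum N (- t) = - sin_sum N t.
Proof.
rewrite /sin_sum -sumrN; apply: eq_bigr => k _.
by rewrite mulrN sinN mulNr.
Qed.

Lemma sin_sumB N t : sin_sum N (2 * pi - t) = - sin_sum N t.
Proof.
rewrite /sin_sum -sumrN; apply: eq_bigr => k _.
rewrite -mulNr -sinN; congr (_ / _).
have -> : k%:R * (2 * pi - t) = - (k%:R * t) + (pi *+ 2) *+ k :> R.
  by rewrite -mulr_natl -[pi *+ 2]mulr_natl; ring.
by rewrite (periodicn (@sinD2pi R)).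
Qed.

Lemma sin_sum0 N : sin_sum N 0 = 0.
Proof. by rewrite /sin_sum big1// => k _; rewrite mulr0 sin0 mul0r. Qed.

(** For N u <= 1 each term is at most u. For N u > 1 the approximation error is at most 8, since
    sin(u/2) >= u/8. The interval [-pi, 2 pi] contains a + b and a - b for all a, b in [0, pi]. *)
Lemma sin_sum_bound N t : - pi <= t <= 2 * pi -> `|sin_sum N t| <= pi + 17.
Proof.
have pi0 := @pi_gt0 R.
have h0 (u : R) : 0 <= u <= pi -> `|sin_sum N u| <= pi + 17.
  move=> /andP[u0 up]; case: (ltgtP 0 u) u0 => // [{}u0 _|<- _]; last first.
    by rewrite sin_sum0 normr0; lra.
  have [Nu|Nu] := leP (N%:R * u) 1.
    apply: (@le_trans _ _ (N%:R * u)); last lra.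
    rewrite /sin_sum (le_trans (ler_norm_sum _ _ _))//.
    apply: (@le_trans _ _ (\sum_(1 <= k < N.+1) u)).
      rewrite big_nat_cond [leRHS]big_nat_cond; apply: ler_sum => k.
      rewrite andbT => /andP[k1 _].
      have k0 : 0 < k%:R :> R by rewrite ltr0n.
      rewrite normrM normfV (gtr0_norm k0) ler_pdivrMr//.
      by rewrite (le_trans (normr_sin_le _))// normrM !gtr0_norm// mulrC.
    by rewrite sumr_const_nat subn1/= mulr_natl.
  have := @sin_sum_approx N u ltac:(lra).
  have := @sin_ge (u / 2) ltac:(lra).
  set s := sin _ => hs.
  have N0 : 0 <= N%:R :> R by [].
  have hh : 2 / ((2 * N%:R + 1) * s) <= 8.
    rewrite ler_pdivrMr; first nra.
    by rewrite mulr_gt0//; lra.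
  rewrite !ler_norml => /andP[h1 h2]; apply/andP; split; lra.
move=> /andP[t1 t2].
have [t3|t3] := leP 0 t; last first.
  by rewrite -normrN -sin_sumN; apply: h0; lra.
have [t4|t4] := leP t pi; first by apply: h0; lra.
by rewrite -normrN -sin_sumB; apply: h0; lra.
Qed.

Lemma sin_sum_cvg t : 0 < t < 2 * pi ->
  (fun N => sin_sum N t) @ \oo --> (pi - t) / 2.
Proof.
have pi0 := @pi_gt0 R.
have h0 (u : R) : 0 < u <= pi -> (fun N => sin_sum N u) @ \oo --> (pi - u) / 2.
  move=> /andP[u0 up].
  have s0 : 0 < sin (u / 2) by apply: sin_gt0_pi; lra.
  apply/cvgrPdist_le => e e0.
  near=> N; rewrite distrC.
  apply: le_trans (sin_sum_approx N _) _; first lra.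
  have : N%:R > 2 / sin (u / 2) / e :> R by near: N; exact: nbhs_infty_gtr.
  rewrite ltr_pdivrMr// ltr_pdivrMr// => hN.
  have N0 : 0 <= N%:R :> R by [].
  rewrite ler_pdivrMr; last by rewrite mulr_gt0//; lra.
  nra.
move=> /andP[t0 t2].
have [t4|t4] := leP t pi; first by apply: h0; lra.
have -> : (pi - t) / 2 = - ((pi - (2 * pi - t)) / 2) by field.
rewrite [X in X @ _](_ : _ = (fun N => - sin_sum N (2 * pi - t))).
  apply: cvgN; apply: h0; lra.
by apply/funext => N; rewrite sin_sumB opprK.
Unshelve. all: by end_near.
Qed.

Definition step_kernel N a b :=
  \sum_(1 <= k < N.+1) sin (k%:R * a) * ((1 - cos (k%:R * b)) / k%:R).

Lemma step_kernelE N a b :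
  step_kernel N a b = sin_sum N a - (sin_sum N (a + b) + sin_sum N (a - b)) / 2.
Proof.
rewrite /step_kernel /sin_sum -big_split/= mulr_suml -sumrB.
apply: eq_bigr => k _.
rewrite mulrBr mulrDr sinB sinD.
by set kV := k%:R^-1; field.
Qed.

Lemma step_kernel_bound N a b : 0 <= a <= pi -> 0 <= b <= pi ->
  `|step_kernel N a b| <= 2 * (pi + 17).
Proof.
move=> a0 b0; rewrite step_kernelE.
have := @sin_sum_bound N a; have := @sin_sum_bound N (a + b).
have := @sin_sum_bound N (a - b).
move=> /(_ ltac:(lra)) h1 /(_ ltac:(lra)) h2 /(_ ltac:(lra)) h3.
move: h1 h2 h3; rewrite !ler_norml; lra.
Qed.

(** For a > b the three sawtooth limits cancel. For a < b the argument a - b is negative, where the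
    odd extension of the sawtooth is lower by pi; with the coefficient -1/2 this leaves pi/2. *)
Lemma step_kernel_cvg a b : 0 < a < pi -> 0 <= b <= pi -> a != b ->
  (fun N => step_kernel N a b) @ \oo --> (if a < b then pi / 2 else 0).
Proof.
move=> a0 b0 ab.
under eq_fun do rewrite step_kernelE.
have h1 := @sin_sum_cvg a; have h2 := @sin_sum_cvg (a + b).
move: h1 h2.
move=> /(_ ltac:(lra)) h1 /(_ ltac:(lra)) h2.
case: ltgtP ab => // ab _.
  have := @sin_sum_cvg (b - a) => /(_ ltac:(lra)) h3.
  have -> : pi / 2 = (pi - a) / 2 - ((pi - (a + b)) / 2 +
     - ((pi - (b - a)) / 2)) / 2 :> R by field.
  apply: cvgB => //; apply: cvgMl; apply: cvgD => //.
  rewrite [X in X @ _](_ : _ = (fun N => - sin_sum N (b - a))).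
    exact: cvgN.
  by apply/funext => N; rewrite -sin_sumN opprB.
have := @sin_sum_cvg (a - b) => /(_ ltac:(lra)) h3.
have -> : 0 = (pi - a) / 2 - ((pi - (a + b)) / 2 +
     ((pi - (a - b)) / 2)) / 2 :> R by field.
by apply: cvgB => //; apply: cvgMl; apply: cvgD.
Qed.

End DirichletSums.

(** * Integrals of real functions, and the Fresnel-type function H *)

Section RealIntegrals.
Context d (T : measurableType d) (R : realType).
Context (mu : {measure set T -> \bar R}).
Implicit Types (D : set T) (f g h : T -> R).

Lemma integrable_dom D g h : measurable D -> measurable_fun D g ->
  (forall x, D x -> `|g x| <= h x) ->
  mu.-integrable D (EFin \o h) -> mu.-integrable D (EFin \o g).
Proof.
move=> mD mg gh ih; apply: (le_integrable mD _ _ ih).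
  exact/measurable_EFinP.
by move=> x Dx /=; rewrite lee_fin (le_trans (gh _ Dx))// ler_norm.
Qed.

Lemma integrable_bd D g (M : R) : measurable D -> (mu D < +oo)%E ->
  measurable_fun D g -> (forall x, D x -> `|g x| <= M) ->
  mu.-integrable D (EFin \o g).
Proof.
move=> mD Doo mg gM.
apply: measurable_bounded_integrable => //.
exists M; split; first exact: num_real.
by move=> N MN x Dx /=; rewrite (le_trans (gM _ Dx))// ltW.
Qed.

Lemma normr_Rintegral_le D g h : measurable D -> measurable_fun D g ->
  (forall x, D x -> `|g x| <= h x) -> mu.-integrable D (EFin \o h) ->
  `|\int[mu]_(x in D) g x| <= \int[mu]_(x in D) h x.
Proof.
move=> mD mg gh ih; have ig := integrable_dom mD mg gh ih.
rewrite (le_trans (le_normr_Rintegral _ _))// le_Rintegral//.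
exact: integrable_norm.
Qed.

Lemma integrableD_real D f g : measurable D ->
  mu.-integrable D (EFin \o f) -> mu.-integrable D (EFin \o g) ->
  mu.-integrable D (EFin \o (fun x => f x + g x)).
Proof. by move=> mD i1 i2; have := integrableD mD i1 i2. Qed.

Lemma integrableB_real D f g : measurable D ->
  mu.-integrable D (EFin \o f) -> mu.-integrable D (EFin \o g) ->
  mu.-integrable D (EFin \o (fun x => f x - g x)).
Proof. by move=> mD i1 i2; have := integrableB mD i1 i2. Qed.

Lemma integrableZ_real D (k : R) f : measurable D ->
  mu.-integrable D (EFin \o f) -> mu.-integrable D (EFin \o (fun x => k * f x)).
Proof. by move=> mD i1; have := integrableZl mD k i1. Qed.

Lemma Rintegral_dct D (f_ : nat -> T -> R) f g : measurable D ->
  (forall n, measurable_fun D (f_ n)) ->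
  (forall x, D x -> (fun n => f_ n x) @ \oo --> f x) ->
  mu.-integrable D (EFin \o g) ->
  (forall n x, D x -> `|f_ n x| <= g x) ->
  mu.-integrable D (EFin \o f) /\
  (fun n => \int[mu]_(x in D) f_ n x) @ \oo --> \int[mu]_(x in D) f x.
Proof.
move=> mD mf ff ig fg.
have mlim : measurable_fun D (EFin \o f).
  apply: (@emeasurable_fun_cvg _ _ _ _ (fun n => EFin \o f_ n)).
    by move=> n; exact/measurable_EFinP.
  move=> x Dx; apply: cvg_EFin; first by near=> n.
  exact: ff.
have [|||||h1 _ h2] := @dominated_convergence _ _ _ mu D mD
   (fun n => EFin \o f_ n) (EFin \o f) (EFin \o g).
- by move=> n; exact/measurable_EFinP.
- exact: mlim.
- apply/aeW => x Dx; apply: cvg_EFin; first by near=> n.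
  exact: ff.
- exact: ig.
- by apply/aeW => x n Dx; rewrite lee_fin fg.
split; first exact: h1.
apply: fine_cvg; rewrite fineK; first exact: h2.
exact: integrable_fin_num.
Unshelve. all: by end_near.
Qed.

End RealIntegrals.

Section OnR.
Context {R : realType}.
Notation leb := (@lebesgue_measure R).

Lemma lebesgue_itvcc (a b : R) : a <= b -> leb `[a, b] = (b - a)%:E.
Proof.
rewrite le_eqVlt => /orP[/eqP->|ab].
  by rewrite set_itv1 lebesgue_measure_set1 subrr.
by rewrite lebesgue_measure_itv/= lte_fin ab EFinB.
Qed.

Lemma cont_meas (f : R -> R) (D : set R) : continuous f -> measurable_fun D f.
Proof. by move=> cf; apply: measurable_funTS; exact: continuous_measurable_fun. Qed.

Lemma integrable_cauchy : leb.-integrable setT (EFin \o (fun y => (1 + y ^+ 2)^-1)).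
Proof.
have m1 : measurable_fun setT (fun y : R => (1 + y ^+ 2)^-1).
  by apply: cont_meas => y; exact: continuous_oneDsqrV.
have p0 (y : R) : 0 <= (1 + y ^+ 2)^-1.
  by rewrite invr_ge0 addr_ge0 ?sqr_ge0.
apply/integrableP; split; first exact/measurable_EFinP.
under eq_integral do rewrite /= ger0_norm//.
rewrite (@ge0_symfun_integralT _ (fun y : R => (1 + y ^+ 2)^-1))//.
- rewrite (_ : [set x | _] = `[0, +oo[%classic); last first.
    by apply/seteqP; split => x/=; rewrite in_itv/= andbT.
  by rewrite (integral0y_oneDsqr R) -EFinM ltry.
- by move=> y; exact: continuous_oneDsqrV.
- by move=> y /=; rewrite sqrrN.
Qed.

Lemma integrable_cauchyZ (C : R) (D : set R) : measurable D ->
  leb.-integrable D (EFin \o (fun y => C * (1 + y ^+ 2)^-1)).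
Proof.
move=> mD; apply: (@integrableS _ _ _ _ setT) => //.
exact: (integrableZl _ C integrable_cauchy).
Qed.

(** Completing the square turns the linear term into the factor exp(K^2 / (2m)) and keeps half of
    the quadratic decay, which exp(x) >= 1 + x compares with 1 + y^2. *)
Lemma gauss_dom (m K : R) : 0 < m -> exists2 C, 0 <= C &
  forall y, expR (K * y - m * y ^+ 2) <= C * (1 + y ^+ 2)^-1.
Proof.
move=> m0; exists (expR (K ^+ 2 / (2 * m)) * (1 + 2 / m)).
  by rewrite mulr_ge0 ?expR_ge0// addr_ge0// divr_ge0// ltW.
move=> y.
have y1 : 0 < 1 + y ^+ 2 by rewrite ltr_pwDl// sqr_ge0.
rewrite ler_pdivlMr//.
have -> : K * y - m * y ^+ 2 =
  K ^+ 2 / (2 * m) + (- (m / 2 * (y - K / m) ^+ 2) - m / 2 * y ^+ 2).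
  by field; rewrite gt_eqF.
rewrite expRD -[leLHS]mulrA ler_pM2l ?expR_gt0//.
have h1 : expR (- (m / 2 * (y - K / m) ^+ 2) - m / 2 * y ^+ 2) <=
   (expR (m / 2 * y ^+ 2))^-1.
  rewrite -expRN ler_expR lerBlDr addNr oppr_le0 mulr_ge0 ?sqr_ge0//.
  by rewrite divr_ge0// ltW.
rewrite (le_trans (ler_wpM2r (ltW y1) h1))// mulrC ler_pdivrMr ?expR_gt0//.
have h2 := expR_ge1Dx (m / 2 * y ^+ 2).
have m1 : 0 <= 1 + 2 / m by rewrite addr_ge0// divr_ge0// ltW.
apply: le_trans (ler_wpM2l m1 h2).
have -> : (1 + 2 / m) * (1 + m / 2 * y ^+ 2) =
  (1 + y ^+ 2) + (2 / m + m / 2 * y ^+ 2) by field; rewrite gt_eqF.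
rewrite lerDl; apply: addr_ge0; first by rewrite divr_ge0// ltW.
by rewrite mulr_ge0 ?sqr_ge0// divr_ge0// ltW.
Qed.

(** The integrals over [0, n] converge to the integral over the half line by domination by |f|; the
    bound on F makes the upper boundary term vanish. *)
Lemma Rintegral_FTCy (f F : R -> R) (C : R) : continuous f ->
  (forall x : R, is_derive x 1 F (f x)) ->
  leb.-integrable `[0, +oo[ (EFin \o f) ->
  (forall y, 0 <= y -> `|F y| <= C * (1 + y ^+ 2)^-1) ->
  \int[leb]_(x in `[0, +oo[) f x = - F 0.
Proof.
move=> cf hF intf FC.
have h1 : (fun n : nat => F n%:R - F 0) @ \oo --> \int[leb]_(x in `[0, +oo[) f x.
  rewrite (_ : (fun n : nat => _) = (fun n : nat =>
      \int[leb]_(x in `[0, +oo[) (f x * \1_`[0, n%:R] x))).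
    apply: (@Rintegral_dct _ _ _ leb `[0, +oo[ _ f (fun x => `|f x|) _ _ _ _ _).2.
    - exact: measurable_itv.
    - move=> n; apply: measurable_funM; first exact: cont_meas.
      by apply: measurable_funTS; exact: measurable_indic.
    - move=> x /=; rewrite in_itv/= andbT => x0.
      apply: cvg_near_cst; near=> n.
      rewrite indicE mem_set ?mulr1//= in_itv/= x0/=.
      by near: n; exact: nbhs_infty_ger.
    - by apply: integrable_norm.
    - move=> n x _; rewrite normrM ler_piMr// indicE.
      by case: (_ \in _); rewrite ?normr1 ?normr0.
  apply/funext => n.
  rewrite -(Rintegral_FTC _ cf hF)// [LHS]Rintegral_mkcond [RHS]Rintegral_mkcond.
  apply: eq_Rintegral => x _; rewrite !patchE !mem_setE/= indicE.
  rewrite !in_itv/= andbT mem_setE/= in_itv/=.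
  by case: (0 <= x) => //=; case: (x <= _) => //=; rewrite ?mulr1 ?mulr0.
have h2 : (fun n : nat => F n%:R - F 0) @ \oo --> - F 0.
  rewrite -[X in _ --> X]sub0r; apply: cvgB; last exact: cvg_cst.
  apply/cvgr0Pnorm_le => e e0; near=> n.
  rewrite (le_trans (FC _ _))//.
  have C0 : 0 <= C.
    by have := FC 0 (lexx _); rewrite expr0n/= addr0 invr1 mulr1; exact: le_trans.
  have : C / e < n%:R by near: n; exact: nbhs_infty_gtr.
  rewrite ltr_pdivrMr// => h.
  rewrite ler_pdivrMr; last by rewrite ltr_pwDl// sqr_ge0.
  have n0 : 0 <= n%:R :> R by [].
  have : n%:R <= 1 + n%:R ^+ 2 :> R by nra.
  by nra.
by apply: cvg_unique h1 h2.
Unshelve. all: by end_near.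
Qed.

End OnR.

Section FresnelErfc.
Context {R : realType}.
(** Argument and modulus of exp(- m (y + s (1 - i) c)^2), using (1 - i)^2 = - 2 i. With s =
    sqrt(t/2) the number s (1 - i) is the square root of - i t, and [erfc_re], [erfc_im] are the two
    parts of H: an unnormalised complementary error function along a diagonal of the plane. *)
Definition erfc_phase (m s c y : R) := m * (2 * y * s * c + 2 * s ^+ 2 * c ^+ 2).
Definition erfc_modulus (m s c y : R) := expR (- (m * (y ^+ 2 + 2 * y * s * c))).
Notation leb := (@lebesgue_measure R).
Context (m s : R) (m0 : 0 < m) (s0 : 0 < s).
Implicit Types c y x L : R.

Local Notation ph := (erfc_phase m s).
Local Notation ex := (erfc_modulus m s).
Definition erfc_re_fun (c y : R) : R := ex c y * cos (ph c y).
Definition erfc_im_fun (c y : R) : R := ex c y * sin (ph c y).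
Definition erfc_re (c : R) : R := \int[leb]_(y in `[0, +oo[) erfc_re_fun c y.
Definition erfc_im (c : R) : R := \int[leb]_(y in `[0, +oo[) erfc_im_fun c y.

Definition dyre c y := ex c y * (- (m * (2 * y + 2 * s * c)) * cos (ph c y)
   - sin (ph c y) * (2 * m * s * c)).
Definition dyim c y := ex c y * (- (m * (2 * y + 2 * s * c)) * sin (ph c y)
   + cos (ph c y) * (2 * m * s * c)).

Local Lemma der_y_re c y : is_derive y 1 (erfc_re_fun c) (dyre c y).
Proof. by rewrite /erfc_re_fun /erfc_modulus /erfc_phase; der; rewrite /dyre /erfc_modulus /erfc_phase; ring. Qed.

Local Lemma der_y_im c y : is_derive y 1 (erfc_im_fun c) (dyim c y).
Proof. by rewrite /erfc_im_fun /erfc_modulus /erfc_phase; der; rewrite /dyim /erfc_modulus /erfc_phase; ring. Qed.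

(** The integrand depends on y + s (1 - i) c only, so its derivative in c is s (1 - i) times its
    derivative in y. *)
Local Lemma der_c_re c y : is_derive c 1 (erfc_re_fun ^~ y) (s * (dyre c y + dyim c y)).
Proof. by rewrite /erfc_re_fun /erfc_modulus /erfc_phase; der; rewrite /dyre /dyim /erfc_modulus /erfc_phase; ring. Qed.

Local Lemma der_c_im c y : is_derive c 1 (erfc_im_fun ^~ y) (s * (dyim c y - dyre c y)).
Proof. by rewrite /erfc_im_fun /erfc_modulus /erfc_phase; der; rewrite /dyre /dyim /erfc_modulus /erfc_phase; ring. Qed.

Local Lemma exE L c y : 0 <= y -> `|c| <= L ->
  ex c y <= expR (2 * m * s * L * y - m * y ^+ 2).
Proof.
move=> y0; rewrite ler_norml => /andP[c1 c2]; rewrite /erfc_modulus ler_expR.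
have h : 0 <= (m * s * y) * (c + L).
  by apply: mulr_ge0; [rewrite !mulr_ge0// ltW | lra].
nra.
Qed.

Local Lemma cs_bound (x : R) : `|cos x| <= 1 /\ `|sin x| <= 1.
Proof. by split; [exact: cos_max | exact: sin_max]. Qed.

Local Lemma dy_bound L : 0 <= L -> exists2 C, 0 <= C & forall c y, 0 <= y -> `|c| <= L ->
  [/\ `|erfc_re_fun c y| <= C * (1 + y ^+ 2)^-1,
      `|erfc_im_fun c y| <= C * (1 + y ^+ 2)^-1,
      `|dyre c y| <= C * (1 + y ^+ 2)^-1 &
      `|dyim c y| <= C * (1 + y ^+ 2)^-1].
Proof.
move=> L0.
(* The extra [+ 1] in the exponent provides a factor exp(y), which absorbs the linear factor 1 + y
   produced by differentiation. *)
have [C1 C10 hC1] := @gauss_dom R m (2 * m * s * L + 1) m0.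
pose K := 1 + (2 * m + 4 * m * s * L).
have K0 : 0 <= 2 * m + 4 * m * s * L.
  by rewrite addr_ge0 ?mulr_ge0// ltW.
exists (K * C1); first by rewrite mulr_ge0// /K; lra.
move=> c y y0 cL.
have y1 : 0 < 1 + y ^+ 2 by rewrite ltr_pwDl// sqr_ge0.
have e0 : 0 <= ex c y by rewrite expR_ge0.
have hE : ex c y * expR y <= C1 * (1 + y ^+ 2)^-1.
  apply: le_trans (hC1 y); apply: le_trans (ler_wpM2r (expR_ge0 _) (exE y0 cL)) _.
  by rewrite -expRD ler_expR; lra.
have ey : 1 + y <= expR y := expR_ge1Dx y.
have g1 : ex c y <= C1 * (1 + y ^+ 2)^-1.
  by apply: le_trans hE; rewrite ler_peMr//; lra.
have g2 : ex c y * (1 + y) <= C1 * (1 + y ^+ 2)^-1.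
  by apply: le_trans hE; rewrite ler_wpM2l.
have gC : C1 * (1 + y ^+ 2)^-1 <= K * C1 * (1 + y ^+ 2)^-1.
  rewrite -mulrA ler_peMl//; last by rewrite /K; lra.
  by rewrite mulr_ge0// invr_ge0 ltW.
have [hc hs] := cs_bound (ph c y).
have ms0 : 0 < m * s by rewrite mulr_gt0.
have msL : `|m * s * c| <= m * s * L.
  by rewrite normrM gtr0_norm// ler_pM2l.
have lin (u v : R) : `|u| <= 1 -> `|v| <= 1 ->
  `|ex c y * (- (m * (2 * y + 2 * s * c)) * u + v * (2 * m * s * c))| <=
   K * C1 * (1 + y ^+ 2)^-1.
  move=> u1 v1; rewrite normrM (ger0_norm e0).
  have h : `|- (m * (2 * y + 2 * s * c)) * u + v * (2 * m * s * c)| <= K * (1 + y).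
    apply: (le_trans (ler_normD _ _)); rewrite !normrM normrN.
    have h1 : `|m * (2 * y + 2 * s * c)| * `|u| <= 2 * m * y + 2 * (m * s * L).
      apply: (@le_trans _ _ `|m * (2 * y + 2 * s * c)|); first by rewrite ler_piMr.
      have -> : m * (2 * y + 2 * s * c) = 2 * m * y + 2 * (m * s * c) by ring.
      apply: (le_trans (ler_normD _ _)); apply: lerD.
        by rewrite ger0_norm// !mulr_ge0// ltW.
      by rewrite normrM ger0_norm// ler_pM2l.
    have h2 : `|v| * (`|2| * `|m| * `|s| * `|c|) <= 2 * (m * s * L).
      have -> : `|2| * `|m| * `|s| * `|c| = 2 * `|m * s * c|.
        rewrite (ger0_norm (ler0n _ 2)).
        by rewrite !normrM; ring.
      apply: (@le_trans _ _ (2 * `|m * s * c|)).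
        by rewrite ler_piMl// mulr_ge0.
      by rewrite ler_pM2l.
    rewrite !normrM in h1 h2 *.
    apply: (le_trans (lerD h1 h2)); rewrite /K.
    rewrite -subr_ge0.
    have -> : (1 + (2 * m + 4 * m * s * L)) * (1 + y) -
      (2 * m * y + 2 * (m * s * L) + 2 * (m * s * L)) =
      1 + 2 * m + y + 4 * (m * s * L * y) by ring.
    by rewrite !addr_ge0// !mulr_ge0// ltW.
  apply: (le_trans (ler_wpM2l e0 h)).
  have -> : ex c y * (K * (1 + y)) = K * (ex c y * (1 + y)) by ring.
  by rewrite -[leRHS]mulrA ler_wpM2l// /K; lra.
split.
- rewrite normrM (ger0_norm e0); apply: le_trans gC; apply: le_trans g1.
  by rewrite ler_piMr.
- rewrite normrM (ger0_norm e0); apply: le_trans gC; apply: le_trans g1.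
  by rewrite ler_piMr.
- have ns : `|- sin (ph c y)| <= 1 by rewrite normrN.
  by have := lin _ _ hc ns; rewrite [- sin _ * _]mulNr.
- exact: lin.
Qed.

Local Lemma cont_fun (F : R -> R) (dF : R -> R) :
  (forall y, is_derive y 1 F (dF y)) -> continuous F.
Proof. by move=> h y; exact: der_continuous (h y). Qed.

Local Lemma cont_dyre c : continuous (dyre c).
Proof. by move=> y; eapply der_continuous; rewrite /dyre /erfc_modulus /erfc_phase; repeat der1. Qed.

Local Lemma cont_dyim c : continuous (dyim c).
Proof. by move=> y; eapply der_continuous; rewrite /dyim /erfc_modulus /erfc_phase; repeat der1. Qed.

Local Lemma mem0y (y : R) : `[0, +oo[%classic y -> 0 <= y.
Proof. by rewrite /= in_itv/= andbT. Qed.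

Lemma erfc_fun_integrable c :
  leb.-integrable `[0, +oo[ (EFin \o erfc_re_fun c) /\
  leb.-integrable `[0, +oo[ (EFin \o erfc_im_fun c).
Proof.
have [C C0 hC] := dy_bound (normr_ge0 c).
have mD : measurable (`[0, +oo[%classic : set R) by exact: measurable_itv.
split; apply: integrable_dom (integrable_cauchyZ C mD) => //.
- by apply: cont_meas; exact: cont_fun (der_y_re c).
- by move=> y /mem0y y0; have [] := hC c y y0 (lexx _).
- by apply: cont_meas; exact: cont_fun (der_y_im c).
- by move=> y /mem0y y0; have [] := hC c y y0 (lexx _).
Qed.

Local Lemma dy_integrable c :
  leb.-integrable `[0, +oo[ (EFin \o dyre c) /\
  leb.-integrable `[0, +oo[ (EFin \o dyim c).
Proof.
have [C C0 hC] := dy_bound (normr_ge0 c).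
have mD : measurable (`[0, +oo[%classic : set R) by exact: measurable_itv.
split; apply: integrable_dom (integrable_cauchyZ C mD) => //.
- by apply: cont_meas; exact: cont_dyre.
- by move=> y /mem0y y0; have [] := hC c y y0 (lexx _).
- by apply: cont_meas; exact: cont_dyim.
- by move=> y /mem0y y0; have [] := hC c y y0 (lexx _).
Qed.

Local Lemma int_dy c :
  \int[leb]_(y in `[0, +oo[) dyre c y = - cos (2 * m * s ^+ 2 * c ^+ 2) /\
  \int[leb]_(y in `[0, +oo[) dyim c y = - sin (2 * m * s ^+ 2 * c ^+ 2).
Proof.
have [C C0 hC] := dy_bound (normr_ge0 c).
have [i1 i2] := dy_integrable c.
have ph0 : ph c 0 = 2 * m * s ^+ 2 * c ^+ 2 by rewrite /erfc_phase; ring.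
have ex0 : ex c 0 = 1 by rewrite /erfc_modulus expr0n/= !mulr0 !mul0r addr0 mulr0 oppr0 expR0.
split.
- rewrite (Rintegral_FTCy (@cont_dyre c) (der_y_re c) i1 (C := C)).
    by rewrite /erfc_re_fun ph0 ex0 mul1r.
  by move=> y y0; have [] := hC c y y0 (lexx _).
- rewrite (Rintegral_FTCy (@cont_dyim c) (der_y_im c) i2 (C := C)).
    by rewrite /erfc_im_fun ph0 ex0 mul1r.
  by move=> y y0; have [] := hC c y y0 (lexx _).
Qed.

Local Lemma diff_under (F dF : R -> R -> R) c :
  (forall c, leb.-integrable `[0, +oo[ (EFin \o F c)) ->
  (forall c y, is_derive c 1 (F ^~ y) (dF c y)) ->
  (forall L, 0 <= L -> exists2 C, 0 <= C &
    forall c y, 0 <= y -> `|c| <= L -> `|dF c y| <= C * (1 + y ^+ 2)^-1) ->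
  is_derive c 1 (fun c => \int[leb]_(y in `[0, +oo[) F c y)
    (\int[leb]_(y in `[0, +oo[) dF c y).
Proof.
move=> iF hF bF.
have mD : measurable (`[0, +oo[%classic : set R) by exact: measurable_itv.
(* The radius |c| + 1 gives one majorant for all parameters in (c - 1, c + 1). *)
have [C C0 hC] := bF (`|c| + 1) (addr_ge0 (normr_ge0 _) ler01).
have cI : `](c - 1), (c + 1)[%classic c by rewrite /= in_itv/=; lra.
have d1 x y : partial1of2 F x y = dF x y.
  by rewrite partial1of2E; exact: derive_val.
pose G (y : R) := C * (1 + y ^+ 2)^-1.
have G0 y : 0 <= G y.
  by rewrite mulr_ge0// invr_ge0 addr_ge0// sqr_ge0.
have := @cvg_differentiation_under_integral R _ _ leb F _ mD c (c - 1) (c + 1) cI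
  (fun x _ => iF x) (fun x y _ _ => @ex_derive _ _ _ _ _ _ _ (hF x y)) G G0
  (integrable_cauchyZ C mD).
move=> /(_ _)/wrap[x y|h].
  rewrite /= in_itv/= => xc /mem0y y0; rewrite d1; apply: hC => //.
  rewrite ler_norml; have := ler_norm c; have := lerNnormlW (lexx `|c|).
  move: xc => /andP[? ?]; lra.
apply: DeriveDef.
  apply/cvg_ex; eexists; rewrite /= in h *.
  under eq_fun do rewrite [_ *: 1]mulr1; exact: h.
rewrite -derive1E /derive1; have -> : \int[leb]_(y in `[0, +oo[) dF c y =
   \int[leb]_(y in `[0, +oo[) partial1of2 F c y by apply: eq_Rintegral => y _; rewrite d1.
by apply/cvg_lim => //; exact: h.
Qed.

(** The derivative in c is s (1 - i) times a derivative in y, and the latter integrates to minus the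
    boundary value at y = 0. In complex form H'(c) = - s (1 - i) exp(2 i m s^2 c^2). *)
Lemma der_erfc_re c : is_derive c 1 erfc_re
  (- s * (cos (2 * m * s ^+ 2 * c ^+ 2) + sin (2 * m * s ^+ 2 * c ^+ 2))).
Proof.
have [i1 i2] := dy_integrable c; have [j1 j2] := int_dy c.
have mD : measurable (`[0, +oo[%classic : set R) by exact: measurable_itv.
apply: is_derive_eq.
  apply: (diff_under (dF := fun c y => s * (dyre c y + dyim c y))).
  - by move=> c'; exact: (erfc_fun_integrable c').1.
  - by move=> c' y; exact: der_c_re.
  - move=> L /dy_bound[C C0 hC]; exists (s * (C + C)).
      by rewrite mulr_ge0 ?addr_ge0// ltW.
    move=> c' y y0 cL; have [_ _ h1 h2] := hC c' y y0 cL.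
    rewrite normrM gtr0_norm// -mulrA ler_pM2l// mulrDl.
    by rewrite (le_trans (ler_normD _ _))// lerD.
transitivity (s * \int[leb]_(y in `[0, +oo[) (dyre c y + dyim c y)).
  rewrite RintegralZl//; exact: integrableD_real.
by rewrite RintegralD// j1 j2; ring.
Qed.

Lemma der_erfc_im c : is_derive c 1 erfc_im
  (s * (cos (2 * m * s ^+ 2 * c ^+ 2) - sin (2 * m * s ^+ 2 * c ^+ 2))).
Proof.
have [i1 i2] := dy_integrable c; have [j1 j2] := int_dy c.
have mD : measurable (`[0, +oo[%classic : set R) by exact: measurable_itv.
apply: is_derive_eq.
  apply: (diff_under (dF := fun c y => s * (dyim c y - dyre c y))).
  - by move=> c'; exact: (erfc_fun_integrable c').2.
  - by move=> c' y; exact: der_c_im.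
  - move=> L /dy_bound[C C0 hC]; exists (s * (C + C)).
      by rewrite mulr_ge0 ?addr_ge0// ltW.
    move=> c' y y0 cL; have [_ _ h1 h2] := hC c' y y0 cL.
    rewrite normrM gtr0_norm// -mulrA ler_pM2l// mulrDl.
    by rewrite (le_trans (ler_normB _ _))// lerD.
transitivity (s * \int[leb]_(y in `[0, +oo[) (dyim c y - dyre c y)).
  rewrite RintegralZl//; exact: integrableB_real.
by rewrite RintegralB// j1 j2; ring.
Qed.

Lemma erfc_im0 : erfc_im 0 = 0.
Proof.
rewrite /erfc_im (_ : erfc_im_fun 0 = fun=> 0).
  by rewrite Rintegral_cst ?mul0r//; exact: measurable_itv.
apply/funext => y; rewrite /erfc_im_fun /erfc_phase expr0n/= !mulr0 addr0 mulr0 sin0.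
by rewrite mulr0.
Qed.

(** H' depends on c^2 only, so H(c) + H(-c) has derivative zero. *)
Lemma erfc_reN c : erfc_re c + erfc_re (- c) = 2 * erfc_re 0.
Proof.
suff -> : erfc_re c + erfc_re (- c) = erfc_re 0 + erfc_re (- 0).
  by rewrite oppr0 mulr_natl.
apply: (@der_eq _ (fun c => erfc_re c + erfc_re (- c))) => x.
apply: is_derive_eq.
  apply: derD; first exact: der_erfc_re.
  exact: (is_derive1_comp (der_erfc_re (- x)) (is_deriveNid x 1)).
by rewrite sqrrN; ring.
Qed.

Lemma erfc_imN c : erfc_im c + erfc_im (- c) = 0.
Proof.
suff -> : erfc_im c + erfc_im (- c) = erfc_im 0 + erfc_im (- 0).
  by rewrite oppr0 erfc_im0 addr0.
apply: (@der_eq _ (fun c => erfc_im c + erfc_im (- c))) => x.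
apply: is_derive_eq.
  apply: derD; first exact: der_erfc_im.
  exact: (is_derive1_comp (der_erfc_im (- x)) (is_deriveNid x 1)).
by rewrite sqrrN; ring.
Qed.

Lemma erfc_re0 : erfc_re 0 = Num.sqrt (pi / m) / 2.
Proof.
(* With 2 sg^2 = 1/m the centred normal density is proportional to exp(- m y^2), and its total mass
   1 gives the Gaussian integral; symmetry halves it. *)
pose sg := (Num.sqrt (2 * m))^-1.
have m2 : 0 < 2 * m by rewrite mulr_gt0.
have sg0 : 0 < sg by rewrite invr_gt0 sqrtr_gt0.
have sg2 : sg ^+ 2 *+ 2 = m^-1.
  by rewrite -mulr_natr /sg exprVn sqr_sqrtr ?ltW//; field; rewrite gt_eqF.
have := integral_normal_pdf 0 sg.
rewrite normal_pdfE ?gt_eqF// => h.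
have E y : normal_peak sg * normal_fun 0 sg y = normal_peak sg * expR (- (m * y ^+ 2)).
  by rewrite /normal_fun subr0 sg2 invrK mulNr [y ^+ 2 * m]mulrC.
have pk : normal_peak sg = (Num.sqrt (pi / m))^-1.
  by rewrite /normal_peak -mulrnAl sg2 mulrC.
have pk0 : 0 < normal_peak sg by apply: normal_peak_gt0; rewrite gt_eqF.
move: h; under eq_integral do rewrite E.
rewrite (@ge0_symfun_integralT _ (fun y => normal_peak sg * expR (- (m * y ^+ 2)))).
- rewrite (_ : [set x | _] = `[0, +oo[%classic); last first.
    by apply/seteqP; split => x/=; rewrite in_itv/= andbT.
  move=> h.
  have e0 : erfc_re_fun 0 = (fun y => expR (- (m * y ^+ 2))).
    apply/funext => y.
    by rewrite /erfc_re_fun /erfc_modulus /erfc_phase expr0n/= !mulr0 !addr0 mulr0 cos0 mulr1.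
  have [+ _] := erfc_fun_integrable 0; rewrite e0 => i0.
  have F : (\int[leb]_(y in `[0%R, +oo[) (expR (- (m * y ^+ 2)))%:E = (erfc_re 0)%:E)%E.
    by rewrite /erfc_re /Rintegral e0 fineK//; apply: integrable_fin_num.
  move: h; under eq_integral do rewrite EFinM.
  rewrite integralZl// F -!EFinM pk => -[h].
  have q0 : Num.sqrt (pi / m) != 0 by rewrite -invr_eq0 -pk gt_eqF.
  by apply: (mulfI (_ : 2 / Num.sqrt (pi / m) != 0)); rewrite ?mulf_neq0 ?invr_eq0//;
     rewrite -mulrA h; field.
- by move=> y; rewrite mulr_ge0 ?expR_ge0// ltW.
- move=> y; eapply der_continuous; repeat der1.
- by move=> y /=; rewrite sqrrN.
Qed.

(** For c >= 0 the factor exp(- 2 m s c y) is at most 1. For negative c it grows with y, and the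
    reflection formula takes over. *)
Lemma erfc_bound c : 0 <= c ->
  `|erfc_re c| <= erfc_re 0 /\ `|erfc_im c| <= erfc_re 0.
Proof.
move=> c0.
have mD : measurable (`[0, +oo[%classic : set R) by exact: measurable_itv.
have [i0 _] := erfc_fun_integrable 0.
have e0 y : erfc_re_fun 0 y = expR (- (m * y ^+ 2)).
  by rewrite /erfc_re_fun /erfc_modulus /erfc_phase expr0n/= !mulr0 !addr0 mulr0 cos0 mulr1.
have le y : 0 <= y -> ex c y <= erfc_re_fun 0 y.
  move=> y0; rewrite e0 ler_expR lerN2 ler_pM2l// lerDl !mulr_ge0// ltW//.
have eg y : 0 <= ex c y by rewrite expR_ge0.
split; apply: normr_Rintegral_le => //.
- by apply: cont_meas; exact: cont_fun (der_y_re c).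
- move=> y /mem0y y0; apply: le_trans (le _ y0); rewrite normrM (ger0_norm (eg _)).
  by rewrite ler_piMr//; exact: cos_max.
- by apply: cont_meas; exact: cont_fun (der_y_im c).
- move=> y /mem0y y0; apply: le_trans (le _ y0); rewrite normrM (ger0_norm (eg _)).
  by rewrite ler_piMr//; exact: sin_max.
Qed.

Local Lemma int_exp (a : R) : 0 < a ->
  leb.-integrable `[0, +oo[ (EFin \o (fun y : R => expR (- (a * y)))) /\
  \int[leb]_(y in `[0, +oo[) expR (- (a * y)) = a^-1.
Proof.
move=> a0.
have mD : measurable (`[0, +oo[%classic : set R) by exact: measurable_itv.
have ce : continuous (fun y : R => expR (- (a * y))).
  by move=> y; eapply der_continuous; repeat der1.
(* From exp(a y) >= (1 + a y / 2)^2: the coefficient 4 / a^2 turns the square of a y / 2 into y^2,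
   and the 1 covers the constant term. *)
pose C := 1 + 4 / a ^+ 2.
have bd (y : R) : 0 <= y -> expR (- (a * y)) <= C * (1 + y ^+ 2)^-1.
  move=> y0; have y1 : 0 < 1 + y ^+ 2 by rewrite ltr_pwDl// sqr_ge0.
  rewrite expRN ler_pdivlMr// mulrC ler_pdivrMr ?expR_gt0//.
  have h1 := expR_ge1Dx (a * y / 2).
  have ay : 0 <= a * y / 2 by rewrite divr_ge0// mulr_ge0// ltW.
  have h2 : (1 + a * y / 2) ^+ 2 <= expR (a * y).
    have -> : expR (a * y) = expR (a * y / 2) ^+ 2.
      by rewrite expr2 -expRD; congr expR; field.
    by rewrite ler_pXn2r// nnegrE ?expR_ge0//; lra.
  have C0 : 0 <= C by rewrite addr_ge0// divr_ge0// sqr_ge0.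
  apply: le_trans (ler_wpM2l C0 h2); rewrite /C.
  have -> : (1 + 4 / a ^+ 2) * (1 + a * y / 2) ^+ 2 = 1 + y ^+ 2 + (a * y) * (1 + a * y / 4)
     + 4 / a ^+ 2 * (1 + a * y) by field; rewrite gt_eqF.
  rewrite -addrA lerDl addr_ge0// !mulr_ge0// ?invr_ge0 ?sqr_ge0//; nra.
have ie : leb.-integrable `[0, +oo[ (EFin \o (fun y : R => expR (- (a * y)))).
  apply: integrable_dom (integrable_cauchyZ C mD) => //; first exact: cont_meas.
  by move=> y /mem0y y0; rewrite ger0_norm ?expR_ge0// bd.
split=> //.
have hF y : is_derive y 1 (fun y => - a^-1 * expR (- (a * y))) (expR (- (a * y))).
  by der; field; rewrite gt_eqF.
have hC y : 0 <= y -> `|- a^-1 * expR (- (a * y))| <= a^-1 * C * (1 + y ^+ 2)^-1.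
  move=> y0; rewrite normrM (ger0_norm (expR_ge0 _)) normrN normfV (gtr0_norm a0).
  by rewrite -[leRHS]mulrA ler_pM2l ?invr_gt0// bd.
by rewrite (Rintegral_FTCy ce hF ie hC) mulr0 oppr0 expR0 mulr1 opprK.
Qed.

(** Dropping exp(- m y^2) leaves exp(- 2 m s c y), whose integral over the half line is the
    bound. *)
Lemma erfc_decay c : 0 < c ->
  `|erfc_re c| <= (2 * m * s * c)^-1 /\ `|erfc_im c| <= (2 * m * s * c)^-1.
Proof.
move=> c0.
have a0 : 0 < 2 * m * s * c by rewrite !mulr_gt0.
have mD : measurable (`[0, +oo[%classic : set R) by exact: measurable_itv.
have [i0 i1] := int_exp a0; rewrite -i1.
have le y : ex c y <= expR (- (2 * m * s * c * y)).
  have h : 0 <= m * y ^+ 2 by rewrite mulr_ge0 ?sqr_ge0// ltW.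
  by rewrite ler_expR lerN2; lra.
have eg y : 0 <= ex c y by rewrite expR_ge0.
split; apply: normr_Rintegral_le => //.
- by apply: cont_meas; exact: cont_fun (der_y_re c).
- move=> y _; apply: le_trans (le y); rewrite normrM (ger0_norm (eg _)).
  by rewrite ler_piMr//; exact: cos_max.
- by apply: cont_meas; exact: cont_fun (der_y_im c).
- move=> y _; apply: le_trans (le y); rewrite normrM (ger0_norm (eg _)).
  by rewrite ler_piMr//; exact: sin_max.
Qed.

End FresnelErfc.

(** * Oscillatory integrals of functions of bounded variation *)

Section Oscillation.
Context {R : realType}.
Notation leb := (@lebesgue_measure R).
Implicit Types (a b c t u v x y : R).

Lemma pi_le4 : pi <= 4 :> R.
Proof. by have := @pihalf_lt2 R; lra. Qed.

(** The real part of - exp(i c) H(v) / (s (1 - i)) with m = 1, hence the primitive of cos(t v^2 + c)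
    that vanishes at +oo. The free phase c also covers the sine, through c = - pi/2. *)
Definition fresnel_prim t c v : R :=
  let s := Num.sqrt (t / 2) in
  (cos c * (erfc_im 1 s v - erfc_re 1 s v) +
   sin c * (erfc_re 1 s v + erfc_im 1 s v)) / (2 * s).

Section Fixed.
Context (t c : R) (t0 : 0 < t).
Local Notation s := (Num.sqrt (t / 2)).

Local Lemma s_gt0 : 0 < s. Proof. by rewrite sqrtr_gt0 divr_gt0. Qed.

Local Lemma s_sqr : s ^+ 2 = t / 2.
Proof. by rewrite sqr_sqrtr// ltW// divr_gt0. Qed.

Lemma der_fresnel_prim v : is_derive v 1 (fresnel_prim t c) (cos (t * v ^+ 2 + c)).
Proof.
have s0 := s_gt0.
have h1 := der_erfc_re ltr01 s0 v; have h2 := der_erfc_im ltr01 s0 v.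
rewrite /fresnel_prim; notypeclasses refine (is_derive_eq _ _).
  notypeclasses refine (derM (derD (derM (der_cst _ _) (derD h2 (derN h1)))
    (derM (der_cst _ _) (derD h1 h2))) (der_cst _ _)).
rewrite /= mulr1 s_sqr cosD.
have -> : 2 * (t / 2) * v ^+ 2 = t * v ^+ 2 by field.
by field; rewrite gt_eqF.
Qed.

Local Lemma comb_bound (p r B : R) : `|p| <= B -> `|r| <= B ->
  `|(cos c * (r - p) + sin c * (p + r)) / (2 * s)| <= 2 * B / s.
Proof.
move=> hp hr; have s0 := s_gt0.
have B0 : 0 <= B := le_trans (normr_ge0 _) hp.
rewrite normrM normfV (gtr0_norm (mulr_gt0 (ltr0Sn _ 1) s0)) ler_pdivrMr ?mulr_gt0//.
have -> : 2 * B / s * (2 * s) = 2 * B + 2 * B by field; rewrite gt_eqF.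
apply: (le_trans (ler_normD _ _)); rewrite !normrM; apply: lerD.
  apply: (@le_trans _ _ `|r - p|); first by rewrite ler_piMl// cos_max.
  by apply: (le_trans (ler_normB _ _)); lra.
apply: (@le_trans _ _ `|p + r|); first by rewrite ler_piMl// sin_max.
by apply: (le_trans (ler_normD _ _)); lra.
Qed.

Local Lemma erfc0_le1 : erfc_re 1 s 0 <= 1 /\ 0 <= erfc_re 1 s 0.
Proof.
rewrite (erfc_re0 ltr01 s_gt0) divr1; split; last by rewrite divr_ge0.
rewrite ler_pdivrMr// mul1r -[leRHS](@ger0_norm _ 2)// -sqrtr_sqr.
by rewrite ler_sqrt ?sqr_ge0// expr2; have := pi_le4; lra.
Qed.

Lemma fresnel_prim_bound v : `|fresnel_prim t c v| <= 6 / s.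
Proof.
have s0 := s_gt0; have [k1 k0] := erfc0_le1.
(* For v < 0 reflection gives |H_re(v)| <= 2 H_re(0) + |H_re(-v)|, and H_re(0) <= 1: this is the
   3. *)
have -> : 6 / s = 2 * 3 / s by congr (_ / _); ring.
apply: comb_bound.
- have [v0|/ltW v0] := leP 0 v.
    by have [h _] := erfc_bound ltr01 s0 v0; lra.
  have := erfc_reN ltr01 s0 v.
  have [h _] := @erfc_bound _ _ _ ltr01 s0 (- v) ltac:(lra).
  by move: h; rewrite !ler_norml; lra.
- have [v0|/ltW v0] := leP 0 v.
    by have [_ h] := erfc_bound ltr01 s0 v0; lra.
  have := erfc_imN ltr01 s0 v.
  have [_ h] := @erfc_bound _ _ _ ltr01 s0 (- v) ltac:(lra).
  by move: h; rewrite !ler_norml; lra.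
Qed.

Lemma fresnel_prim_decay v : 0 < v -> `|fresnel_prim t c v| <= 2 / (t * v).
Proof.
move=> v0; have s0 := s_gt0.
have [h1 h2] := erfc_decay ltr01 s0 v0.
apply: (le_trans (comb_bound h1 h2)).
have -> : t * v = 2 * s ^+ 2 * v by rewrite s_sqr; field.
by rewrite le_eqVlt; apply/orP; left; apply/eqP; field; rewrite !gt_eqF.
Qed.

(** By the reflection formula an increment over [a, b] equals the one over [-b, -a]. This moves
    segments of the negative axis to the positive one, where the primitive decays. *)
Lemma fresnel_primN a b : fresnel_prim t c b - fresnel_prim t c a =
  fresnel_prim t c (- a) - fresnel_prim t c (- b).
Proof.
have s0 := s_gt0.
have ra := erfc_reN ltr01 s0 a; have rb := erfc_reN ltr01 s0 b.
have ia := erfc_imN ltr01 s0 a; have ib := erfc_imN ltr01 s0 b.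
rewrite /fresnel_prim.
have -> : erfc_re 1 s (- a) = 2 * erfc_re 1 s 0 - erfc_re 1 s a by lra.
have -> : erfc_re 1 s (- b) = 2 * erfc_re 1 s 0 - erfc_re 1 s b by lra.
have -> : erfc_im 1 s (- a) = - erfc_im 1 s a by lra.
have -> : erfc_im 1 s (- b) = - erfc_im 1 s b by lra.
ring.
Qed.

(** For |u| <= 2 boundedness of the primitive suffices: 12/s times (3/2) s times 5/2 is 45 <= 60.
    For |u| > 2 the segment from u to x + u stays at distance at least |u|/2 from 0 on one side, so
    the decay applies at both ends, after reflection if u < 0; this gives the 16 / sqrt t. *)
Lemma fresnel_osc_bound x u : 0 <= x <= 1 ->
  `|fresnel_prim t c (x + u) - fresnel_prim t c u| <=
    (60 + 16 / Num.sqrt t) / (Num.sqrt t * Num.sqrt (1 + u ^+ 2)).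
Proof.
move=> x01; have s0 := s_gt0.
have q0 : 0 < Num.sqrt t by rewrite sqrtr_gt0.
have qq : t = Num.sqrt t * Num.sqrt t by rewrite -expr2 sqr_sqrtr// ltW.
have u1 : 0 < 1 + u ^+ 2 by rewrite ltr_pwDl// sqr_ge0.
set r := Num.sqrt (1 + u ^+ 2).
have r0 : 0 < r by rewrite sqrtr_gt0.
have rr : r ^+ 2 = 1 + u ^+ 2 by rewrite sqr_sqrtr// ltW.
have rle z : 0 <= z -> 1 + u ^+ 2 <= z ^+ 2 -> r <= z.
  by move=> z0 h; rewrite -(ger0_norm z0) -sqrtr_sqr ler_sqrt// sqr_ge0.
have sq : Num.sqrt t <= 3 / 2 * s.
  have -> : 3 / 2 * s = Num.sqrt (9 / 8 * t).
    have -> : 9 / 8 * t = (3 / 2) ^+ 2 * (t / 2) by field.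
    by rewrite [RHS]sqrtrM ?sqr_ge0// sqrtr_sqr ger0_norm//.
  by rewrite ler_sqrt; nra.
rewrite ler_pdivlMr ?mulr_gt0//.
have [ule|ult] := leP `|u| 2.
  have r3 : r <= 5 / 2.
    by apply: rle => //; move: ule; rewrite ler_norml => /andP[]; nra.
  have h : `|fresnel_prim t c (x + u) - fresnel_prim t c u| <= 12 / s.
    apply: (le_trans (ler_normB _ _)).
    have -> : 12 / s = 6 / s + 6 / s by field; rewrite gt_eqF.
    by apply: lerD; exact: fresnel_prim_bound.
  apply: (@le_trans _ _ (12 / s * (3 / 2 * s * (5 / 2)))).
    apply: ler_pM => //; first by rewrite mulr_ge0// ltW.
    by apply: ler_pM => //; exact: ltW.
  have -> : 12 / s * (3 / 2 * s * (5 / 2)) = 45 by field; rewrite gt_eqF.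
  have : 0 <= 16 / Num.sqrt t by rewrite divr_ge0// ltW.
  by lra.
have ru : r <= 2 * `|u|.
  apply: rle; first by rewrite mulr_ge0.
  by have e := real_normK (num_real u); rewrite exprMn; nra.
have fin (B : R) : 0 <= B -> B <= 8 / (t * `|u|) ->
    B * (Num.sqrt t * r) <= 60 + 16 / Num.sqrt t.
  move=> B0 hB; have u0 : 0 < `|u| by lra.
  apply: (@le_trans _ _ (8 / (t * `|u|) * (Num.sqrt t * (2 * `|u|)))).
    apply: ler_pM => //; first by rewrite mulr_ge0// ltW.
    by rewrite ler_pM2l.
  have -> : 8 / (t * `|u|) * (Num.sqrt t * (2 * `|u|)) = 16 / Num.sqrt t.
    by rewrite {1}qq; field; rewrite !gt_eqF.
  by lra.
have dec v : `|u| / 2 <= v -> `|fresnel_prim t c v| <= 4 / (t * `|u|).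
  move=> hv; have v0 : 0 < v by lra.
  apply: (le_trans (fresnel_prim_decay v0)).
  rewrite ler_pdivrMr ?mulr_gt0// mulrAC ler_pdivlMr ?mulr_gt0//; last lra.
  have h : t * (`|u| / 2) <= t * v by rewrite ler_pM2l.
  by lra.
apply: fin; first exact: normr_ge0.
have -> : 8 / (t * `|u|) = 4 / (t * `|u|) + 4 / (t * `|u|) by ring.
have [u0|u0] := leP 0 u.
  have e : `|u| = u by rewrite ger0_norm.
  apply: (le_trans (ler_normB _ _)); apply: lerD; apply: dec; rewrite e; lra.
have e : `|u| = - u by rewrite ltr0_norm.
rewrite fresnel_primN.
apply: (le_trans (ler_normB _ _)); apply: lerD; apply: dec; rewrite e; lra.
Qed.

End Fixed.

Lemma sum_abel (h g : nat -> R) N :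
  \sum_(0 <= j < N) h j.+1 * (g j.+1 - g j) =
  h N * g N - h 0%N * g 0%N - \sum_(0 <= j < N) (h j.+1 - h j) * g j.
Proof.
elim: N => [|N IH]; first by rewrite !big_geq//; ring.
by rewrite !big_nat_recr//= IH; ring.
Qed.

(* Total variation is only tested along the partitions of [0, 1] into [m * p]
   equal intervals, for one fixed [m] and all [p]. *)
Definition bounded_var (h : R -> R) (K : R) := exists2 m : nat, (0 < m)%N &
  forall p, (0 < p)%N -> let N := (m * p)%N in
  `|h 1| + \sum_(0 <= j < N) `|h (j.+1%:R / N%:R) - h (j%:R / N%:R)| <= K.

Definition unif_cont (h : R -> R) := forall e, 0 < e -> exists2 d, 0 < d &
  forall u v, 0 <= u -> u <= v -> v <= 1 -> v - u < d -> `|h v - h u| < e.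

Lemma Rintegral_itv_cst a b e : a <= b ->
  \int[leb]_(x in `[a, b]) e = e * (b - a).
Proof.
move=> ab; rewrite mulrBr.
apply: (@Rintegral_FTC _ (fun=> e) (fun x => e * x)) => //.
  by move=> x; exact: cvg_cst.
by move=> x; der; ring.
Qed.

Lemma Rintegral_itv_split (g : R -> R) x y : 0 <= x -> x <= y ->
  leb.-integrable `[0, y] (EFin \o g) ->
  \int[leb]_(z in `[0, y]) g z =
  \int[leb]_(z in `[0, x]) g z + \int[leb]_(z in `[x, y]) g z.
Proof.
move=> x0 xy ig; apply/eqP; rewrite addrC -subr_eq; apply/eqP.
rewrite Rintegral_itvB ?bnd_simp//.
rewrite Rintegral_itv_obnd_cbnd//.
apply: integrableS ig => //.
by move=> z /=; rewrite !in_itv/= => /andP[? ?]; lra.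
Qed.

(** No derivative of [h] occurs. On each cell of a fine partition [h] is replaced by its value at
    the right end; the resulting sum is summed by parts, so that only the variation of [h] and the
    size of G - G(0) remain. The mesh affects only the error [e]. *)
Lemma abel_bound (h g G : R -> R) (K L B : R) :
  measurable_fun setT h -> bounded_var h K -> unif_cont h ->
  (forall x, 0 <= x <= 1 -> `|h x| <= L) ->
  continuous g -> (forall x, `|g x| <= 1) ->
  (forall x, is_derive x 1 G (g x)) ->
  (forall x, 0 <= x <= 1 -> `|G x - G 0| <= B) ->
  `|\int[leb]_(x in `[0, 1]) (h x * g x)| <= K * B.
Proof.
move=> mh [m m0 bh] uh hL cg g1 dG GB.
have B0 : 0 <= B by apply: le_trans (GB 0 _); rewrite ?normr_ge0 ?lexx ?ler01.
have fin x : (leb `[0%R, x] < +oo)%E.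
  by rewrite lebesgue_measure_itv/=; case: ifP => _; rewrite ?ltry// -EFinD ltry.
have mhg D : measurable_fun D (fun x => h x * g x).
  by apply: measurable_funM; [exact: measurable_funTS | exact: cont_meas].
have L0 : 0 <= L by apply: le_trans (hL 0 _); rewrite ?normr_ge0 ?lexx ?ler01.
have ihg y : y <= 1 -> leb.-integrable `[0, y] (EFin \o (fun x => h x * g x)).
  move=> y1; apply: (@integrable_bd _ _ _ leb _ _ L); first exact: measurable_itv.
  - exact: fin.
  - exact: mhg.
  move=> x /=; rewrite in_itv/= => /andP[x0 xy].
  rewrite normrM -[L]mulr1; apply: ler_pM => //; apply: hL; lra.
apply/ler_addgt0Pr => e e0.
have [d d0 hd] := uh _ e0.
(* [m] is prescribed by [bounded_var]; refining by [p] brings the mesh below the modulus of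
   continuity without leaving the partitions whose variation is controlled. *)
have [p p0 hp] : exists2 p, (0 < p)%N & (m * p)%:R^-1 < d.
  have [p hp] : exists p : nat, d^-1 < p%:R.
    by exists (Num.truncn d^-1).+1; exact: truncnS_gt.
  have di : 0 < d^-1 by rewrite invr_gt0.
  have p0 : (0 < p)%N by rewrite -(ltr0n R) (lt_trans di).
  exists p => //; rewrite invf_plt ?posrE ?ltr0n ?muln_gt0 ?m0//.
  by apply: (lt_le_trans hp); rewrite ler_nat leq_pmull.
set N := (m * p)%N in hp.
have N0 : (0 < N)%N by rewrite muln_gt0 m0.
have NR : 0 < N%:R :> R by rewrite ltr0n.
pose z (j : nat) : R := j%:R / N%:R.
have z0 j : 0 <= z j by rewrite divr_ge0.
have zS j : z j.+1 = z j + N%:R^-1 by rewrite /z -natr1 mulrDl mul1r.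
have z1 j : (j <= N)%N -> z j <= 1.
  by move=> jN; rewrite ler_pdivrMr// mul1r ler_nat.
pose gam j := G (z j) - G 0.
(* Each cell costs at most [e] times its length, since |g| <= 1, so the errors up to z_j add up to e
   z_j. *)
have key j : (j <= N)%N ->
  `|\int[leb]_(x in `[0, z j]) (h x * g x) -
    \sum_(0 <= i < j) h (z i.+1) * (gam i.+1 - gam i)| <= e * z j.
  elim: j => [_|j IH jN].
    rewrite big_geq// subr0 /z mul0r set_itv1 Rintegral_set1 normr0 mulr0.
    exact: lexx.
  have zz : z j <= z j.+1 by rewrite zS lerDl invr_ge0.
  rewrite (@Rintegral_itv_split _ (z j))// ?ihg ?z1//.
  rewrite big_nat_recr//=.
  have i1 : leb.-integrable `[z j, z j.+1] (EFin \o (fun x => h x * g x)).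
    apply: integrableS (ihg _ (z1 _ jN)) => //.
    by move=> x /=; rewrite !in_itv/=; have := z0 j; lra.
  have i2 : leb.-integrable `[z j, z j.+1] (EFin \o (fun x => h (z j.+1) * g x)).
    by apply: integrableZ_real => //; apply: integrable_itvcc; exact: cont_within.
  have E : h (z j.+1) * (gam j.+1 - gam j) =
      \int[leb]_(x in `[z j, z j.+1]) (h (z j.+1) * g x).
    rewrite RintegralZl//; last first.
      by apply: integrable_itvcc; exact: cont_within.
    by rewrite (Rintegral_FTC zz cg dG) /gam; congr (_ * _); ring.
  have step : `|\int[leb]_(x in `[z j, z j.+1]) (h x * g x) -
     h (z j.+1) * (gam j.+1 - gam j)| <= e * N%:R^-1.
    rewrite E -RintegralB//.
    have -> : e * N%:R^-1 = \int[leb]_(x in `[z j, z j.+1]) e.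
      by rewrite Rintegral_itv_cst// zS; congr (_ * _); ring.
    apply: normr_Rintegral_le => //.
    - apply: measurable_funB; first exact: mhg.
      by apply: measurable_funM; [exact: measurable_cst | exact: cont_meas].
    - move=> x /=; rewrite in_itv/= => /andP[xa xb].
      rewrite -mulrBl normrM -[e]mulr1; apply: ler_pM => //.
      rewrite distrC ltW//; apply: hd => //.
      + by have := z0 j; lra.
      + exact: z1.
      + by apply: le_lt_trans hp; rewrite zS; lra.
    - by apply: integrable_itvcc; apply: cont_within => x; exact: cvg_cst.
  have -> : e * z j.+1 = e * z j + e * N%:R^-1 by rewrite zS mulrDr.
  have -> (a1 a2 b1 b2 : R) : a1 + a2 - (b1 + b2) = (a1 - b1) + (a2 - b2) by ring.
  by apply: (le_trans (ler_normD _ _)); apply: lerD => //; apply: IH; exact: ltnW.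
have zN : z N = 1 by rewrite /z divff// gt_eqF.
have := key N (leqnn _); rewrite zN mulr1.
rewrite (sum_abel (fun j => h (z j)) gam) zN.
have -> : gam 0%N = 0 by rewrite /gam /z mul0r subrr.
rewrite mulr0 subr0 => k1.
have k2 : `|h 1 * gam N - \sum_(0 <= j < N) (h (z j.+1) - h (z j)) * gam j| <= K * B.
  apply: (le_trans (ler_normB _ _)).
  apply: (@le_trans _ _ ((`|h 1| + \sum_(0 <= j < N) `|h (z j.+1) - h (z j)|) * B)).
    rewrite mulrDl; apply: lerD.
      by rewrite normrM ler_wpM2l// /gam zN GB// ler01 lexx.
    rewrite mulr_suml; apply: (le_trans (ler_norm_sum _ _ _)).
    rewrite big_nat_cond [leRHS]big_nat_cond; apply: ler_sum => j.
    rewrite andbT => /andP[_ jN]; rewrite normrM ler_wpM2l//.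
    by apply: GB; rewrite z0 z1// ltnW.
  by rewrite ler_wpM2r//; exact: bh.
have -> : \int[leb]_(x in `[0, 1]) (h x * g x) =
  (\int[leb]_(x in `[0, 1]) (h x * g x) - (h 1 * gam N -
     \sum_(0 <= j < N) (h (z j.+1) - h (z j)) * gam j)) + (h 1 * gam N -
     \sum_(0 <= j < N) (h (z j.+1) - h (z j)) * gam j) by rewrite subrK.
by apply: (le_trans (ler_normD _ _)); rewrite addrC lerD.
Qed.

Lemma osc_integral_bound (h : R -> R) (K L t c u : R) : 0 < t ->
  measurable_fun setT h -> bounded_var h K -> unif_cont h ->
  (forall x, 0 <= x <= 1 -> `|h x| <= L) ->
  `|\int[leb]_(x in `[0, 1]) (h x * cos (t * (x + u) ^+ 2 + c))| <=
  K * ((60 + 16 / Num.sqrt t) / (Num.sqrt t * Num.sqrt (1 + u ^+ 2))).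
Proof.
move=> t0 mh bh uh hL.
apply: (@abel_bound h (fun x => cos (t * (x + u) ^+ 2 + c)) (fun x => fresnel_prim t c (x + u)) K L _ mh bh uh hL).
- by move=> x; eapply der_continuous; repeat der1.
- by move=> x; exact: cos_max.
- move=> x; apply: is_derive_eq.
    exact: (der_comp (g := fun y => y + u) (der_fresnel_prim c t0 (x + u))
      (derD (der_id x) (der_cst u x))).
  by rewrite addr0 mulr1.
- by move=> x x01; rewrite add0r; exact: fresnel_osc_bound.
Qed.

Lemma abs_cont_unif_cont (f : R -> R) : abs_cont 0 1 f -> unif_cont f.
Proof.
move=> ac e e0; have [d d0 hd] := ac e e0; exists d => // u v u0 uv v1 uvd.
have := hd 1%N (fun=> u) (fun=> v); rewrite !big_ord1; apply => //.
by move=> i j; rewrite !ord1 eqxx.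
Qed.

(** Take d for e = 1 and m > 1/d. The m p cells split into m blocks of p cells with total length 1/m
    < d, so each block contributes less than 1, whatever p is. *)
Lemma abs_cont_bounded_var (f : R -> R) : abs_cont 0 1 f ->
  exists K, bounded_var f K.
Proof.
move=> ac; have [d d0 hd] := ac 1 ltr01.
have [m hm] : exists m : nat, d^-1 < m%:R.
  by exists (Num.truncn d^-1).+1; exact: truncnS_gt.
have di : 0 < d^-1 by rewrite invr_gt0.
have m0 : (0 < m)%N by rewrite -(ltr0n R) (lt_trans di).
exists (`|f 1| + m%:R); exists m => // p p0; cbv zeta.
set N := (m * p)%N; rewrite lerD2l.
have N0 : 0 < N%:R :> R by rewrite ltr0n muln_gt0 m0.
pose D j := `|f (j.+1%:R / N%:R) - f (j%:R / N%:R)|.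
have key i : (i <= m)%N -> \sum_(0 <= j < i * p) D j <= i%:R.
  elim: i => [_|i IH im]; first by rewrite mul0n big_geq.
  rewrite mulSn addnC (@big_cat_nat _ _ _ (i * p)%N)//=; last exact: leq_addr.
  rewrite -natr1; apply: lerD; first by apply: IH; exact: ltnW.
  rewrite -{1}[(i * p)%N]add0n big_addn addKn big_mkord.
  apply/ltW/hd => [r|r r' rr'|].
  - split; first by rewrite divr_ge0.
    split; first by rewrite ler_pM2r ?invr_gt0// ler_nat.
    rewrite ler_pdivrMr// mul1r ler_nat /N.
    apply: (@leq_trans (i * p + p)%N); first by rewrite addnC -addnS leq_add2l.
    by rewrite -mulSnr leq_mul2r im orbT.
  - case: (ltngtP r r') => [h|h|h].
    + by left; rewrite ler_pM2r ?invr_gt0// ler_nat ltn_add2r.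
    + by right; rewrite ler_pM2r ?invr_gt0// ler_nat ltn_add2r.
    + by move: rr'; rewrite (val_inj h) eqxx.
  - under eq_bigr => r _ do rewrite -mulrBl -natr1 addrAC subrr add0r mul1r.
    rewrite sumr_const card_ord.
    have -> : N%:R^-1 *+ p = m%:R^-1 :> R.
      rewrite -mulr_natl /N natrM; field.
      by rewrite !pnatr_eq0 -!lt0n m0.
    by rewrite invf_plt ?posrE ?ltr0n.
by have := key m (leqnn _).
Qed.

Lemma within_cont_bounded (f : R -> R) : {within `[0, 1], continuous f} ->
  exists2 M, 0 <= M & forall x, 0 <= x <= 1 -> `|f x| <= M.
Proof.
move=> cf.
have [c _ hc] := EVT_max ler01 cf; have [c' _ hc'] := EVT_min ler01 cf.
exists (`|f c| + `|f c'|); first by rewrite addr_ge0.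
move=> x x01; have xI : x \in `[0, 1]%R by rewrite in_itv.
have h1 := hc _ xI; have h2 := hc' _ xI.
have := ler_norm (f c); have := ler_norm (- f c'); rewrite normrN.
have := normr_ge0 (f c); have := normr_ge0 (f c').
by rewrite ler_norml; lra.
Qed.

Lemma bounded_varM (f g : R -> R) (K L V : R) : 0 <= L -> bounded_var f K ->
  (forall x, 0 <= x <= 1 -> `|f x| <= L) ->
  (forall x, 0 <= x <= 1 -> `|g x| <= 1) ->
  (forall N, (0 < N)%N -> \sum_(0 <= j < N) `|g (j.+1%:R / N%:R) - g (j%:R / N%:R)| <= V) ->
  bounded_var (fun x => f x * g x) (K + L * V).
Proof.
move=> L0 [m m0 hf] fL g1 gV; exists m => // p p0; cbv zeta.
set N := (m * p)%N.
have N0 : (0 < N)%N by rewrite muln_gt0 m0.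
have NR : 0 < N%:R :> R by rewrite ltr0n.
have z0 j : 0 <= j%:R / N%:R :> R by rewrite divr_ge0.
have z1 j : (j <= N)%N -> j%:R / N%:R <= 1 :> R.
  by move=> jN; rewrite ler_pdivrMr// mul1r ler_nat.
have i1 : 0 <= (1 : R) <= 1 by lra.
apply: (@le_trans _ _ (`|f 1| + (\sum_(0 <= j < N) `|f (j.+1%:R / N%:R) - f (j%:R / N%:R)|
   + \sum_(0 <= j < N) L * `|g (j.+1%:R / N%:R) - g (j%:R / N%:R)|))); last first.
  rewrite addrA; apply: lerD; first exact: hf.
  by rewrite -mulr_sumr ler_wpM2l// gV.
apply: lerD; first by rewrite normrM ler_piMr// g1.
rewrite -big_split/= big_nat_cond [leRHS]big_nat_cond; apply: ler_sum => j.
rewrite andbT => /andP[_ jN].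
set a := j.+1%:R / _; set b := j%:R / _.
have -> : f a * g a - f b * g b = (f a - f b) * g a + f b * (g a - g b) by ring.
apply: (le_trans (ler_normD _ _)); rewrite !normrM; apply: lerD.
  by rewrite ler_piMr// g1// z0 z1.
by rewrite ler_wpM2r// fL// z0 z1// ltnW.
Qed.

Lemma unif_contM (f g : R -> R) (L M : R) : 0 <= L -> 0 <= M ->
  unif_cont f -> (forall x, 0 <= x <= 1 -> `|f x| <= L) ->
  (forall x, 0 <= x <= 1 -> `|g x| <= 1) ->
  (forall u v, 0 <= u -> u <= v -> v <= 1 -> `|g v - g u| <= M * (v - u)) ->
  unif_cont (fun x => f x * g x).
Proof.
move=> L0 M0 uf fL g1 gM e e0.
have e2 : 0 < e / 2 by rewrite divr_gt0.
have [d d0 hd] := uf _ e2.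
have LM : 0 < L * M + 1 by rewrite ltr_wpDl// mulr_ge0.
exists (Num.min d (e / 2 / (L * M + 1))).
  by rewrite lt_min d0/= divr_gt0.
move=> u v u0 uv v1; rewrite lt_min => /andP[h1 h2].
have -> : f v * g v - f u * g u = (f v - f u) * g v + f u * (g v - g u) by ring.
apply: (le_lt_trans (ler_normD _ _)); rewrite !normrM.
have -> : e = e / 2 + e / 2 by field.
apply: ltr_leD.
  apply: le_lt_trans (hd _ _ u0 uv v1 h1); rewrite ler_piMr// g1//; lra.
apply: (@le_trans _ _ (L * (M * (v - u)))).
  by apply: ler_pM => //; [apply: fL; lra | exact: gM].
move: h2; rewrite ltr_pdivlMr// => h2; nra.
Qed.

(** The function is monotone, so the sum telescopes. The point is a bound independent of [al], which
    later depends on both t and y. *)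
Lemma expN_variation (al : R) (N : nat) : 0 <= al -> (0 < N)%N ->
  \sum_(0 <= j < N) `|expR (- (al * (j.+1%:R / N%:R))) - expR (- (al * (j%:R / N%:R)))| <= 1.
Proof.
move=> al0 N0.
have NR : 0 < N%:R :> R by rewrite ltr0n.
rewrite (eq_bigr (fun j : nat => expR (- (al * (j%:R / N%:R))) -
   expR (- (al * (j.+1%:R / N%:R))))); last first.
  move=> j _; rewrite distrC ger0_norm// subr_ge0 ler_expR lerN2.
  by rewrite ler_wpM2l// ler_pM2r ?invr_gt0// ler_nat.
rewrite (@telescope_sumr_eq _ 0 N (fun j : nat => - expR (- (al * (j%:R / N%:R)))))//; last first.
  by move=> j _; rewrite opprK addrC.
rewrite mul0r mulr0 oppr0 expR0 opprK addrC gerBl; exact: expR_ge0.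
Qed.

(** This constant grows with [al], harmlessly: it serves only uniform continuity, whose modulus does
    not enter the bound of [abel_bound]. *)
Lemma expN_lip (al u v : R) : 0 <= al -> 0 <= u -> u <= v ->
  `|expR (- (al * v)) - expR (- (al * u))| <= al * (v - u).
Proof.
move=> al0 u0 uv; rewrite distrC ger0_norm; last first.
  by rewrite subr_ge0 ler_expR lerN2 ler_wpM2l.
have := @der_ge _ (fun x => expR (- (al * x)) + al * x)
  (fun x => al * (1 - expR (- (al * x)))) u v uv.
move=> h; suff : expR (- (al * u)) + al * u <= expR (- (al * v)) + al * v by lra.
apply: h => x; first by move=> _; der; ring.
move=> /andP[ux _]; rewrite mulr_ge0// subr_ge0 -expR0 ler_expR oppr_le0.
by rewrite mulr_ge0//; lra.
Qed.

End Oscillation.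

(** * Bounds on psi *)

Section ComplexTools.
Context {R : realType}.
Implicit Types (z w : R[i]) (t u x y : R).

(** The l1 norm is submultiplicative and dominates both parts, which is all that the estimates need;
    no square root appears. *)
Definition nrm z := `|complex.Re z| + `|complex.Im z|.

Lemma nrm_ge0 z : 0 <= nrm z. Proof. by rewrite addr_ge0. Qed.

Lemma Re_le_nrm z : `|complex.Re z| <= nrm z.
Proof. by rewrite lerDl. Qed.

Lemma Im_le_nrm z : `|complex.Im z| <= nrm z.
Proof. by rewrite lerDr. Qed.

Lemma ReM z w : complex.Re (z * w) =
  complex.Re z * complex.Re w - complex.Im z * complex.Im w.
Proof. by case: z => ? ?; case: w. Qed.

Lemma ImM z w : complex.Im (z * w) =
  complex.Re z * complex.Im w + complex.Im z * complex.Re w.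
Proof. by case: z => ? ?; case: w. Qed.

Lemma ReD z w : complex.Re (z + w) = complex.Re z + complex.Re w.
Proof. by case: z => ? ?; case: w. Qed.

Lemma ImD z w : complex.Im (z + w) = complex.Im z + complex.Im w.
Proof. by case: z => ? ?; case: w. Qed.

Lemma nrmM z w : nrm (z * w) <= nrm z * nrm w.
Proof.
rewrite /nrm ReM ImM mulrDl !mulrDr -!normrM.
by apply: le_trans (lerD (ler_normB _ _) (ler_normD _ _)) _; lra.
Qed.

Lemma nrmD z w : nrm (z + w) <= nrm z + nrm w.
Proof.
rewrite /nrm ReD ImD.
by apply: le_trans (lerD (ler_normD _ _) (ler_normD _ _)) _; lra.
Qed.

Lemma nrm1 : nrm (1 : R[i]) = 1.
Proof. by rewrite /nrm /= normr1 normr0 addr0. Qed.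

Lemma nrmX z n : nrm (z ^+ n) <= nrm z ^+ n.
Proof.
elim: n => [|n IH]; first by rewrite !expr0 nrm1.
rewrite !exprS; apply: (le_trans (nrmM _ _)).
by rewrite ler_wpM2l ?nrm_ge0.
Qed.

Lemma eq_Complex (a b c d : R) : a = c -> b = d -> Complex a b = Complex c d.
Proof. by move=> -> ->. Qed.

Lemma cexpD z w : cexp (z + w) = cexp z * cexp w.
Proof.
rewrite /cexp ReD ImD expRD cosD sinD; case: z => a b; case: w => c d /=.
by apply: eq_Complex; ring.
Qed.

Lemma cexp0 : cexp (0 : R[i]) = 1.
Proof. by rewrite /cexp /= expR0 cos0 sin0 !mul1r. Qed.

Lemma cexp_sum n (z : 'I_n -> R[i]) :
  cexp (\sum_(i < n) z i) = \prod_(i < n) cexp (z i).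
Proof.
elim: n z => [|n IH] z; first by rewrite !big_ord0 cexp0.
by rewrite !big_ord_recr/= cexpD IH.
Qed.

Lemma sqrt_mitE t : 0 < t ->
  sqrt_mit t = Complex (Num.sqrt (t / 2)) (- Num.sqrt (t / 2)).
Proof. by move=> t0; rewrite /sqrt_mit gtr0_sg// gtr0_norm// mulN1r. Qed.

Lemma sqr_sqrt_half t : 0 < t -> Num.sqrt (t / 2) * Num.sqrt (t / 2) = t / 2.
Proof. by move=> t0; rewrite -expr2 sqr_sqrtr// ltW// divr_gt0. Qed.

Lemma psistar_exponent t u x : 0 < t ->
  - (Complex u 0 * sqrt_mit t + sqrt_mit t * Complex x 0) ^+ 2 =
  Complex 0 (t * (x + u) ^+ 2).
Proof.
move=> t0; rewrite sqrt_mitE//; have := sqr_sqrt_half t0.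
set s := Num.sqrt _ => ss.
have -> : t = 2 * (s * s) by rewrite ss; field.
by rewrite expr2 /=; simpc; apply: eq_Complex; ring.
Qed.

Lemma psi_right_exponent t y x : 0 < t ->
  - (Complex y 0 + sqrt_mit t * Complex x 0) ^+ 2 =
  Complex (- (y ^+ 2) - 2 * y * Num.sqrt (t / 2) * x)
          (t * x ^+ 2 + 2 * y * Num.sqrt (t / 2) * x).
Proof.
move=> t0; rewrite sqrt_mitE//; have := sqr_sqrt_half t0.
set s := Num.sqrt _ => ss.
have -> : t = 2 * (s * s) by rewrite ss; field.
by rewrite expr2 /=; simpc; apply: eq_Complex; ring.
Qed.

(** Here - y - s + s x = - (y + s (1 - x)), so this is the previous case with x replaced by 1 -
    x. *)
Lemma psi_left_exponent t y x : 0 < t ->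
  - (- Complex y 0 - sqrt_mit t + sqrt_mit t * Complex x 0) ^+ 2 =
  Complex (- (y ^+ 2) - 2 * y * Num.sqrt (t / 2) * (1 - x))
          (t * (1 - x) ^+ 2 + 2 * y * Num.sqrt (t / 2) * (1 - x)).
Proof.
move=> t0; rewrite -psi_right_exponent//; congr (- _).
have -> : (Complex (1 - x) 0 : R[i]) = 1 - Complex x 0.
  by simpc; apply: eq_Complex; ring.
by ring.
Qed.

End ComplexTools.

Section PsiBounds.
Context {R : realType}.
Notation leb := (@lebesgue_measure R).
Context (f : R -> R) (K L : R) (mf : measurable_fun setT f)
  (bf : bounded_var f K) (uf : unif_cont f) (L0 : 0 <= L)
  (fL : forall x, 0 <= x <= 1 -> `|f x| <= L).
Implicit Types (t u x y c : R).

Let rate t := 60 + 16 / Num.sqrt t.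

Lemma cos_shift x : sin x = cos (x - pi / 2).
Proof. by rewrite cosBpihalf. Qed.

Lemma psistarE t u : 0 < t -> psistar f t u =
  Complex (\int[leb]_(x in `[0, 1]) (f x * cos (t * (x + u) ^+ 2)))
          (\int[leb]_(x in `[0, 1]) (f x * sin (t * (x + u) ^+ 2))).
Proof.
move=> t0; rewrite /psistar /psi /cintegral; apply: eq_Complex;
  apply: eq_Rintegral => x _; rewrite psistar_exponent// /cexp /= expR0; ring.
Qed.

Lemma psistar_bound t u : 0 < t ->
  nrm (psistar f t u) <= 2 * K * (rate t / (Num.sqrt t * Num.sqrt (1 + u ^+ 2))).
Proof.
move=> t0; rewrite psistarE// /nrm /=.
have -> (A B : R) : 2 * A * B = A * B + A * B by ring.
apply: lerD.
  have := osc_integral_bound 0 u t0 mf bf uf fL.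
  by under eq_Rintegral do rewrite addr0.
have := osc_integral_bound (- (pi / 2)) u t0 mf bf uf fL.
by under eq_Rintegral do rewrite -cos_shift.
Qed.

(** The real part of the exponent of psi contributes exp(- al x), which is no oscillation. It is
    joined to the amplitude, whose variation stays bounded uniformly in [al]. *)
Let amp_facts al : 0 <= al ->
  [/\ measurable_fun setT (fun x => f x * expR (- (al * x))),
      bounded_var (fun x => f x * expR (- (al * x))) (K + L * 1),
      unif_cont (fun x => f x * expR (- (al * x))) &
      forall x, 0 <= x <= 1 -> `|f x * expR (- (al * x))| <= L].
Proof.
move=> al0.
have e1 x : 0 <= x <= 1 -> `|expR (- (al * x))| <= 1.
  move=> /andP[x0 _]; rewrite ger0_norm ?expR_ge0// -expR0 ler_expR oppr_le0.
  by rewrite mulr_ge0.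
split.
- apply: measurable_funM => //; apply: cont_meas => x.
  by eapply der_continuous; repeat der1.
- by apply: bounded_varM => // N N0; exact: expN_variation.
- apply: (unif_contM L0 al0) => // u v u0 uv _; exact: expN_lip.
- by move=> x x01; rewrite normrM -[L]mulr1 ler_pM// ?fL ?e1.
Qed.

Let amp_facts_rev al : 0 <= al ->
  [/\ measurable_fun setT (fun x => f x * expR (- (al * (1 - x)))),
      bounded_var (fun x => f x * expR (- (al * (1 - x)))) (K + L * 1),
      unif_cont (fun x => f x * expR (- (al * (1 - x)))) &
      forall x, 0 <= x <= 1 -> `|f x * expR (- (al * (1 - x)))| <= L].
Proof.
move=> al0.
have e1 x : 0 <= x <= 1 -> `|expR (- (al * (1 - x)))| <= 1.
  move=> /andP[_ x1]; rewrite ger0_norm ?expR_ge0// -[leRHS]expR0 ler_expR oppr_le0.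
  by rewrite mulr_ge0// subr_ge0.
split.
- apply: measurable_funM => //; apply: cont_meas => x.
  by eapply der_continuous; repeat der1.
- apply: bounded_varM => // N N0.
  apply: le_trans (expN_variation al0 N0).
  rewrite [leRHS]big_nat_rev/= big_nat_cond [leRHS]big_nat_cond.
  apply: ler_sum => j /[!andbT] /andP[_ jN]; rewrite add0n.
  have NR : N%:R != 0 :> R by rewrite pnatr_eq0 -lt0n.
  have E1 : ((N - j.+1).+1%:R / N%:R : R) = 1 - j%:R / N%:R.
    rewrite subnSK//; rewrite natrB; last exact: ltnW.
    by rewrite mulrBl divff.
  have E2 : ((N - j.+1)%:R / N%:R : R) = 1 - j.+1%:R / N%:R.
    by rewrite natrB// mulrBl divff.
  by rewrite E1 E2 distrC.
- apply: (unif_contM L0 al0) => // u v u0 uv v1.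
  rewrite distrC; have h1 : 0 <= 1 - v by lra.
  have h2 : 1 - v <= 1 - u by lra.
  by have := expN_lip al0 h1 h2; rewrite opprB [1 - u + _]addrC addrA subrK.
- by move=> x x01; rewrite normrM -[L]mulr1 ler_pM// ?fL ?e1.
Qed.

Lemma psi_rightE t y : 0 < t -> psi f t (Complex y 0) =
  Complex (\int[leb]_(x in `[0, 1]) (expR (- (y ^+ 2)) *
     (f x * expR (- (2 * y * Num.sqrt (t / 2) * x)) *
      cos (t * x ^+ 2 + 2 * y * Num.sqrt (t / 2) * x))))
   (\int[leb]_(x in `[0, 1]) (expR (- (y ^+ 2)) *
     (f x * expR (- (2 * y * Num.sqrt (t / 2) * x)) *
      sin (t * x ^+ 2 + 2 * y * Num.sqrt (t / 2) * x)))).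
Proof.
move=> t0; rewrite /psi /cintegral; apply: eq_Complex;
  apply: eq_Rintegral => x _; rewrite psi_right_exponent// /cexp /= expRD; ring.
Qed.

Lemma psi_leftE t y : 0 < t -> psi f t (- Complex y 0 - sqrt_mit t) =
  Complex (\int[leb]_(x in `[0, 1]) (expR (- (y ^+ 2)) *
     (f x * expR (- (2 * y * Num.sqrt (t / 2) * (1 - x))) *
      cos (t * (1 - x) ^+ 2 + 2 * y * Num.sqrt (t / 2) * (1 - x)))))
   (\int[leb]_(x in `[0, 1]) (expR (- (y ^+ 2)) *
     (f x * expR (- (2 * y * Num.sqrt (t / 2) * (1 - x))) *
      sin (t * (1 - x) ^+ 2 + 2 * y * Num.sqrt (t / 2) * (1 - x))))).
Proof.
move=> t0; rewrite /psi /cintegral; apply: eq_Complex;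
  apply: eq_Rintegral => x _; rewrite psi_left_exponent// /cexp /= expRD; ring.
Qed.

(** The phase enters as a completed square. The decay in the shift [u] is discarded here: exp(- y^2)
    already provides decay in y, while the rate 1 / sqrt t is kept. *)
Let amp_bound (h : R -> R) (g1 g2 : R -> R) t u c y : 0 < t ->
  measurable_fun setT h -> bounded_var h (K + L * 1) -> unif_cont h ->
  (forall x, 0 <= x <= 1 -> `|h x| <= L) ->
  (forall x, g1 x = t * (x + u) ^+ 2 + c) ->
  nrm (Complex
    (\int[leb]_(x in `[0, 1]) (expR (- (y ^+ 2)) * (h x * cos (g1 x))))
    (\int[leb]_(x in `[0, 1]) (expR (- (y ^+ 2)) * (h x * sin (g1 x))))) <=
  2 * (K + L) * (rate t / Num.sqrt t) * expR (- (y ^+ 2)).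
Proof.
move=> t0 mh bh uh hL gE.
have K0 : 0 <= K.
  case: bf => m m0 /(_ 1%N isT); apply: le_trans.
  by rewrite addr_ge0// sumr_ge0.
have q0 : 0 < Num.sqrt t by rewrite sqrtr_gt0.
have r0 : 0 <= rate t by rewrite addr_ge0// divr_ge0// ltW.
have fin : (leb `[0%R, 1%R] < +oo)%E by rewrite lebesgue_itvcc// ltry.
have ii (g : R -> R) : continuous g -> (forall x, `|g x| <= 1) ->
    leb.-integrable `[0, 1] (EFin \o (fun x => h x * g x)).
  move=> cg gb; apply: (@integrable_bd _ _ _ leb _ _ L) => //.
    by apply: measurable_funM; [exact: measurable_funTS | exact: cont_meas].
  move=> x /=; rewrite in_itv/= => x01.
  by rewrite normrM -[L]mulr1 ler_pM// hL.
have cc (c' : R) : continuous (fun x : R => cos (t * (x + u) ^+ 2 + c')).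
  by move=> x; eapply der_continuous; repeat der1.
have B c' : `|\int[leb]_(x in `[0, 1])
      (h x * cos (t * (x + u) ^+ 2 + c'))| <= (K + L) * (rate t / Num.sqrt t).
  apply: (le_trans (osc_integral_bound c' u t0 mh bh uh hL)).
  rewrite mulr1 ler_wpM2l ?addr_ge0// ler_wpM2l// lef_pV2 ?posrE//; last first.
    by rewrite mulr_gt0// sqrtr_gt0 ltr_pwDl// sqr_ge0.
  apply: ler_peMr; first exact: ltW.
  by rewrite -[leLHS]sqrtr1 ler_sqrt ?lerDl ?sqr_ge0// addr_ge0// sqr_ge0.
rewrite /nrm /=.
have -> : 2 * (K + L) * (rate t / Num.sqrt t) * expR (- (y ^+ 2)) =
  expR (- (y ^+ 2)) * ((K + L) * (rate t / Num.sqrt t)) +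
  expR (- (y ^+ 2)) * ((K + L) * (rate t / Num.sqrt t)) by ring.
apply: lerD.
  under eq_Rintegral do rewrite gE.
  rewrite RintegralZl//; last by apply: ii => // x; exact: cos_max.
  by rewrite normrM ger0_norm ?expR_ge0// ler_wpM2l ?expR_ge0// B.
under eq_Rintegral do rewrite gE cos_shift -addrA.
rewrite RintegralZl//; last by apply: ii => // x; exact: cos_max.
by rewrite normrM ger0_norm ?expR_ge0// ler_wpM2l ?expR_ge0// B.
Qed.

Lemma psi_right_bound t y : 0 < t -> 0 <= y ->
  nrm (psi f t (Complex y 0)) <=
  2 * (K + L) * (rate t / Num.sqrt t) * expR (- (y ^+ 2)).
Proof.
move=> t0 y0; rewrite psi_rightE//.
have al0 : 0 <= 2 * y * Num.sqrt (t / 2) by rewrite !mulr_ge0.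
have [h1 h2 h3 h4] := amp_facts al0.
(* Completing the square: t x^2 + 2 t be x = t (x + be)^2 - t be^2. *)
pose be := y * Num.sqrt (t / 2) / t.
apply: (@amp_bound (fun x => f x * expR (- (2 * y * Num.sqrt (t / 2) * x))) _
   (fun=> 0) t be (- (t * be ^+ 2))) => // x.
by rewrite /be; field; rewrite gt_eqF.
Qed.

Lemma psi_left_bound t y : 0 < t -> 0 <= y ->
  nrm (psi f t (- Complex y 0 - sqrt_mit t)) <=
  2 * (K + L) * (rate t / Num.sqrt t) * expR (- (y ^+ 2)).
Proof.
move=> t0 y0; rewrite psi_leftE//.
have al0 : 0 <= 2 * y * Num.sqrt (t / 2) by rewrite !mulr_ge0.
have [h1 h2 h3 h4] := amp_facts_rev al0.
pose be := y * Num.sqrt (t / 2) / t.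
apply: (@amp_bound (fun x => f x * expR (- (2 * y * Num.sqrt (t / 2) * (1 - x)))) _
   (fun=> 0) t (- 1 - be) (- (t * be ^+ 2))) => // x.
by rewrite /be; field; rewrite gt_eqF.
Qed.

End PsiBounds.

(** * Complex integrals and independence *)

Section ComplexIntegral.
Context d (T : measurableType d) (R : realType).
Context (mu : {measure set T -> \bar R}).
Implicit Types (D : set T) (g h : T -> R[i]) (z : R[i]).

Definition Cintegral D g : R[i] :=
  Complex (\int[mu]_(x in D) complex.Re (g x)) (\int[mu]_(x in D) complex.Im (g x)).

Definition Cintegrable D g :=
  mu.-integrable D (EFin \o (fun x => complex.Re (g x))) /\
  mu.-integrable D (EFin \o (fun x => complex.Im (g x))).

Definition Cmeasurable D g :=
  measurable_fun D (fun x => complex.Re (g x)) /\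
  measurable_fun D (fun x => complex.Im (g x)).

Lemma Cmeasurable_cst D z : Cmeasurable D (fun=> z).
Proof. by split; exact: measurable_cst. Qed.

Lemma CmeasurableM D g h : Cmeasurable D g -> Cmeasurable D h ->
  Cmeasurable D (fun x => g x * h x).
Proof.
move=> [g1 g2] [h1 h2]; split.
  under eq_fun do rewrite ReM.
  by apply: measurable_funB; apply: measurable_funM.
under eq_fun do rewrite ImM.
by apply: measurable_funD; apply: measurable_funM.
Qed.

Lemma CmeasurableD D g h : Cmeasurable D g -> Cmeasurable D h ->
  Cmeasurable D (fun x => g x + h x).
Proof.
move=> [g1 g2] [h1 h2]; split.
  by under eq_fun do rewrite ReD; exact: measurable_funD.
by under eq_fun do rewrite ImD; exact: measurable_funD.
Qed.

Lemma CmeasurableX D g n : Cmeasurable D g -> Cmeasurable D (fun x => g x ^+ n).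
Proof.
move=> mg; elim: n => [|n IH]; first exact: Cmeasurable_cst.
by under eq_fun do rewrite exprS; exact: CmeasurableM.
Qed.

Lemma Cmeasurable_prod (I : Type) (s : seq I) (Q : pred I) D (g : I -> T -> R[i]) :
  (forall i, Cmeasurable D (g i)) ->
  Cmeasurable D (fun x => \prod_(i <- s | Q i) g i x).
Proof.
move=> mg; elim: s => [|i s IH].
  by under eq_fun do rewrite big_nil; exact: Cmeasurable_cst.
under eq_fun do rewrite big_cons.
by case: (Q i) => //; exact: CmeasurableM.
Qed.

Lemma Cmeasurable_cexp D g : Cmeasurable D g -> Cmeasurable D (fun x => cexp (g x)).
Proof.
move=> [g1 g2]; split; rewrite /cexp /=; apply: measurable_funM.
- exact: (measurableT_comp (@measurable_expR R) g1).
- exact: (measurableT_comp (continuous_measurable_fun (@continuous_cos R)) g2).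
- exact: (measurableT_comp (@measurable_expR R) g1).
- exact: (measurableT_comp (continuous_measurable_fun (@continuous_sin R)) g2).
Qed.

Lemma Cintegrable_dom D g (h : T -> R) : measurable D -> Cmeasurable D g ->
  (forall x, D x -> nrm (g x) <= h x) -> mu.-integrable D (EFin \o h) ->
  Cintegrable D g.
Proof.
move=> mD [g1 g2] gh ih; split.
  apply: (integrable_dom mD g1 _ ih) => x Dx.
  exact: le_trans (Re_le_nrm _) (gh _ Dx).
apply: (integrable_dom mD g2 _ ih) => x Dx.
exact: le_trans (Im_le_nrm _) (gh _ Dx).
Qed.

Lemma CintegralZ D z g : measurable D -> Cintegrable D g ->
  Cintegral D (fun x => z * g x) = z * Cintegral D g.
Proof.
move=> mD [g1 g2]; rewrite /Cintegral; case: z => a b; simpc.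
apply: eq_Complex.
  under eq_Rintegral do rewrite ReM /=.
  rewrite RintegralB//; try exact: integrableZ_real.
  by rewrite !RintegralZl.
under eq_Rintegral do rewrite ImM /=.
rewrite RintegralD//; try exact: integrableZ_real.
by rewrite !RintegralZl.
Qed.

Lemma CintegralD D g h : measurable D -> Cintegrable D g -> Cintegrable D h ->
  Cintegral D (fun x => g x + h x) = Cintegral D g + Cintegral D h.
Proof.
move=> mD [g1 g2] [h1 h2]; rewrite /Cintegral; simpc; apply: eq_Complex.
  by under eq_Rintegral do rewrite ReD; rewrite RintegralD.
by under eq_Rintegral do rewrite ImD; rewrite RintegralD.
Qed.

Lemma eq_Cintegral D g h : (forall x, D x -> g x = h x) ->
  Cintegral D g = Cintegral D h.
Proof.
move=> gh; rewrite /Cintegral; apply: eq_Complex;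
  by apply: eq_Rintegral => x /set_mem Dx; rewrite gh.
Qed.

Lemma nrm_Cintegral D g (h : T -> R) : measurable D -> Cmeasurable D g ->
  (forall x, D x -> nrm (g x) <= h x) -> mu.-integrable D (EFin \o h) ->
  nrm (Cintegral D g) <= 2 * \int[mu]_(x in D) h x.
Proof.
move=> mD [g1 g2] gh ih; rewrite /nrm /=.
have -> : 2 * \int[mu]_(x in D) h x = \int[mu]_(x in D) h x + \int[mu]_(x in D) h x by ring.
apply: lerD; apply: normr_Rintegral_le => // x Dx.
  exact: le_trans (Re_le_nrm _) (gh _ Dx).
exact: le_trans (Im_le_nrm _) (gh _ Dx).
Qed.

End ComplexIntegral.

Section Expectation.
Context d (T : measurableType d) (R : realType) (P : probability T R).
Local Notation EC := (Cintegral P setT).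

Lemma integrable_prob (g : T -> R) (M : R) : measurable_fun setT g ->
  (forall w, `|g w| <= M) -> P.-integrable setT (EFin \o g).
Proof.
move=> mg gM; apply: (@integrable_bd _ _ _ P _ _ M) => //.
exact: le_lt_trans (probability_le1 P measurableT) (ltry 1).
Qed.

Lemma Rintegral_prob_cst (c : R) : \int[P]_w c = c.
Proof.
rewrite Rintegral_cst//; transitivity (c * fine (P setT)) => //.
by rewrite probability_setT mulr1.
Qed.

Lemma normr_Rintegral_prob (g : T -> R) (M : R) : measurable_fun setT g ->
  (forall w, `|g w| <= M) -> `|\int[P]_w g w| <= M.
Proof.
move=> mg gM; rewrite -[leRHS]Rintegral_prob_cst.
apply: normr_Rintegral_le => //.
by apply: (@integrable_prob _ `|M|) => //; exact: measurable_cst.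
Qed.

Lemma Cintegrable_prob (g : T -> R[i]) (M : R) : Cmeasurable setT g ->
  (forall w, nrm (g w) <= M) -> Cintegrable P setT g.
Proof.
move=> [g1 g2] gM; split; apply: (@integrable_prob _ M) => // w.
  exact: le_trans (Re_le_nrm _) (gM w).
exact: le_trans (Im_le_nrm _) (gM w).
Qed.

Lemma Rintegral_indic_preimage (Y : T -> R) (B : set R) : measurable_fun setT Y ->
  measurable B -> \int[P]_w \1_B (Y w) = fine (P (Y @^-1` B)).
Proof.
move=> mY mB.
have -> : (fun w => \1_B (Y w) : R) = \1_(Y @^-1` B).
  by apply/funext => w; rewrite !indicE.
rewrite /Rintegral integral_indic ?setIT//.
by rewrite -[_ @^-1` _]setTI; exact: mY.
Qed.

Lemma measurable_indic_comp (Y : T -> R) (B : set R) : measurable_fun setT Y ->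
  measurable B -> measurable_fun setT (fun w => \1_B (Y w) : R).
Proof.
by move=> mY mB; apply: (measurableT_comp _ mY); exact: measurable_indic.
Qed.

Lemma indic_norm_le1 (B : set R) x : `|\1_B x : R| <= 1.
Proof. by rewrite indicE; case: (_ \in _); rewrite ?normr1 ?normr0. Qed.

(** The sum counts the integers 1, ..., m that do not exceed r. It writes a bounded quantity, up to
    an error of 1, as a finite sum of indicators. *)
Lemma stair_sum (m : nat) (r : R) : 0 <= r -> r <= m.+1%:R ->
  r - 1 <= \sum_(0 <= j < m) \1_[set x : R | j.+1%:R <= x] r <= r.
Proof.
move=> r0.
have full k : k%:R <= r -> \sum_(0 <= j < k) \1_[set x : R | j.+1%:R <= x] r = k%:R :> R.
  move=> kr; rewrite (eq_big_nat _ _ (F2 := fun=> 1)).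
    by rewrite sumr_const_nat subn0.
  move=> j /andP[_ jk]; rewrite indicE mem_set//=.
  by rewrite (le_trans _ kr)// ler_nat.
elim: m => [|m IH] rm; first by rewrite big_geq//; lra.
have [mr|mr] := leP m.+1%:R r; first by rewrite full//; move: rm; rewrite -natr1; lra.
rewrite big_nat_recr//=.
have -> : \1_[set x : R | m.+1%:R <= x] r = 0 :> R.
  by rewrite indicE memNset//=; apply/negP; rewrite -ltNge.
by rewrite addr0; apply: IH; exact: ltW.
Qed.

(** Quantising g in steps of 1/k gives a finite combination of indicators of [Y], for which the
    factorisation holds by linearity. The quantised function is within 1/k of g uniformly, so the
    defect is at most 2M/k for every k. *)
Lemma indep_bounded (W : T -> R) (Y : T -> R) (g : R -> R) (M N : R) :
  measurable_fun setT W -> (forall w, `|W w| <= M) ->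
  measurable_fun setT Y -> measurable_fun setT g -> (forall x, `|g x| <= N) ->
  (forall B, measurable B -> \int[P]_w (W w * \1_B (Y w)) =
     (\int[P]_w W w) * \int[P]_w \1_B (Y w)) ->
  \int[P]_w (W w * g (Y w)) = (\int[P]_w W w) * \int[P]_w g (Y w).
Proof.
move=> mW WM mY mg gN ind.
have M0 : 0 <= M.
  have : `|\int[P]_w W w| <= M by exact: normr_Rintegral_prob.
  exact: le_trans.
have mgY : measurable_fun setT (fun w => g (Y w)) by exact: measurableT_comp.
(* An integer bound for |g|: then k (g + a) lies in [0, 2ak], and 2ak indicators suffice. *)
pose a := (Num.truncn `|N|).+1.
have aN x : `|g x| <= a%:R.
  apply: (le_trans (gN x)); apply: (le_trans (ler_norm _)).
  by apply/ltW; exact: truncnS_gt.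
have iW : P.-integrable setT (EFin \o W) by exact: integrable_prob mW WM.
suff key (k : nat) : (0 < k)%N ->
    `|\int[P]_w (W w * g (Y w)) - (\int[P]_w W w) * \int[P]_w g (Y w)| <= 2 * M / k%:R.
  apply/eqP; rewrite -subr_eq0 -normr_le0 leNgt; apply/negP.
  set e := `| _ | => e0.
  pose k := (Num.truncn (2 * M / e)).+1.
  have := key k isT; rewrite -/e leNgt => /negP; apply.
  rewrite ltr_pdivrMr ?ltr0n// [e * _]mulrC -ltr_pdivrMr//.
  exact: truncnS_gt.
move=> k0.
have kR : 0 < k%:R :> R by rewrite ltr0n.
pose B (j : nat) := [set x : R | j.+1%:R <= k%:R * (g x + a%:R)].
have mB j : measurable (B j).
  have mg' : measurable_fun setT (fun x => k%:R * (g x + a%:R)).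
    by apply: measurable_funM => //; apply: measurable_funD.
  have := mg' measurableT `[j.+1%:R, +oo[%classic (measurable_itv _).
  rewrite setTI; congr measurable; apply/seteqP; split=> x /=.
    by rewrite in_itv/= andbT.
  by rewrite /B /= in_itv/= andbT.
pose S w := \sum_(0 <= j < 2 * a * k) \1_(B j) (Y w) : R.
pose gk w := S w / k%:R - a%:R.
have approx w : `|g (Y w) - gk w| <= k%:R^-1.
  have h0 : 0 <= k%:R * (g (Y w) + a%:R).
    apply: mulr_ge0; first exact: ltW.
    by have := aN (Y w); rewrite ler_norml; lra.
  have h1 : k%:R * (g (Y w) + a%:R) <= (2 * a * k).+1%:R.
    have := aN (Y w); rewrite ler_norml => /andP[_ h].
    rewrite -natr1 !natrM; have : k%:R * (g (Y w) + a%:R) <= k%:R * (a%:R + a%:R) :> R.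
      by rewrite ler_pM2l// lerD2r.
    by lra.
  have /andP[] := stair_sum h0 h1.
  rewrite (eq_bigr (fun j => \1_(B j) (Y w) : R)); last first.
    by move=> j _; rewrite !indicE !mem_setE.
  rewrite -/(S w) => {}h1 h2.
  rewrite /gk -(ler_pM2l kR) -{1}(gtr0_norm kR) -normrM mulfV ?gt_eqF//.
  have -> : k%:R * (g (Y w) - (S w / k%:R - a%:R)) =
     k%:R * (g (Y w) + a%:R) - S w by field; rewrite gt_eqF.
  by rewrite ler_norml; lra.
have mS : measurable_fun setT S.
  by apply: measurable_sum => j; exact: measurable_indic_comp.
have mgk : measurable_fun setT gk.
  by apply: measurable_funB => //; apply: measurable_funM.
have S_le w : `|S w| <= (2 * a * k)%:R.
  apply: (le_trans (ler_norm_sum _ _ _)).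
  have -> : (2 * a * k)%:R = \sum_(0 <= j < 2 * a * k) (1 : R).
    by rewrite sumr_const_nat subn0.
  by apply: ler_sum => j _; exact: indic_norm_le1.
have sumE m : \int[P]_w (W w * \sum_(0 <= j < m) \1_(B j) (Y w)) =
    (\int[P]_w W w) * \int[P]_w \sum_(0 <= j < m) \1_(B j) (Y w).
  elim: m => [|m IH].
    under eq_Rintegral do rewrite big_geq// mulr0.
    under [X in _ = _ * X]eq_Rintegral do rewrite big_geq//.
    by rewrite Rintegral_prob_cst mulr0.
  under eq_Rintegral do rewrite big_nat_recr//= mulrDr.
  under [X in _ = _ * X]eq_Rintegral do rewrite big_nat_recr//=.
  have ms j : measurable_fun setT (fun w => \1_(B j) (Y w) : R).
    exact: measurable_indic_comp.
  have msum : measurable_fun setT (fun w => \sum_(0 <= j < m) \1_(B j) (Y w) : R).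
    by apply: measurable_sum.
  have bsum w : `|\sum_(0 <= j < m) \1_(B j) (Y w) : R| <= m%:R.
    apply: (le_trans (ler_norm_sum _ _ _)).
    have -> : m%:R = \sum_(0 <= j < m) (1 : R) by rewrite sumr_const_nat subn0.
    by apply: ler_sum => j _; exact: indic_norm_le1.
  rewrite RintegralD//; first last.
  - apply: (@integrable_prob _ (M * 1)); first exact: measurable_funM.
    by move=> w; rewrite normrM ler_pM// indic_norm_le1.
  - apply: (@integrable_prob _ (M * m%:R)); first exact: measurable_funM.
    by move=> w; rewrite normrM ler_pM.
  rewrite RintegralD//; first last.
  - by apply: (@integrable_prob _ 1) => // w; exact: indic_norm_le1.
  - exact: (@integrable_prob _ m%:R).
  by rewrite IH ind// mulrDr.
have iS : P.-integrable setT (EFin \o S) by exact: integrable_prob mS S_le.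
have iWS : P.-integrable setT (EFin \o (fun w => W w * S w)).
  apply: (@integrable_prob _ (M * (2 * a * k)%:R)); first exact: measurable_funM.
  by move=> w; rewrite normrM ler_pM.
have gkE : \int[P]_w (W w * gk w) = (\int[P]_w W w) * \int[P]_w gk w.
  have -> : \int[P]_w gk w = k%:R^-1 * \int[P]_w S w - a%:R.
    rewrite -[X in _ - X]Rintegral_prob_cst -RintegralZl// -RintegralB//.
    - by apply: eq_Rintegral => w _; rewrite /gk mulrC.
    - exact: integrableZ_real.
    - by apply: (@integrable_prob _ `|a%:R|).
  have -> : \int[P]_w (W w * gk w) = k%:R^-1 * \int[P]_w (W w * S w) - a%:R * \int[P]_w W w.
    rewrite -!RintegralZl// -RintegralB//; try exact: integrableZ_real.
    by apply: eq_Rintegral => w _; rewrite /gk; ring.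
  by rewrite sumE; ring.
have gk_le w : `|gk w| <= a%:R + k%:R^-1.
  have := approx w; have := aN (Y w); rewrite !ler_norml; lra.
have -> : \int[P]_w (W w * g (Y w)) - (\int[P]_w W w) * \int[P]_w g (Y w) =
   \int[P]_w (W w * (g (Y w) - gk w)) -
    (\int[P]_w W w) * \int[P]_w (g (Y w) - gk w).
  have i1 : P.-integrable setT (EFin \o (fun w => W w * g (Y w))).
    apply: (@integrable_prob _ (M * a%:R)); first exact: measurable_funM.
    by move=> w; rewrite normrM ler_pM.
  have i2 : P.-integrable setT (EFin \o (fun w => W w * gk w)).
    apply: (@integrable_prob _ (M * (a%:R + k%:R^-1))); first exact: measurable_funM.
    by move=> w; rewrite normrM ler_pM.
  under [X in _ = X - _]eq_Rintegral do rewrite mulrBr.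
  have i3 := integrable_prob mgY (fun w => aN (Y w)).
  have i4 := integrable_prob mgk gk_le.
  rewrite (RintegralB measurableT i1 i2) (RintegralB measurableT i3 i4) gkE; ring.
have kV : 0 <= k%:R^-1 :> R by rewrite invr_ge0 ltW.
have -> : 2 * M / k%:R = M * k%:R^-1 + M * k%:R^-1 by ring.
apply: (le_trans (ler_normB _ _)); apply: lerD.
  apply: normr_Rintegral_prob.
    by apply: measurable_funM => //; exact: measurable_funB.
  by move=> w; rewrite normrM ler_pM.
rewrite normrM ler_pM//; first exact: normr_Rintegral_prob.
by apply: normr_Rintegral_prob => //; exact: measurable_funB.
Qed.

Lemma eq_EC (g h : T -> R[i]) : g =1 h -> EC g = EC h.
Proof. by move=> gh; apply: eq_Cintegral => w _. Qed.

Lemma indep_bounded_complex (W : T -> R[i]) (Y : T -> R) (g : R -> R[i]) (M N : R) :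
  Cmeasurable setT W -> (forall w, nrm (W w) <= M) ->
  measurable_fun setT Y -> Cmeasurable setT g -> (forall x, nrm (g x) <= N) ->
  (forall B, measurable B -> EC (fun w => W w * Complex (\1_B (Y w)) 0) =
     EC W * Complex (\int[P]_w \1_B (Y w)) 0) ->
  EC (fun w => W w * g (Y w)) = EC W * EC (fun w => g (Y w)).
Proof.
move=> [mW1 mW2] WM mY [mg1 mg2] gN ind.
have W1 w : `|complex.Re (W w)| <= M by exact: le_trans (Re_le_nrm _) (WM w).
have W2 w : `|complex.Im (W w)| <= M by exact: le_trans (Im_le_nrm _) (WM w).
have g1 x : `|complex.Re (g x)| <= N by exact: le_trans (Re_le_nrm _) (gN x).
have g2 x : `|complex.Im (g x)| <= N by exact: le_trans (Im_le_nrm _) (gN x).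
have i1 B : measurable B -> \int[P]_w (complex.Re (W w) * \1_B (Y w)) =
    (\int[P]_w complex.Re (W w)) * \int[P]_w \1_B (Y w).
  move=> /ind/(congr1 (@complex.Re R)); rewrite ReM /= mulr0 subr0 => <-.
  by apply: eq_Rintegral => w _; rewrite ReM /= mulr0 subr0.
have i2 B : measurable B -> \int[P]_w (complex.Im (W w) * \1_B (Y w)) =
    (\int[P]_w complex.Im (W w)) * \int[P]_w \1_B (Y w).
  move=> /ind/(congr1 (@complex.Im R)); rewrite ImM /= mulr0 add0r => <-.
  by apply: eq_Rintegral => w _; rewrite ImM /= mulr0 add0r.
have mgY1 : measurable_fun setT (fun w => complex.Re (g (Y w))).
  exact: (measurableT_comp mg1 mY).
have mgY2 : measurable_fun setT (fun w => complex.Im (g (Y w))).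
  exact: (measurableT_comp mg2 mY).
have ip (a b : T -> R) : measurable_fun setT a -> measurable_fun setT b ->
    (forall w, `|a w| <= M) -> (forall w, `|b w| <= N) ->
    P.-integrable setT (EFin \o (fun w => a w * b w)).
  move=> ma mb aM bN; apply: (@integrable_prob _ (M * N)).
    exact: measurable_funM.
  by move=> w; rewrite normrM ler_pM.
rewrite /Cintegral; simpc; apply: eq_Complex.
  under eq_Rintegral do rewrite ReM.
  rewrite RintegralB//; [|exact: ip|exact: ip].
  rewrite (indep_bounded (g := fun x => complex.Re (g x)) mW1 W1 mY mg1 g1 i1).
  by rewrite (indep_bounded (g := fun x => complex.Im (g x)) mW2 W2 mY mg2 g2 i2).
under eq_Rintegral do rewrite ImM.
rewrite RintegralD//; [|exact: ip|exact: ip].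
rewrite (indep_bounded (g := fun x => complex.Im (g x)) mW1 W1 mY mg2 g2 i1).
by rewrite (indep_bounded (g := fun x => complex.Re (g x)) mW2 W2 mY mg1 g1 i2).
Qed.

Lemma nrm_prod_le (I : Type) (s : seq I) (Q : pred I) (z : I -> R[i]) (M : R) :
  1 <= M -> (forall i, nrm (z i) <= M) ->
  nrm (\prod_(i <- s | Q i) z i) <= M ^+ size s.
Proof.
move=> M1 zM; elim: s => [|i s IH]; first by rewrite big_nil nrm1 expr0.
have M0 : 0 <= M by apply: le_trans M1.
rewrite big_cons /=; case: (Q i); last first.
  by apply: (le_trans IH); rewrite exprS ler_peMl// exprn_ge0.
by apply: (le_trans (nrmM _ _)); rewrite exprS ler_pM ?nrm_ge0.
Qed.

(* Independence is given for indicators; they are replaced by the [g i] one at a time. *)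
Lemma expectation_prod n (Y : 'I_n -> T -> R) (g : 'I_n -> R -> R[i]) (M : R) :
  (forall i, measurable_fun setT (Y i)) -> mutually_independent P Y ->
  (forall i, Cmeasurable setT (g i)) -> (forall i x, nrm (g i x) <= M) ->
  EC (fun w => \prod_(i < n) g i (Y i w)) = \prod_(i < n) EC (fun w => g i (Y i w)).
Proof.
move=> mY ind mg gM.
pose h (m : nat) (B : 'I_n -> set R) (i : 'I_n) (x : R) : R[i] :=
  if (i < m)%N then g i x else Complex (\1_(B i) x) 0.
pose M' := `|M| + 1.
have M1 : 1 <= M' by rewrite lerDr.
have hM m B i x : nrm (h m B i x) <= M'.
  rewrite /h; case: ifP => _.
    by apply: (le_trans (gM i x)); apply: (le_trans (ler_norm _)); rewrite lerDl.
  rewrite /nrm /= normr0 addr0; apply: (le_trans (indic_norm_le1 _ _)).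
  by rewrite lerDr.
have mh m B i : (forall i, measurable (B i)) -> Cmeasurable setT (fun w => h m B i (Y i w)).
  move=> mB; rewrite /h; case: (i < m)%N; split => /=.
  - exact: (measurableT_comp (mg i).1 (mY i)).
  - exact: (measurableT_comp (mg i).2 (mY i)).
  - exact: measurable_indic_comp.
  - exact: measurable_cst.
have mYB i (B : set R) : measurable B -> measurable (Y i @^-1` B).
  by move=> mB; rewrite -[_ @^-1` _]setTI; exact: mY.
have key m : (m <= n)%N -> forall B, (forall i, measurable (B i)) ->
    EC (fun w => \prod_(i < n) h m B i (Y i w)) =
    \prod_(i < n) EC (fun w => h m B i (Y i w)).
  elim: m => [_|m IH mn] B mB.
    have prodC (I : Type) (s : seq I) (a : I -> R) :
        \prod_(i <- s) (Complex (a i) 0 : R[i]) = Complex (\prod_(i <- s) a i) 0.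
      elim: s => [|i s IH]; first by rewrite !big_nil.
      by rewrite !big_cons IH; simpc; apply: eq_Complex; ring.
    rewrite (eq_EC (h := fun w => Complex (\prod_(i < n) \1_(B i) (Y i w)) 0)); last first.
      by move=> w; rewrite /h /= prodC.
    rewrite (eq_bigr (fun i => Complex (fine (P (Y i @^-1` B i))) 0)); last first.
      move=> i _; rewrite /Cintegral /h /=; apply: eq_Complex.
        exact: Rintegral_indic_preimage.
      exact: Rintegral_prob_cst.
    rewrite prodC /Cintegral /=; apply: eq_Complex; last exact: Rintegral_prob_cst.
    have -> : (fun w => \prod_(i < n) \1_(B i) (Y i w)) =
       \1_(\bigcap_(i in [set: 'I_n]) (Y i @^-1` B i)) :> (T -> R).
      apply/funext => w; rewrite indicE.
      have [hw|hw] := boolP (w \in _).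
        rewrite big1// => i _; rewrite indicE mem_set//.
        by move/set_mem: hw; apply.
      have [i hi] : exists i, ~ B i (Y i w).
        apply/existsNP => hall; move/negP: hw; apply; apply/mem_set => i _.
        exact: hall.
      by rewrite (bigD1 i)//= indicE memNset// mul0r.
    rewrite /Rintegral integral_indic ?setIT//; last first.
      by apply: fin_bigcap_measurable => // i _; exact: mYB.
    have E : (P (\bigcap_(i in [set: 'I_n]) (Y i @^-1` B i)) =
        (\prod_(i < n) fine (P (Y i @^-1` B i)))%:E)%E.
      rewrite (ind B mB) -prodEFin; apply: eq_bigr => i _; rewrite fineK//.
      by apply: fin_num_measure; exact: mYB.
    exact: (congr1 fine E).
  pose i0 := Ordinal mn.
  pose W w := \prod_(i < n | i != i0) h m B i (Y i w).
  have hS (B' : 'I_n -> set R) i : i != i0 -> (forall j, j != i0 -> B' j = B j) ->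
      h m.+1 B i = h m B' i /\ h m B' i = h m B i.
    move=> ii0 BB; rewrite /h ltnS leq_eqVlt.
    have -> : (i == m :> nat) = false.
      by apply/negbTE; move: ii0; rewrite -val_eqE.
    by rewrite /= BB.
  (* The induction hypothesis with the set at position m replaced by an arbitrary [B']: the product
     of the other factors is uncorrelated with every indicator of [Y i0]. *)
  have E1 (B' : set R) : measurable B' ->
      EC (fun w => W w * Complex (\1_B' (Y i0 w)) 0) =
      (\prod_(i < n | i != i0) EC (fun w => h m B i (Y i w))) *
      Complex (\int[P]_w \1_B' (Y i0 w)) 0.
    move=> mB'.
    pose BB i := if i == i0 then B' else B i.
    have mBB i : measurable (BB i) by rewrite /BB; case: ifP.
    have BBn j : j != i0 -> BB j = B j by rewrite /BB => /negbTE ->.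
    have BB0 : h m BB i0 = fun x => Complex (\1_B' x) 0.
      by rewrite /h ltnn /BB eqxx.
    have := IH (ltnW mn) BB mBB.
    rewrite [X in _ = X](bigD1 i0)//= mulrC => e.
    rewrite (eq_EC (h := fun w => \prod_(i < n) h m BB i (Y i w))); last first.
      move=> w; rewrite [RHS](bigD1 i0)//= mulrC BB0 /W; congr (_ * _).
      by apply: eq_bigr => i ii0; rewrite (hS _ _ ii0 BBn).2.
    rewrite e; congr (_ * _).
      by apply: eq_bigr => i ii0; rewrite (hS _ _ ii0 BBn).2.
    rewrite BB0 /Cintegral /=; apply: eq_Complex => //; exact: Rintegral_prob_cst.
  (* With [B'] the whole line the m-th factor disappears, which identifies the expectation of [W]
     itself. *)
  have EW : EC W = \prod_(i < n | i != i0) EC (fun w => h m B i (Y i w)).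
    have := E1 setT measurableT.
    rewrite (eq_EC (h := W)); last by move=> w; rewrite indicT /= mulr1.
    move=> ->; rewrite [X in _ * X](_ : _ = 1) ?mulr1//.
    by apply: eq_Complex => //; rewrite indicT Rintegral_prob_cst.
  have mW : Cmeasurable setT W by apply: Cmeasurable_prod => i; exact: mh.
  have WM w : nrm (W w) <= M' ^+ size (index_enum 'I_n) by exact: nrm_prod_le.
  rewrite (eq_EC (h := fun w => W w * g i0 (Y i0 w))); last first.
    move=> w; rewrite (bigD1 i0)//= mulrC; congr (_ * _).
      by apply: eq_bigr => i ii0; rewrite (hS B i ii0 (fun _ _ => erefl)).1.
    by rewrite /h ltnSn.
  rewrite (indep_bounded_complex mW WM (mY i0) (mg i0) (gM i0)); last first.
    by move=> B' mB'; rewrite E1// EW.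
  rewrite [RHS](bigD1 i0)//= mulrC EW; congr (_ * _).
    by apply: eq_EC => w; rewrite /h ltnSn.
  by apply: eq_bigr => i ii0; rewrite (hS B i ii0 (fun _ _ => erefl)).1.
have := key n (leqnn _) (fun=> setT) (fun=> measurableT).
rewrite (eq_EC (h := fun w => \prod_(i < n) g i (Y i w))); last first.
  by move=> w; apply: eq_bigr => i _; rewrite /h ltn_ord.
move=> ->; apply: eq_bigr => i _; apply: eq_EC => w; by rewrite /h ltn_ord.
Qed.

(** [f] need not be nonnegative pointwise, so it is not turned into a measure. The change of
    variables uses the Radon-Nikodym derivative of the law of [Y], which equals [f] almost
    everywhere because both have the same integral over every measurable set. *)
Lemma expectation_density (Y : T -> R) (f g : R -> R) (N : R) :
  measurable_fun setT Y -> is_density_of P Y f ->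
  measurable_fun setT g -> (forall x, `|g x| <= N) ->
  \int[P]_w g (Y w) = \int[lebesgue_measure]_x (f x * g x).
Proof.
move=> mY [mf fd] mg gN.
have mY' : @measurable_fun _ _ T (measurableTypeR R) setT Y by exact: mY.
pose X : {mfun T >-> measurableTypeR R} :=
  @mfun_Sub _ _ T (measurableTypeR R) Y (mem_set mY').
pose nu : probability (measurableTypeR R) R := distribution P X.
pose leb : {sigma_finite_measure set (measurableTypeR R) -> \bar R} := @lebesgue_measure R.
pose nuc := charge_of_finite_measure nu.
have nuE A : measurable A -> nu A = (\int[leb]_(x in A) (f x)%:E)%E.
  by move=> mA; rewrite -fd.
have dom : nu `<< leb.
  apply/null_content_dominatesP => A mA A0; rewrite nuE//.
  by apply: null_set_integral => //; exact/measurable_funTS/measurable_EFinP.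
have mf' : measurable_fun setT (EFin \o f) by exact/measurable_EFinP.
have iRN := @Radon_Nikodym_integrable _ _ _ nuc leb dom.
have mRN := measurable_int _ iRN.
have RNf : ae_eq leb setT
    (Radon_Nikodym nuc leb) (EFin \o f).
  apply: integral_ae_eq => //.
  by move=> E _ mE; rewrite -(@Radon_Nikodym_integral _ _ _ nuc leb _ dom)// -nuE.
have iY : P.-integrable setT ((EFin \o g) \o X).
  apply: (@integrable_prob (fun w => g (Y w)) N) => // ; exact: measurableT_comp.
have mg' : measurable_fun setT (EFin \o g) by exact/measurable_EFinP.
have ig : nu.-integrable setT (EFin \o g).
  by apply: (@integrable_bd _ _ _ nu _ _ N) => //; exact: le_lt_trans (probability_le1 nu measurableT) (ltry 1).
rewrite /Rintegral; congr fine.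
transitivity (\int[nu]_x (EFin \o g) x)%E.
  by rewrite integral_distribution.
rewrite -(Radon_Nikodym_change_of_variables dom measurableT ig).
apply: ae_eq_integral => //.
- exact: emeasurable_funM.
- by apply/measurable_EFinP; exact: measurable_funM.
apply: filterS RNf => x h _ /=; rewrite [X in (_ * X)%E](h I) /= EFinM.
exact: muleC.
Qed.

End Expectation.

(** * Powers of psi as expectations *)

Section Fubini.
Context d (T : measurableType d) (R : realType) (P : probability T R).
Notation leb := (@lebesgue_measure R).
Local Notation unit_itv := (`[0, 1]%classic : set R).
Local Notation half_line := (`[0, +oo[%classic : set R).

Lemma Rintegral_fubini (D : set R) (g : T -> R -> R) (h : R -> R) :
  measurable D -> measurable_fun setT (fun z : T * R => g z.1 z.2) ->
  (forall w u, D u -> `|g w u| <= h u) -> leb.-integrable D (EFin \o h) ->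
  [/\ \int[P]_w (\int[leb]_(u in D) g w u) = \int[leb]_(u in D) (\int[P]_w g w u),
      measurable_fun D (fun u => \int[P]_w g w u) &
      measurable_fun setT (fun w => \int[leb]_(u in D) g w u)].
Proof.
move=> mD mg gh ih.
pose lebs : {sigma_finite_measure set (measurableTypeR R) -> \bar R} := leb.
pose F (z : T * measurableTypeR R) : \bar R := (g z.1 z.2 * \1_D z.2)%:E.
have m2 : measurable_fun setT (snd : T * measurableTypeR R -> measurableTypeR R).
  exact: measurable_snd.
have mI : measurable_fun setT (fun z : T * measurableTypeR R => \1_D z.2 : R).
  by apply: (measurableT_comp _ m2); exact: measurable_indic.
have mF : measurable_fun setT F.
  by apply/measurable_EFinP; apply: measurable_funM.
have ihD : leb.-integrable setT (EFin \o (h \_ D)).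
  by have := (@integrable_mkcond _ _ _ leb D (EFin \o h) mD).1 ih; rewrite restrict_EFin.
have Fh z : (`|F z| <= ((h \_ D) z.2)%:E)%E.
  rewrite /F lee_fin patchE indicE; case: ifPn => [/set_mem Dz|_].
    by rewrite mulr1 gh.
  by rewrite mulr0 normr0.
have h0 u : 0 <= (h \_ D) u.
  rewrite patchE; case: ifPn => // /set_mem Du.
  exact: le_trans (normr_ge0 _) (gh point u Du).
(* The majorant depends on u only, so integrating over the probability space first leaves at most
   [h]. *)
have iF : (P \x lebs)%E.-integrable setT F.
  apply/(integrable21ltyP) => //.
  apply: (@le_lt_trans _ _ (\int[lebs]_u ((h \_ D) u)%:E)%E).
    apply: ge0_le_integral => //.
    - by move=> u _; apply: integral_ge0 => w _; exact: abse_ge0.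
    - apply: (@measurable_fun_fubini_tonelli_G _ _ _ _ _ P (abse \o F)).
        exact: measurableT_comp.
      by move=> z; exact: abse_ge0.
    - by have := measurable_int _ ihD.
    move=> u _; apply: (@le_trans _ _ (\int[P]_w ((h \_ D) u)%:E)%E).
      apply: ge0_le_integral => //.
      apply: measurableT_comp => //.
      exact: (measurableT_comp mF (measurable_pair2 u)).
    rewrite integral_cst//.
    rewrite -[leRHS]mule1 lee_wpmul2l ?lee_fin//.
    exact: (probability_le1 P measurableT).
  have /integrableP[_] := ihD; apply: le_lt_trans.
  apply: ge0_le_integral => //.
  - by move=> u _; rewrite lee_fin.
  - by have := measurable_int _ ihD.
  - by apply: measurableT_comp => //; have := measurable_int _ ihD.
  - by move=> u _; rewrite lee_fin ler_norm.
have E1 w : fubini_F lebs F w = (\int[leb]_(u in D) (g w u)%:E)%E.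
  rewrite /fubini_F [RHS]integral_mkcond; apply: eq_integral => u _.
  by rewrite /F patchE /= indicE; case: ifPn => _; rewrite ?mulr1 ?mulr0.
have bw w : leb.-integrable D (EFin \o g w).
  apply: (@integrable_dom _ _ _ leb D (g w) h) => //; last exact: gh.
  apply: measurable_funTS.
  exact: (measurableT_comp mg (measurable_pair1 w)).
have E1r w : (fubini_F lebs F w = (\int[leb]_(u in D) g w u)%:E)%E.
  by rewrite E1 /Rintegral fineK//; exact: (integrable_fin_num _ (bw w)).
have E2 u : D u -> fubini_G P F u = (\int[P]_w (g w u)%:E)%E.
  move=> Du; rewrite /fubini_G; apply: eq_integral => w _.
  by rewrite /F /= indicE mem_set// mulr1.
have E2r u : D u -> (fubini_G P F u = (\int[P]_w g w u)%:E)%E.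
  move=> Du; rewrite E2// /Rintegral fineK//; apply: integrable_fin_num => //.
  apply: (@integrable_prob _ _ _ P (fun w => g w u) (h u)).
    exact: (measurableT_comp mg (measurable_pair2 u)).
  by move=> w; exact: gh.
have E3 u : ~ D u -> fubini_G P F u = 0%E.
  move=> Du; rewrite /fubini_G /F; under eq_integral.
    by move=> w _; rewrite /= indicE memNset// mulr0; over.
  exact: integral0.
have mG : measurable_fun setT (fubini_G P F) := measurable_fubini_G iF.
have mFF : measurable_fun setT (fubini_F lebs F) := measurable_fubini_F iF.
split.
- have := Fubini iF; rewrite -/(fubini_F _ _) -/(fubini_G _ _) => e.
  have e1 : (\int[P]_x \int[lebs]_y F (x, y) = \int[P]_w (\int[leb]_(u in D) g w u)%:E)%E.
    by apply: eq_integral => w _; exact: E1r.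
  have e2 : (\int[lebs]_y \int[P]_x F (x, y) = \int[leb]_(u in D) (\int[P]_w g w u)%:E)%E.
    rewrite [RHS]integral_mkcond; apply: eq_integral => u _.
    rewrite patchE; case: ifPn => [/set_mem Du|/negP Du]; first exact: E2r.
    by apply: E3 => Du'; apply: Du; exact: mem_set.
  by rewrite /Rintegral; congr fine; rewrite -e1 -e2.
- apply/measurable_EFinP.
  apply: (eq_measurable_fun (fubini_G P F)); last exact: measurable_funTS.
  by move=> u /set_mem Du; exact: E2r.
- apply/measurable_EFinP.
  apply: (eq_measurable_fun (fubini_F lebs F)) => //.
Qed.

Lemma Cintegral_fubini (D : set R) (g : T -> R -> R[i]) (h : R -> R) :
  measurable D -> Cmeasurable setT (fun z : T * R => g z.1 z.2) ->
  (forall w u, D u -> nrm (g w u) <= h u) -> leb.-integrable D (EFin \o h) ->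
  [/\ Cintegral P setT (fun w => Cintegral leb D (g w)) =
        Cintegral leb D (fun u => Cintegral P setT (fun w => g w u)),
      Cmeasurable D (fun u => Cintegral P setT (fun w => g w u)) &
      Cmeasurable setT (fun w => Cintegral leb D (g w))].
Proof.
move=> mD [mg1 mg2] gh ih.
have [a1 a2 a3] := Rintegral_fubini (g := fun w u => complex.Re (g w u)) mD mg1
  (fun w u Du => le_trans (Re_le_nrm _) (gh w u Du)) ih.
have [b1 b2 b3] := Rintegral_fubini (g := fun w u => complex.Im (g w u)) mD mg2
  (fun w u Du => le_trans (Im_le_nrm _) (gh w u Du)) ih.
by split; [rewrite /Cintegral /= a1 b1 | split | split].
Qed.

End Fubini.

Section PowerAsExpectation.
Context d (T : measurableType d) (R : realType) (P : probability T R).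
Context (n : nat) (Y : 'I_n -> T -> R) (f : R -> R).
Context (n0 : (0 < n)%N) (mY : forall i, measurable_fun setT (Y i))
  (Y01 : forall i w, 0 <= Y i w <= 1)
  (fY : forall i, is_density_of P (Y i) f) (indY : mutually_independent P Y).
Notation leb := (@lebesgue_measure R).
Local Notation unit_itv := (`[0, 1]%classic : set R).
Local Notation half_line := (`[0, +oo[%classic : set R).
Notation EC := (Cintegral P setT).
Implicit Types (t u y : R) (z : R[i]) (w : T).

Lemma nrm_cexp z : nrm (cexp z) <= 2 * expR (nrm z).
Proof.
rewrite /nrm /cexp /= !normrM !(ger0_norm (expR_ge0 _)).
have -> : 2 * expR (`|complex.Re z| + `|complex.Im z|) =
  expR (nrm z) * 1 + expR (nrm z) * 1 by rewrite /nrm; ring.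
have h : expR (complex.Re z) <= expR (nrm z).
  by rewrite ler_expR (le_trans (ler_norm _))// Re_le_nrm.
by apply: lerD; apply: ler_pM; rewrite ?expR_ge0 ?cos_max ?sin_max.
Qed.

(** The kernels may grow exponentially outside [0, 1]. Multiplying by the indicator of [0, 1] makes
    them bounded and changes nothing at the values of [Y i]. *)
Lemma expectation_density_complex i (g : R -> R[i]) (N : R) :
  Cmeasurable setT g -> (forall x, 0 <= x <= 1 -> nrm (g x) <= N) ->
  EC (fun w => g (Y i w)) = cintegral `[0, 1] (fun x => Complex (f x) 0 * g x).
Proof.
move=> [mg1 mg2] gN.
have key (r : R -> R) : measurable_fun setT r ->
    (forall x, 0 <= x <= 1 -> `|r x| <= N) ->
    \int[P]_w r (Y i w) = \int[leb]_(x in `[0, 1]) (f x * r x).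
  move=> mr rN.
  have N0 : 0 <= N by apply: le_trans (rN 0 _); rewrite ?normr_ge0 ?lexx ?ler01.
  pose r' x := r x * \1_(`[0, 1] : set R) x.
  have -> : \int[P]_w r (Y i w) = \int[P]_w r' (Y i w).
    apply: eq_Rintegral => w _.
    by rewrite /r' indicE mem_set ?mulr1//= in_itv/= Y01.
  rewrite (expectation_density (N := N) (mY i) (fY i)).
  - rewrite [RHS]Rintegral_mkcond; apply: eq_Rintegral => x _.
    by rewrite /r' patchE indicE; case: ifPn => _; rewrite ?mulr1 ?mulr0.
  - by apply: measurable_funM => //; exact: measurable_indic.
  - move=> x; rewrite /r' indicE; case: (boolP (x \in _)) => [/set_mem|_].
      by rewrite /= in_itv/= mulr1; exact: rN.
    by rewrite mulr0 normr0.
rewrite /Cintegral /cintegral; apply: eq_Complex.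
  rewrite (key (fun x => complex.Re (g x)) mg1); last first.
    by move=> x x01; exact: le_trans (Re_le_nrm _) (gN x x01).
  by apply: eq_Rintegral => x _; rewrite ReM /= mul0r subr0.
rewrite (key (fun x => complex.Im (g x)) mg2); last first.
  by move=> x x01; exact: le_trans (Im_le_nrm _) (gN x x01).
by apply: eq_Rintegral => x _; rewrite ImM /= mul0r addr0.
Qed.

Let kern t z x : R[i] := cexp (- (z + sqrt_mit t * Complex x 0) ^+ 2).

Lemma Cmeasurable_kern d' (T' : measurableType d') t z (g : T' -> R) (D : set T') : measurable_fun D g ->
  Cmeasurable D (fun w : T' => kern t z (g w)).
Proof.
move=> mg; apply: Cmeasurable_cexp.
have -> : (fun w : T' => - (z + sqrt_mit t * Complex (g w) 0) ^+ 2) =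
  (fun w : T' => (- 1) * (z + sqrt_mit t * Complex (g w) 0) ^+ 2).
  by apply/funext => w; rewrite mulN1r.
apply: CmeasurableM; first exact: Cmeasurable_cst.
apply: CmeasurableX; apply: CmeasurableD; first exact: Cmeasurable_cst.
apply: CmeasurableM; first exact: Cmeasurable_cst.
by split => //=; exact: measurable_cst.
Qed.

Lemma nrmN z : nrm (- z) = nrm z.
Proof. by rewrite /nrm; case: z => a b /=; rewrite !normrN. Qed.

Lemma kern_bound t z x : 0 <= x <= 1 ->
  nrm (kern t z x) <= 2 * expR ((nrm z + nrm (sqrt_mit t)) ^+ 2).
Proof.
move=> x01; apply: (le_trans (nrm_cexp _)); rewrite ler_pM2l// ler_expR nrmN.
apply: (le_trans (nrmX _ _)); rewrite ler_pXn2r// ?nnegrE ?addr_ge0 ?nrm_ge0//.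
apply: (le_trans (nrmD _ _)); rewrite lerD2l.
apply: (le_trans (nrmM _ _)); rewrite ler_piMr ?nrm_ge0//.
by rewrite /nrm /= normr0 addr0 ler_norml; lra.
Qed.

Lemma psi_power t z : psi f t z ^+ n = EC (fun w => \prod_(i < n) kern t z (Y i w)).
Proof.
set N := 2 * expR ((nrm z + nrm (sqrt_mit t)) ^+ 2).
have N0 : 0 <= N by rewrite mulr_ge0// expR_ge0.
pose g x : R[i] := kern t z x * Complex (\1_(`[0, 1] : set R) x) 0.
have mk : Cmeasurable setT (kern t z).
  by apply: (@Cmeasurable_kern _ _ t z id); exact: measurable_id.
have mg : Cmeasurable setT g.
  apply: CmeasurableM => //; split => /=; last exact: measurable_cst.
  exact: measurable_indic.
have gE x : 0 <= x <= 1 -> g x = kern t z x.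
  by move=> x01; rewrite /g indicE mem_set ?mulr1//= in_itv/=.
have gN x : nrm (g x) <= N.
  have [x01|x01] := boolP (0 <= x <= 1); first by rewrite gE// kern_bound.
  rewrite /g indicE memNset ?mulr0; first by rewrite /nrm /= normr0 addr0.
  by rewrite /= in_itv/=; exact/negP.
have := @expectation_prod _ _ _ P n Y (fun=> g) N mY indY (fun=> mg) (fun=> gN).
rewrite (@eq_EC _ _ _ _ _ (fun w => \prod_(i < n) kern t z (Y i w))); last first.
  by move=> w; apply: eq_bigr => i _; rewrite gE// Y01.
move=> ->; transitivity (\prod_(i < n) psi f t z).
  by rewrite prodr_const card_ord.
apply: eq_bigr => i _.
rewrite (@eq_EC _ _ _ _ _ (fun w => kern t z (Y i w))); last first.
  by move=> w; rewrite gE// Y01.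
by rewrite (expectation_density_complex i mk (@kern_bound t z)).
Qed.

Definition sample_mean w := (\sum_(i < n) Y i w) / n%:R.
Definition sample_Q w := Qfun (fun i => Y i w).
Local Notation cm := sample_mean.
Local Notation Q := sample_Q.

Let nR : (n%:R : R) != 0. Proof. by rewrite pnatr_eq0 -lt0n. Qed.

Lemma sample_mean01 w : 0 <= cm w <= 1.
Proof.
have nR0 : 0 < n%:R :> R by rewrite ltr0n.
apply/andP; split.
  by rewrite divr_ge0// sumr_ge0// => i _; have /andP[] := Y01 i w.
rewrite ler_pdivrMr// mul1r.
rewrite -[X in _ <= X%:R]card_ord -sumr_const.
by apply: ler_sum => i _; have /andP[] := Y01 i w.
Qed.

Lemma measurable_sample_mean : measurable_fun setT cm.
Proof.
apply: measurable_funM; last exact: measurable_cst.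
by apply: measurable_sum => i; exact: mY.
Qed.

Lemma measurable_sample_Q : measurable_fun setT Q.
Proof.
apply: measurable_sum => i; apply: measurable_funX.
by apply: measurable_funB; [exact: mY | exact: measurable_sample_mean].
Qed.

(** Each square is expanded about the sample mean. The cross terms sum to zero, and s^2 = - i t
    turns the squared deviations into i t Q. *)
Lemma kern_prodE t z w : 0 < t -> \prod_(i < n) kern t z (Y i w) =
  cexp (Complex 0 (t * Q w)) *
  cexp (- (z + sqrt_mit t * Complex (cm w) 0) ^+ 2 *+ n).
Proof.
move=> t0; rewrite -cexp_sum -cexpD; congr cexp.
set s := sqrt_mit t; set c := cm w.
have ss : s ^+ 2 = - Complex 0 t.
  have := @psistar_exponent _ t 0 1 t0; rewrite -/s => /(congr1 (fun z => - z)).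
  rewrite opprK addr0 expr1n mulr1 => <-; congr (_ ^+ 2).
  by case: s => a b; simpc; apply: eq_Complex; ring.
have E i : - (z + s * Complex (Y i w) 0) ^+ 2 = - (z + s * Complex c 0) ^+ 2 +
   ((- 2 * (z + s * Complex c 0) * s) * ((Y i w - c)%:C)%C +
    Complex 0 t * (((Y i w - c) ^+ 2)%:C)%C).
  have -> : Complex (Y i w) 0 = Complex c 0 + ((Y i w - c)%:C)%C.
    by simpc; apply: eq_Complex => //; rewrite addrC subrK.
  have -> : Complex 0 t = - s ^+ 2 by rewrite ss opprK.
  by rewrite rmorphXn /=; ring.
rewrite (eq_bigr _ (fun i _ => E i)) big_split /= sumr_const card_ord addrC.
congr (_ + _); rewrite big_split /= -!mulr_sumr -!rmorph_sum /=.
have -> : \sum_(i < n) (Y i w - c) = 0.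
  by rewrite sumrB sumr_const card_ord /c /sample_mean -[X in _ - X]mulr_natr divfK// subrr.
rewrite rmorph0 mulr0 add0r /Q /Qfun /sample_Q.
by simpc; apply: eq_Complex => //; ring.
Qed.

Definition cis (a : R) : R[i] := Complex (cos a) (sin a).

Lemma cexp_im (a : R) : cexp (Complex 0 a) = cis a.
Proof. by rewrite /cexp /= expR0 !mul1r. Qed.

Lemma nrm_cis (a : R) : nrm (cis a) <= 2.
Proof.
by rewrite /nrm /=; have := cos_max a; have := sin_max a; lra.
Qed.

Lemma mulrn_Complex (a b : R) k : Complex a b *+ k = Complex (k%:R * a) (k%:R * b).
Proof.
elim: k => [|k IH]; first by rewrite mulr0n !mul0r.
by rewrite mulrSr IH; simpc; apply: eq_Complex; rewrite -natr1; ring.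
Qed.

Lemma psistar_power t u : 0 < t -> psistar f t u ^+ n =
  EC (fun w => cis (t * Q w) * cis (n%:R * t * (cm w + u) ^+ 2)).
Proof.
move=> t0; rewrite /psistar psi_power; apply: eq_EC => w.
rewrite kern_prodE// cexp_im psistar_exponent// mulrn_Complex mulr0 cexp_im.
by rewrite mulrA.
Qed.

Section FixedFrequency.
Context (t : R) (t0 : 0 < t).
Local Notation sg := (Num.sqrt (t / 2)).
Local Notation s := (sqrt_mit t).

Let sg0 : 0 < sg. Proof. by rewrite sqrtr_gt0 divr_gt0. Qed.
Let n0R : 0 < n%:R :> R. Proof. by rewrite ltr0n. Qed.
Let sg2 : 2 * sg ^+ 2 = t.
Proof. by rewrite sqr_sqrtr ?ltW ?divr_gt0//; field. Qed.

Definition erfc_fun (c y : R) : R[i] :=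
  Complex (erfc_re_fun n%:R sg c y) (erfc_im_fun n%:R sg c y).
Definition erfcC (c : R) : R[i] := Complex (erfc_re n%:R sg c) (erfc_im n%:R sg c).
Definition phiQ : R[i] := EC (fun w => cis (t * Q w)).

Lemma erfc_funE c y : cexp (Complex (- (y ^+ 2) - 2 * y * sg * c)
    (t * c ^+ 2 + 2 * y * sg * c) *+ n) = erfc_fun c y.
Proof.
rewrite mulrn_Complex /cexp /erfc_fun /erfc_re_fun /erfc_im_fun /erfc_modulus /erfc_phase.
rewrite sg2 /=.
have -> : n%:R * (- y ^+ 2 - 2 * y * sg * c) = - (n%:R * (y ^+ 2 + 2 * y * sg * c)).
  by ring.
by rewrite [t * _ + _]addrC.
Qed.

Lemma psi_right_power y : psi f t (Complex y 0) ^+ n =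
  EC (fun w => cis (t * Q w) * erfc_fun (cm w) y).
Proof.
rewrite psi_power; apply: eq_EC => w.
by rewrite kern_prodE// cexp_im psi_right_exponent// erfc_funE.
Qed.

Lemma psi_left_power y : psi f t (- Complex y 0 - s) ^+ n =
  EC (fun w => cis (t * Q w) * erfc_fun (1 - cm w) y).
Proof.
rewrite psi_power; apply: eq_EC => w.
by rewrite kern_prodE// cexp_im psi_left_exponent// erfc_funE.
Qed.

Lemma Cmeasurable_cis d' (T' : measurableType d') (D : set T') (g : T' -> R) :
  measurable_fun D g -> Cmeasurable D (fun x => cis (g x)).
Proof.
move=> mg; split.
  exact: (measurableT_comp (continuous_measurable_fun (@continuous_cos R)) mg).
exact: (measurableT_comp (continuous_measurable_fun (@continuous_sin R)) mg).
Qed.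

(** The factor cis(t Q) does not depend on u and leaves the inner integral. The majorant is required
    only for c in [0, 1], where the sample mean lies. *)
Lemma fubini_cis (D : set R) (k : R -> R -> R[i]) (h : R -> R) : measurable D ->
  Cmeasurable setT (fun z : R * R => k z.1 z.2) ->
  (forall c u, 0 <= c <= 1 -> D u -> nrm (k c u) <= h u) ->
  leb.-integrable D (EFin \o h) ->
  Cintegral leb D (fun u => EC (fun w => cis (t * Q w) * k (cm w) u)) =
    EC (fun w => cis (t * Q w) * Cintegral leb D (k (cm w))) /\
  Cmeasurable D (fun u => EC (fun w => cis (t * Q w) * k (cm w) u)).
Proof.
move=> mD [mk1 mk2] kh ih.
have mp : measurable_fun setT (fun z : T * R => (cm z.1, z.2)).
  apply: measurable_fun_pair; last exact: measurable_snd.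
  exact: (measurableT_comp measurable_sample_mean measurable_fst).
have mG : Cmeasurable setT (fun z : T * R => cis (t * Q z.1) * k (cm z.1) z.2).
  apply: CmeasurableM.
    apply: Cmeasurable_cis; apply: measurable_funM; first exact: measurable_cst.
    exact: (measurableT_comp measurable_sample_Q measurable_fst).
  split; [exact: (measurableT_comp mk1 mp) | exact: (measurableT_comp mk2 mp)].
have bG w u : D u -> nrm (cis (t * Q w) * k (cm w) u) <= 2 * h u.
  move=> Du; apply: (le_trans (nrmM _ _)); apply: ler_pM; rewrite ?nrm_ge0//.
    exact: nrm_cis.
  by apply: kh => //; exact: sample_mean01.
have ih2 : leb.-integrable D (EFin \o (fun u => 2 * h u)) by exact: integrableZ_real.
have [e m1 m2] := @Cintegral_fubini _ _ _ P D
  (fun w u => cis (t * Q w) * k (cm w) u) (fun u => 2 * h u) mD mG bG ih2.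
split=> //; rewrite -e; apply: eq_EC => w; rewrite CintegralZ//.
apply: (Cintegrable_dom _ _ _ ih) => //.
  split; apply: measurable_funTS.
    exact: (measurableT_comp mk1 (measurable_pair1 (cm w))).
  exact: (measurableT_comp mk2 (measurable_pair1 (cm w))).
by move=> u Du; apply: kh => //; exact: sample_mean01.
Qed.

Let kap := erfc_re n%:R sg 0.

Lemma erfcCN c : erfcC (- c) = Complex (2 * kap) 0 - erfcC c.
Proof.
rewrite /erfcC; simpc; have := erfc_reN n0R sg0 c; have := erfc_imN n0R sg0 c.
by move=> h1 h2; apply: eq_Complex; rewrite /kap; lra.
Qed.

Lemma sE : s = Complex sg (- sg). Proof. exact: sqrt_mitE. Qed.

Let smulcis a : s * cis a =
  Complex (sg * (cos a + sin a)) (sg * (sin a - cos a)).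
Proof. by rewrite sE /cis; simpc; apply: eq_Complex; ring. Qed.

Let sg2c c : 2 * n%:R * sg ^+ 2 * c ^+ 2 = n%:R * t * c ^+ 2.
Proof. by rewrite -[in RHS]sg2; ring. Qed.

(** Because s = sg (1 - i), the formula for H' says exactly that - H(c + u) is a primitive in u of s
    cis(n t (c + u)^2). *)
Lemma fresnel_right a b c : a <= b ->
  Cintegral leb `[a, b] (fun u => s * cis (n%:R * t * (c + u) ^+ 2)) =
  erfcC (a + c) - erfcC (b + c).
Proof.
move=> ab; rewrite /Cintegral /erfcC.
under eq_Rintegral do rewrite smulcis /=.
under [X in Complex _ X]eq_Rintegral do rewrite smulcis /=.
have d1 u : is_derive u 1 (fun u => - erfc_re n%:R sg (u + c))
   (sg * (cos (n%:R * t * (c + u) ^+ 2) + sin (n%:R * t * (c + u) ^+ 2))).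
  notypeclasses refine (is_derive_eq (derN (der_comp (g := fun u => u + c) (der_erfc_re n0R sg0 (u + c))
    (derD (der_id u) (der_cst c u)))) _).
  by rewrite sg2c addr0 mulr1 mulNr opprK [u + c]addrC.
have d2 u : is_derive u 1 (fun u => - erfc_im n%:R sg (u + c))
   (sg * (sin (n%:R * t * (c + u) ^+ 2) - cos (n%:R * t * (c + u) ^+ 2))).
  notypeclasses refine (is_derive_eq (derN (der_comp (g := fun u => u + c) (der_erfc_im n0R sg0 (u + c))
    (derD (der_id u) (der_cst c u)))) _).
  by rewrite sg2c addr0 mulr1 [u + c]addrC; ring.
simpc; apply: eq_Complex.
  rewrite (@Rintegral_FTC _ _ _ _ _ ab _ d1); first by ring.
  by move=> u; eapply der_continuous; repeat der1.
rewrite (@Rintegral_FTC _ _ _ _ _ ab _ d2); first by ring.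
by move=> u; eapply der_continuous; repeat der1.
Qed.

Lemma fresnel_left c :
  Cintegral leb unit_itv (fun u => s * cis (n%:R * t * (c - u) ^+ 2)) =
  erfcC (c - 1) - erfcC c.
Proof.
rewrite /Cintegral /erfcC.
under eq_Rintegral do rewrite smulcis /=.
under [X in Complex _ X]eq_Rintegral do rewrite smulcis /=.
have d1 u : is_derive u 1 (fun u => erfc_re n%:R sg (c - u))
   (sg * (cos (n%:R * t * (c - u) ^+ 2) + sin (n%:R * t * (c - u) ^+ 2))).
  notypeclasses refine (is_derive_eq (der_comp (g := fun u => c - u) (der_erfc_re n0R sg0 (c - u))
    (derD (der_cst c u) (derN (der_id u)))) _).
  by rewrite sg2c; ring.
have d2 u : is_derive u 1 (fun u => erfc_im n%:R sg (c - u))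
   (sg * (sin (n%:R * t * (c - u) ^+ 2) - cos (n%:R * t * (c - u) ^+ 2))).
  notypeclasses refine (is_derive_eq (der_comp (g := fun u => c - u) (der_erfc_im n0R sg0 (c - u))
    (derD (der_cst c u) (derN (der_id u)))) _).
  by rewrite sg2c; ring.
simpc; apply: eq_Complex.
  rewrite (@Rintegral_FTC _ _ _ _ _ ler01 _ d1); first by rewrite subr0.
  by move=> u; eapply der_continuous; repeat der1.
rewrite (@Rintegral_FTC _ _ _ _ _ ler01 _ d2); first by rewrite subr0.
by move=> u; eapply der_continuous; repeat der1.
Qed.

Let nrm_s : nrm s = 2 * sg.
Proof. by rewrite sE /nrm /= normrN gtr0_norm//; ring. Qed.

Let nrm_scis a : nrm (s * cis a) <= 4 * sg.
Proof.
apply: (le_trans (nrmM _ _)); rewrite nrm_s.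
have -> : 4 * sg = 2 * sg * 2 by ring.
by rewrite ler_wpM2l ?nrm_cis// mulr_ge0// ltW.
Qed.

Let cst_integrable a b (k : R) : leb.-integrable `[a, b] (EFin \o (fun=> k)).
Proof. by apply: integrable_itvcc; apply: cont_within => x; exact: cvg_cst. Qed.

Let psistar_times u : s * psistar f t u ^+ n =
  EC (fun w => cis (t * Q w) * (s * cis (n%:R * t * (cm w + u) ^+ 2))).
Proof.
rewrite psistar_power// -CintegralZ//.
  by apply: eq_EC => w; ring.
apply: (@Cintegrable_prob _ _ _ P _ 4).
  apply: CmeasurableM; apply: Cmeasurable_cis; apply: measurable_funM.
  - exact: measurable_cst.
  - exact: measurable_sample_Q.
  - exact: measurable_cst.
  - apply: measurable_funX; apply: measurable_funD; last exact: measurable_cst.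
    exact: measurable_sample_mean.
move=> w; apply: (le_trans (nrmM _ _)).
have -> : (4 : R) = 2 * 2 by ring.
by apply: ler_pM; rewrite ?nrm_ge0 ?nrm_cis.
Qed.

(** A bounded segment is essential for Fubini: the integrand in (w, u) has constant modulus and is
    integrable only over sets of finite length. *)
Lemma psistar_segment a b : a <= b ->
  Cintegral leb `[a, b] (fun u => s * psistar f t u ^+ n) =
    EC (fun w => cis (t * Q w) * (erfcC (a + cm w) - erfcC (b + cm w))) /\
  Cmeasurable `[a, b] (fun u => s * psistar f t u ^+ n).
Proof.
move=> ab.
have [||||e m1] := @fubini_cis (`[a, b]%classic : set R) (fun c u => s * cis (n%:R * t * (c + u) ^+ 2))
  (fun=> 4 * sg).
- exact: measurable_itv.
- apply: CmeasurableM; first exact: Cmeasurable_cst.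
  apply: Cmeasurable_cis; apply: measurable_funM; first exact: measurable_cst.
  apply: measurable_funX; apply: measurable_funD; first exact: measurable_fst.
  exact: measurable_snd.
- by move=> c u _ _; exact: nrm_scis.
- exact: cst_integrable.
rewrite (_ : (fun u => s * psistar f t u ^+ n) = (fun u => EC (fun w =>
   cis (t * Q w) * (s * cis (n%:R * t * (cm w + u) ^+ 2))))); last first.
  by apply/funext => u; exact: psistar_times.
split => //; rewrite e; apply: eq_EC => w.
by rewrite fresnel_right.
Qed.

Lemma psistar_middle :
  Cintegral leb unit_itv (fun u => s * psistar f t (- u) ^+ n) =
    EC (fun w => cis (t * Q w) * (erfcC (cm w - 1) - erfcC (cm w))) /\
  Cmeasurable unit_itv (fun u => s * psistar f t (- u) ^+ n).
Proof.
have [||||e m1] := @fubini_cis unit_itv (fun c u => s * cis (n%:R * t * (c - u) ^+ 2))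
  (fun=> 4 * sg).
- exact: measurable_itv.
- apply: CmeasurableM; first exact: Cmeasurable_cst.
  apply: Cmeasurable_cis; apply: measurable_funM; first exact: measurable_cst.
  apply: measurable_funX; apply: measurable_funB; first exact: measurable_fst.
  exact: measurable_snd.
- by move=> c u _ _; exact: nrm_scis.
- exact: cst_integrable.
rewrite (_ : (fun u => s * psistar f t (- u) ^+ n) = (fun u => EC (fun w =>
   cis (t * Q w) * (s * cis (n%:R * t * (cm w - u) ^+ 2))))); last first.
  by apply/funext => u; exact: psistar_times.
split => //; rewrite e; apply: eq_EC => w.
by rewrite fresnel_left.
Qed.

Let erfc_fun_nrm c y : 0 <= c -> 0 <= y ->
  nrm (erfc_fun c y) <= 2 * erfc_re_fun n%:R sg 0 y.
Proof.
move=> c0 y0.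
have e0 : erfc_re_fun n%:R sg 0 y = expR (- (n%:R * y ^+ 2)).
  rewrite /erfc_re_fun /erfc_modulus /erfc_phase expr0n/= !mulr0 !addr0 mulr0.
  by rewrite cos0 mulr1.
have le : erfc_modulus n%:R sg c y <= expR (- (n%:R * y ^+ 2)).
  by rewrite ler_expR lerN2 ler_pM2l// lerDl !mulr_ge0// ltW.
rewrite e0 /nrm /= !normrM ger0_norm ?expR_ge0//.
have -> : 2 * expR (- (n%:R * y ^+ 2)) =
  expR (- (n%:R * y ^+ 2)) * 1 + expR (- (n%:R * y ^+ 2)) * 1 by ring.
by apply: lerD; apply: ler_pM; rewrite ?expR_ge0 ?cos_max ?sin_max.
Qed.

Let erfc_fun_meas : Cmeasurable setT (fun z : R * R => erfc_fun z.1 z.2).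
Proof.
have mph : measurable_fun setT (fun z : R * R => erfc_phase n%:R sg z.1 z.2).
  apply: measurable_funM; first exact: measurable_cst.
  apply: measurable_funD; apply: measurable_funM => //.
  - by apply: measurable_funM => //; apply: measurable_funM.
  - by apply: measurable_funX.
have mex : measurable_fun setT (fun z : R * R => erfc_modulus n%:R sg z.1 z.2).
  apply: (measurableT_comp (@measurable_expR R)).
  apply: measurableT_comp => //; apply: measurable_funM => //.
  apply: measurable_funD; first exact: measurable_funX.
  by apply: measurable_funM => //; apply: measurable_funM => //; apply: measurable_funM.
have [c1 c2] := Cmeasurable_cis mph.
by split; apply: measurable_funM.
Qed.

Let erfc_dom : leb.-integrable half_line (EFin \o (fun y => 2 * erfc_re_fun n%:R sg 0 y)).
Proof. by apply: integrableZ_real => //; exact: (erfc_fun_integrable n0R sg0 0).1. Qed.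

Lemma psi_right_integral :
  Cintegral leb half_line (fun y => psi f t (Complex y 0) ^+ n) =
    EC (fun w => cis (t * Q w) * erfcC (cm w)) /\
  Cmeasurable half_line (fun y => psi f t (Complex y 0) ^+ n).
Proof.
have [|||e m1] := @fubini_cis half_line erfc_fun
  (fun y => 2 * erfc_re_fun n%:R sg 0 y) (measurable_itv _).
- exact: erfc_fun_meas.
- move=> c u /andP[c0 _]; rewrite /= in_itv/= andbT; exact: erfc_fun_nrm.
- exact: erfc_dom.
rewrite (_ : (fun y => psi f t (Complex y 0) ^+ n) = (fun u => EC (fun w =>
   cis (t * Q w) * erfc_fun (cm w) u))); last first.
  by apply/funext => u; exact: psi_right_power.
by split.
Qed.

Lemma psi_left_integral :
  Cintegral leb half_line (fun y => psi f t (- Complex y 0 - s) ^+ n) =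
    EC (fun w => cis (t * Q w) * erfcC (1 - cm w)) /\
  Cmeasurable half_line (fun y => psi f t (- Complex y 0 - s) ^+ n).
Proof.
have [|||e m1] := @fubini_cis half_line (fun c => erfc_fun (1 - c))
  (fun y => 2 * erfc_re_fun n%:R sg 0 y) (measurable_itv _).
- have mp : measurable_fun setT (fun z : R * R => (1 - z.1, z.2)).
    apply: measurable_fun_pair; last exact: measurable_snd.
    by apply: measurable_funB.
  split; [exact: (measurableT_comp erfc_fun_meas.1 mp)
         |exact: (measurableT_comp erfc_fun_meas.2 mp)].
- move=> c u /andP[_ c1]; rewrite /= in_itv/= andbT; apply: erfc_fun_nrm; lra.
- exact: erfc_dom.
rewrite (_ : (fun y => psi f t (- Complex y 0 - s) ^+ n) = (fun u => EC (fun w =>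
   cis (t * Q w) * erfc_fun (1 - cm w) u))); last first.
  by apply/funext => u; exact: psi_left_power.
by split.
Qed.

End FixedFrequency.
End PowerAsExpectation.

(** * The two representations for a general weight *)

Section SumIntegralInterchange.
Context {R : realType}.
Notation leb := (@lebesgue_measure R).
Implicit Types (b c : nat -> R) (D : set R) (g : R -> R).

Lemma sum1_series b N : \sum_(1 <= k < N.+1) b k = series (fun k => b k.+1) N.
Proof. by rewrite /series /= big_add1. Qed.

Lemma sum1_dom_cvg b c : (forall k, (0 < k)%N -> `|c k| <= b k) ->
  cvgn (fun N => \sum_(1 <= k < N) b k) -> cvgn (fun N => \sum_(1 <= k < N) c k).
Proof.
move=> cb hb; apply/cvg_ex; have b0 k : 0 <= b k.+1 by apply: le_trans (cb _ _).
have hb' : cvgn (series (fun k => b k.+1)).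
  have /cvg_ex[l hl] := hb; apply/cvg_ex; exists l.
  have -> : series (fun k => b k.+1) = fun N => \sum_(1 <= k < N.+1) b k.
    by apply/funext => N; rewrite sum1_series.
  by have := hl; rewrite -cvg_shiftS.
have : cvgn (series (fun k => c k.+1)).
  apply: normed_cvg; apply: (@series_le_cvg _ _ (fun k => b k.+1)) => //.
  - by move=> k; exact: normr_ge0.
  - by move=> k; exact: cb.
move=> /cvg_ex[l hl]; exists l; rewrite -cvg_shiftS.
have -> : (fun N => \sum_(1 <= k < N.+1) c k) = series (fun k => c k.+1).
  by apply/funext => N; rewrite sum1_series.
by [].
Qed.

Lemma sum1_le_lim b N : (forall k, (0 < k)%N -> 0 <= b k) ->
  cvgn (fun N => \sum_(1 <= k < N) b k) -> \sum_(1 <= k < N) b k <= sum1 b.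
Proof.
move=> b0 hb; apply: (@nondecreasing_cvgn_le _ (fun N => \sum_(1 <= k < N) b k)) => //.
move=> m p mp; have [m0|m0] := leqP 1 m.
  rewrite (big_cat_nat m0 mp) /= lerDl big_nat sumr_ge0// => k /andP[mk _].
  by apply: b0; exact: leq_trans mk.
rewrite big_geq; last exact: ltnW.
by rewrite big_nat sumr_ge0// => k /andP[k0 _]; exact: b0.
Qed.

(** The majorant separates: summable in k, integrable in u. All partial sums are then dominated by
    the total of [b] times [g], so one application of dominated convergence gives both the
    integrability of the sum and the exchange. *)
Lemma SI_interchange D (a : R -> nat -> R) b g : measurable D ->
  (forall k, (0 < k)%N -> measurable_fun D (fun u => a u k)) ->
  leb.-integrable D (EFin \o g) -> (forall u, D u -> 0 <= g u) ->
  (forall u k, D u -> (0 < k)%N -> `|a u k| <= b k * g u) ->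
  (forall k, (0 < k)%N -> 0 <= b k) ->
  cvgn (fun N => \sum_(1 <= k < N) b k) ->
  SI_ok D a /\
  (fun N => \sum_(1 <= k < N) \int[leb]_(u in D) a u k) @ \oo --> SI D a.
Proof.
move=> mD ma ig g0 ab b0 hb.
have cu u : D u -> cvgn (fun N => \sum_(1 <= k < N) a u k).
  move=> Du; apply: (@sum1_dom_cvg (fun k => b k * g u)).
    by move=> k k0; exact: ab.
  have -> : (fun N => \sum_(1 <= k < N) b k * g u) =
      (fun N => (\sum_(1 <= k < N) b k) * g u).
    by apply/funext => N; rewrite mulr_suml.
  by apply: is_cvgM => //; exact: is_cvg_cst.
have mS N : measurable_fun D (fun u => \sum_(1 <= k < N) a u k).
  have -> : (fun u => \sum_(1 <= k < N) a u k) =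
     (fun u => \sum_(1 <= k < N) (if (0 < k)%N then a u k else 0)).
    by apply/funext => u; apply: eq_big_nat => k /andP[-> _].
  apply: measurable_sum => k.
  by case: (boolP (0 < k)%N) => [k0|_]; [exact: ma | exact: measurable_cst].
have bS N u : D u -> `|\sum_(1 <= k < N) a u k| <= sum1 b * g u.
  move=> Du; apply: (le_trans (ler_norm_sum _ _ _)).
  apply: (@le_trans _ _ ((\sum_(1 <= k < N) b k) * g u)).
    by rewrite mulr_suml; apply: ler_sum_nat => k /andP[k0 _]; exact: ab.
  by apply: ler_wpM2r; [exact: g0 | exact: sum1_le_lim].
have ia k : (0 < k)%N -> leb.-integrable D (EFin \o (fun u => a u k)).
  move=> k0; apply: (@integrable_dom _ _ _ leb _ _ (fun u => b k * g u)) => //.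
  - exact: ma.
  - by move=> u Du; exact: ab.
  - exact: integrableZ_real.
have ig' : leb.-integrable D (EFin \o (fun u => sum1 b * g u)).
  exact: integrableZ_real.
have [//|iS cS] := @Rintegral_dct _ _ _ leb D
  (fun N u => \sum_(1 <= k < N) a u k) (fun u => sum1 (a u))
  (fun u => sum1 b * g u) _ mS cu ig' bS.
split; first by split.
have E N : leb.-integrable D (EFin \o (fun u => \sum_(1 <= k < N) a u k)) /\
   \int[leb]_(u in D) (\sum_(1 <= k < N) a u k) =
   \sum_(1 <= k < N) \int[leb]_(u in D) a u k.
  split.
    apply: (@integrable_dom _ _ _ leb _ _ (fun u => sum1 b * g u)) => //.
    - exact: mS.
    - by move=> u Du; exact: bS.
  elim: N => [|N IH].
    under eq_Rintegral do rewrite big_geq//.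
    by rewrite big_geq// Rintegral_cst// mul0r.
  case: N IH => [|N] IH.
    under eq_Rintegral do rewrite big_geq//.
    by rewrite big_geq// Rintegral_cst// mul0r.
  under eq_Rintegral do rewrite big_nat_recr//=.
  rewrite RintegralD//; first by rewrite big_nat_recr//= IH.
    apply: (@integrable_dom _ _ _ leb _ _ (fun u => sum1 b * g u)) => //.
    - exact: mS.
    - by move=> u Du; exact: bS.
  exact: ia.
move: cS; rewrite /SI.
have -> : (fun N => \int[leb]_(x in D) (\sum_(1 <= k < N) a x k)) =
  (fun N => \sum_(1 <= k < N) \int[leb]_(u in D) a u k).
  by apply/funext => N; rewrite (E N).2.
by [].
Qed.

(** Comparison with the telescoping 2/sqrt(k) - 2/sqrt(k+1), which yields the partial sum bound 3 -
    2/sqrt(m+1). *)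
Lemma cvg_sum_three_halves (C : R) : 0 <= C ->
  cvgn (fun N => \sum_(1 <= k < N) C * (Num.sqrt k%:R)^-1 ^+ 3).
Proof.
move=> C0; apply: nondecreasing_is_cvgn.
  move=> m p mp; have [m0|m0] := leqP 1 m.
    rewrite (big_cat_nat m0 mp) /= lerDl sumr_ge0// => k _.
    by rewrite mulr_ge0// exprn_ge0// invr_ge0.
  rewrite big_geq; last exact: ltnW.
  by rewrite sumr_ge0// => k _; rewrite mulr_ge0// exprn_ge0// invr_ge0.
exists (C * 3) => _ [N _ <-].
suff h m : \sum_(1 <= k < m.+2) C * (Num.sqrt k%:R)^-1 ^+ 3 <=
    C * (3 - 2 * (Num.sqrt m.+1%:R)^-1).
  case: N => [|[|m]]; first by rewrite big_geq// mulr_ge0.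
    by rewrite big_geq// mulr_ge0.
  apply: (le_trans (h m)); rewrite ler_wpM2l// gerBl mulr_ge0//.
elim: m => [|m IH].
  by rewrite big_nat1 sqrtr1 invr1 expr1n; lra.
rewrite big_nat_recr//=; apply: (le_trans (lerD IH (lexx _))).
rewrite -mulrDr ler_wpM2l//.
set x := (Num.sqrt m.+1%:R)^-1; set y := (Num.sqrt m.+2%:R)^-1.
have p1 : 0 < m.+1%:R :> R by rewrite ltr0n.
have p2 : 0 < m.+2%:R :> R by rewrite ltr0n.
have x0 : 0 < x by rewrite invr_gt0 sqrtr_gt0.
have y0 : 0 < y by rewrite invr_gt0 sqrtr_gt0.
have x2 : x ^+ 2 = m.+1%:R^-1 by rewrite exprVn sqr_sqrtr// ltW.
have y2 : y ^+ 2 = m.+2%:R^-1 by rewrite exprVn sqr_sqrtr// ltW.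
have xy : y <= x by rewrite lef_pV2 ?posrE ?sqrtr_gt0// ler_sqrt// ler_nat.
(* Consecutive integers have reciprocals whose difference equals their product; after division by x
   + y this makes x - y comparable with y^3. *)
have e : (x - y) * (x + y) = x ^+ 2 * y ^+ 2.
  have -> : (x - y) * (x + y) = x ^+ 2 - y ^+ 2 by ring.
  rewrite x2 y2 -[m.+2%:R]natr1; field.
  have m0 : 0 <= m%:R :> R by [].
  by apply/andP; split; apply: lt0r_neq0; lra.
suff : y ^+ 3 <= 2 * (x - y) by lra.
have : y ^+ 3 * (x + y) <= 2 * (x - y) * (x + y).
  rewrite -mulrA e.
  have -> : y ^+ 3 * (x + y) = y ^+ 2 * (y * (x + y)) by ring.
  have -> : 2 * (x ^+ 2 * y ^+ 2) = y ^+ 2 * (2 * x ^+ 2) by ring.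
  apply: ler_wpM2l; first exact: sqr_ge0.
  by nra.
by rewrite ler_pM2r// addr_gt0.
Qed.

End SumIntegralInterchange.

Section Representations.
Context d (T : measurableType d) (R : realType) (P : probability T R).
Context (n : nat) (Y : 'I_n -> T -> R) (f : R -> R).
Context (n2 : (2 <= n)%N) (mY : forall i, measurable_fun setT (Y i))
  (Y01 : forall i w, 0 <= Y i w <= 1)
  (fY : forall i, is_density_of P (Y i) f) (indY : mutually_independent P Y).
Context (K L : R) (bf : bounded_var f K) (uf : unif_cont f) (L0 : 0 <= L)
  (fL : forall x, 0 <= x <= 1 -> `|f x| <= L).
Notation leb := (@lebesgue_measure R).
Local Notation unit_itv := (`[0, 1]%classic : set R).
Local Notation half_line := (`[0, +oo[%classic : set R).
Notation EC := (Cintegral P setT).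
Local Notation Q := (sample_Q Y).
Local Notation cm := (sample_mean Y).
Local Notation phi t := (phiQ P Y t).

Let n0 : (0 < n)%N. Proof. exact: ltnW. Qed.
Let n0R : 0 < n%:R :> R. Proof. by rewrite ltr0n. Qed.
Let mf : measurable_fun setT f. Proof. by have [] := fY (Ordinal n0). Qed.

Definition cauchyw (u : R) : R := (1 + u ^+ 2)^-1.

Lemma cauchyw_gt0 u : 0 < cauchyw u.
Proof. by rewrite invr_gt0 ltr_pwDl// sqr_ge0. Qed.

Let psi_rate (t1 : R) := 2 * (`|K| + L) * (60 + 16 / Num.sqrt t1).

Let psi_rate_ge0 t1 : 0 < t1 -> 0 <= psi_rate t1.
Proof.
by move=> t10; rewrite !mulr_ge0 ?addr_ge0 ?divr_ge0.
Qed.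

Let psi_rate_le t1 t k : 0 < t1 -> t1 <= t -> k <= `|K| + L ->
  2 * k * (60 + 16 / Num.sqrt t) <= psi_rate t1.
Proof.
move=> t10 t1t kK; have t0 : 0 < t by exact: lt_le_trans t1t.
apply: (@le_trans _ _ (2 * (`|K| + L) * (60 + 16 / Num.sqrt t))).
  apply: ler_wpM2r; last by rewrite ler_pM2l.
  by rewrite addr_ge0 ?divr_ge0.
apply: ler_wpM2l; first by rewrite mulr_ge0// addr_ge0.
by rewrite lerD2l ler_wpM2l// lef_pV2 ?posrE ?sqrtr_gt0// ler_sqrt// ltW.
Qed.

(** The n factors give t^(-n/2), and the prefactor s costs sqrt t, whence the exponent n - 1. In u
    the power (1 + u^2)^(-n/2) is integrable because n >= 2. The restriction t >= t1 keeps the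
    factor 60 + 16 / sqrt t bounded. *)
Lemma psi_powers_bound t1 : 0 < t1 -> exists2 C, 0 <= C & forall t, t1 <= t ->
  (forall u, nrm (sqrt_mit t * psistar f t u ^+ n) <=
    C * (Num.sqrt t)^-1 ^+ n.-1 * cauchyw u) /\
  (forall y, 0 <= y ->
    nrm (psi f t (Complex y 0) ^+ n) <= C * (Num.sqrt t)^-1 ^+ n.-1 * cauchyw y /\
    nrm (psi f t (- Complex y 0 - sqrt_mit t) ^+ n) <=
      C * (Num.sqrt t)^-1 ^+ n.-1 * cauchyw y).
Proof.
move=> t10; have [M M0 HM] : exists2 M, 0 <= M & forall t k, t1 <= t ->
    k <= `|K| + L -> 2 * k * (60 + 16 / Num.sqrt t) <= M.
  by exists (psi_rate t1) => [|t k]; [exact: psi_rate_ge0 | exact: psi_rate_le].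
(* The 2 comes from |s| <= 2 sqrt t. The other summand pays for psi without the prefactor s: its
   spare factor 1 / sqrt t is at most 1 / sqrt t1. *)
pose C := M ^+ n * (2 + (Num.sqrt t1)^-1).
have st10 : 0 < Num.sqrt t1 by rewrite sqrtr_gt0.
exists C; first by rewrite mulr_ge0 ?exprn_ge0// addr_ge0// invr_ge0.
move=> t t1t; have t0 : 0 < t by exact: lt_le_trans t1t.
set r := (Num.sqrt t)^-1.
have st0 : 0 < Num.sqrt t by rewrite sqrtr_gt0.
have r0 : 0 < r by rewrite invr_gt0.
have rt1 : r <= (Num.sqrt t1)^-1.
  by rewrite lef_pV2 ?posrE// ler_sqrt// ltW.
have rS : r ^+ n = r ^+ n.-1 * r by rewrite -exprSr prednK.
split.
  move=> u; apply: (le_trans (nrmM _ _)).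
  have -> : nrm (sqrt_mit t) = 2 * Num.sqrt (t / 2).
    by rewrite sqrt_mitE// /nrm /= normrN ger0_norm//; ring.
  have s2 : Num.sqrt (t / 2) <= Num.sqrt t.
    by rewrite ler_sqrt ?ltW//; lra.
  pose v := Num.sqrt (1 + u ^+ 2).
  have u1 : 1 <= 1 + u ^+ 2 by rewrite lerDl sqr_ge0.
  have v1 : 1 <= v by rewrite -[leLHS]sqrtr1 ler_sqrt// (le_trans ler01).
  have v0 : 0 < v by exact: lt_le_trans v1.
  have b1 : nrm (psistar f t u) <= M * (r * v^-1).
    apply: (le_trans (psistar_bound mf bf uf fL u t0)).
    rewrite mulrA -/v invfM -/r; apply: ler_wpM2r.
      by rewrite mulr_ge0 ?invr_ge0// ltW.
    by apply: HM => //; rewrite (le_trans (ler_norm K))// lerDl.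
  have b2 : nrm (psistar f t u ^+ n) <= (M * (r * v^-1)) ^+ n.
    apply: (le_trans (nrmX _ _)); rewrite ler_pXn2r ?nnegrE ?nrm_ge0//.
    by apply: mulr_ge0 => //; apply: mulr_ge0; rewrite ?invr_ge0 ltW.
  have vn : v^-1 ^+ n <= cauchyw u.
    rewrite /cauchyw -[1 + _]sqr_sqrtr ?(le_trans ler01)// -/v -exprVn.
    by apply: ler_wiXn2l => //; rewrite ?invr_ge0 ?invf_le1// ltW.
  apply: (@le_trans _ _ (2 * Num.sqrt t * (M * (r * v^-1)) ^+ n)).
    apply: ler_pM; rewrite ?nrm_ge0 ?mulr_ge0//.
    by rewrite ler_pM2l.
  rewrite !exprMn rS.
  have -> : 2 * Num.sqrt t * (M ^+ n * (r ^+ n.-1 * r * v^-1 ^+ n)) =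
     (M ^+ n * 2) * r ^+ n.-1 * v^-1 ^+ n.
    by rewrite /r; field; rewrite !gt_eqF.
  apply: ler_pM => //.
  - by rewrite !mulr_ge0 ?exprn_ge0// ltW.
  - by rewrite exprn_ge0 ?invr_ge0// ltW.
  - apply: ler_wpM2r; first by rewrite exprn_ge0// ltW.
    by rewrite /C ler_wpM2l ?exprn_ge0// lerDl invr_ge0 ltW.
move=> y y0.
have ey : expR (- (y ^+ 2)) <= cauchyw y.
  rewrite expRN lef_pV2 ?posrE ?expR_gt0 ?ltr_pwDl ?sqr_ge0//.
  exact: expR_ge1Dx.
have e1 : expR (- (y ^+ 2)) <= 1 by rewrite -expR0 ler_expR oppr_le0 sqr_ge0.
have key z : nrm z <= 2 * (K + L) * ((60 + 16 / Num.sqrt t) / Num.sqrt t) *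
    expR (- (y ^+ 2)) -> nrm (z ^+ n) <= C * r ^+ n.-1 * cauchyw y.
  move=> zb.
  have zb' : nrm z <= M * r * expR (- (y ^+ 2)).
    apply: (le_trans zb); apply: ler_wpM2r; first exact: expR_ge0.
    rewrite mulrA -/r; apply: ler_wpM2r; first exact: ltW.
    by apply: HM => //; rewrite lerD2r ler_norm.
  have b2 : nrm (z ^+ n) <= (M * r * expR (- (y ^+ 2))) ^+ n.
    apply: (le_trans (nrmX _ _)); rewrite ler_pXn2r ?nnegrE ?nrm_ge0//.
    by rewrite !mulr_ge0 ?expR_ge0// ltW.
  apply: (le_trans b2); rewrite !exprMn rS.
  have en : expR (- (y ^+ 2)) ^+ n <= cauchyw y.
    apply: le_trans ey; rewrite -[leRHS]expr1.
    by apply: ler_wiXn2l => //; exact: expR_ge0.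
  apply: ler_pM => //.
  - by rewrite !mulr_ge0 ?exprn_ge0// ltW.
  - rewrite mulrA -mulrA [r ^+ _ * r]mulrC mulrA.
    apply: ler_wpM2r; first by rewrite exprn_ge0// ltW.
    rewrite /C ler_wpM2l ?exprn_ge0// (le_trans rt1)// lerDr.
    by [].
by split; apply: key; [apply: psi_right_bound | apply: psi_left_bound].
Qed.

Local Notation kap := (Complex (Num.sqrt (pi / n%:R)) 0 : R[i]).

Section Frequency.
Context (t : R) (t0 : 0 < t).
Local Notation sg := (Num.sqrt (t / 2)).
Local Notation s := (sqrt_mit t).
Let sg0 : 0 < sg. Proof. by rewrite sqrtr_gt0 divr_gt0. Qed.

Let kap_erfc : 2 * erfc_re n%:R sg 0 = Num.sqrt (pi / n%:R).
Proof. by rewrite erfc_re0//; field. Qed.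

Let erfcCN' c : erfcC n t (- c) = kap - erfcC n t c.
Proof. by rewrite erfcCN// kap_erfc. Qed.

Lemma Cmeasurable_erfcC : Cmeasurable setT (erfcC n t).
Proof.
split; apply: cont_meas => c.
  exact: (der_continuous (der_erfc_re n0R sg0 c)).
exact: (der_continuous (der_erfc_im n0R sg0 c)).
Qed.

Let mcis : Cmeasurable setT (fun w => cis (t * Q w)).
Proof.
apply: Cmeasurable_cis; apply: measurable_funM; first exact: measurable_cst.
exact: measurable_sample_Q.
Qed.

Let merfc (g : T -> R) : measurable_fun setT g ->
  Cmeasurable setT (fun w => cis (t * Q w) * erfcC n t (g w)).
Proof.
move=> mg; apply: CmeasurableM => //.
by split; [exact: (measurableT_comp Cmeasurable_erfcC.1 mg)
          |exact: (measurableT_comp Cmeasurable_erfcC.2 mg)].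
Qed.

Let nrm_cis_erfc w c : 0 <= c ->
  nrm (cis (t * Q w) * erfcC n t c) <= 4 * erfc_re n%:R sg 0.
Proof.
move=> c0; apply: (le_trans (nrmM _ _)).
have [h1 h2] := erfc_bound n0R sg0 c0.
have -> : 4 * erfc_re n%:R sg 0 = 2 * (erfc_re n%:R sg 0 + erfc_re n%:R sg 0) by ring.
by apply: ler_pM; rewrite ?nrm_ge0 ?nrm_cis// lerD.
Qed.

Let ierfc (g : T -> R) : measurable_fun setT g -> (forall w, 0 <= g w) ->
  Cintegrable P setT (fun w => cis (t * Q w) * erfcC n t (g w)).
Proof.
move=> mg g0; apply: (@Cintegrable_prob _ _ _ _ _ (4 * erfc_re n%:R sg 0)).
  exact: merfc.
by move=> w; exact: nrm_cis_erfc.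
Qed.

Let icis : Cintegrable P setT (fun w => cis (t * Q w)).
Proof.
apply: (@Cintegrable_prob _ _ _ _ _ 2) => // w; exact: nrm_cis.
Qed.

Let mm := measurable_sample_mean mY.
Let m01 := sample_mean01 n0 Y01.

Let mm1 : measurable_fun setT (fun w => 1 - cm w).
Proof. by apply: measurable_funB. Qed.

Lemma split_line_integral :
  Cintegral leb unit_itv (fun u => s * psistar f t (- u) ^+ n) +
  (Cintegral leb half_line (fun y => psi f t (Complex y 0) ^+ n) +
   Cintegral leb half_line (fun y => psi f t (- Complex y 0 - s) ^+ n)) =
  kap * phi t.
Proof.
rewrite (psistar_middle n0 mY Y01 fY indY t0).1.
rewrite (psi_right_integral n0 mY Y01 fY indY t0).1.
rewrite (psi_left_integral n0 mY Y01 fY indY t0).1.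
have i1 := ierfc mm (fun w => proj1 (andP (m01 w))).
have i2 : Cintegrable P setT (fun w => cis (t * Q w) * erfcC n t (1 - cm w)).
  by apply: ierfc => // w; rewrite subr_ge0; have /andP[] := m01 w.
have E w : cis (t * Q w) * (erfcC n t (cm w - 1) - erfcC n t (cm w)) =
   kap * cis (t * Q w) + ((- 1) * (cis (t * Q w) * erfcC n t (1 - cm w)) +
   (- 1) * (cis (t * Q w) * erfcC n t (cm w))).
  by rewrite -[cm w - 1]opprB erfcCN'; ring.
have iZ (z : R[i]) g : Cintegrable P setT g -> Cintegrable P setT (fun w => z * g w).
  move=> [g1 g2]; split.
    have -> : (fun w => complex.Re (z * g w)) = fun w =>
      complex.Re z * complex.Re (g w) - complex.Im z * complex.Im (g w).
      by apply/funext => w; rewrite ReM.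
    by apply: integrableB_real => //; exact: integrableZ_real.
  have -> : (fun w => complex.Im (z * g w)) = fun w =>
    complex.Re z * complex.Im (g w) + complex.Im z * complex.Re (g w).
    by apply/funext => w; rewrite ImM.
  by apply: integrableD_real => //; exact: integrableZ_real.
have iD g h : Cintegrable P setT g -> Cintegrable P setT h ->
    Cintegrable P setT (fun w => g w + h w).
  move=> [g1 g2] [h1 h2]; split.
    have -> : (fun w => complex.Re (g w + h w)) = fun w =>
      complex.Re (g w) + complex.Re (h w) by apply/funext => w; rewrite ReD.
    exact: integrableD_real.
  have -> : (fun w => complex.Im (g w + h w)) = fun w =>
    complex.Im (g w) + complex.Im (h w) by apply/funext => w; rewrite ImD.
  exact: integrableD_real.
rewrite (eq_EC _ E) CintegralD//; last 2 first.
- exact: iZ.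
- by apply: iD; exact: iZ.
rewrite CintegralD//; last 2 first.
- exact: iZ.
- exact: iZ.
rewrite !CintegralZ// -/(phi t).
move: (EC (fun w => cis (t * Q w) * erfcC n t (1 - cm w))) (phi t)
  (EC (fun w => cis (t * Q w) * erfcC n t (cm w))) kap => A p B k.
ring.
Qed.

(** The segment integral is E cis(tQ) (H(c - N - 2) - H(c + N + 2)). Reflecting the first value
    produces the full constant, and the error consists of two values of H at arguments at least N +
    1, since 0 <= c <= 1; hence the [N.+2]. *)
Let tail_bound (N : nat) :
  nrm (Cintegral leb `[- N.+2%:R, N.+2%:R] (fun u => s * psistar f t u ^+ n) -
    kap * phi t) <= 16 * (2 * n%:R * sg * N.+1%:R)^-1.
Proof.
have NN : - N.+2%:R <= N.+2%:R :> R by rewrite (@le_trans _ _ 0)// oppr_le0.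
rewrite (psistar_segment n0 mY Y01 fY indY t0 NN).1.
pose e w := cis (t * Q w) * (erfcC n t (N.+2%:R - cm w) + erfcC n t (N.+2%:R + cm w)).
have mN1 : measurable_fun setT (fun w => N.+2%:R - cm w) by exact: measurable_funB.
have mN2 : measurable_fun setT (fun w => N.+2%:R + cm w) by exact: measurable_funD.
have me : Cmeasurable setT e.
  rewrite /e; under eq_fun do rewrite mulrDr.
  by apply: CmeasurableD; exact: merfc.
have be w : nrm (e w) <= 8 * (2 * n%:R * sg * N.+1%:R)^-1.
  have dec c : N.+1%:R <= c -> nrm (erfcC n t c) <= 2 * (2 * n%:R * sg * N.+1%:R)^-1.
    move=> Nc; have c0 : 0 < c by apply: lt_le_trans Nc; rewrite ltr0n.
    have [h1 h2] := erfc_decay n0R sg0 c0.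
    have le : (2 * n%:R * sg * c)^-1 <= (2 * n%:R * sg * N.+1%:R)^-1.
      rewrite lef_pV2 ?posrE; last 2 first.
      - by rewrite !mulr_gt0.
      - by rewrite !mulr_gt0// ltr0n.
      by rewrite ler_pM2l// !mulr_gt0.
    have -> : 2 * (2 * n%:R * sg * N.+1%:R)^-1 = (2 * n%:R * sg * N.+1%:R)^-1 +
       (2 * n%:R * sg * N.+1%:R)^-1 by ring.
    by apply: lerD; [exact: le_trans h1 le | exact: le_trans h2 le].
  apply: (le_trans (nrmM _ _)).
  have -> : 8 * (2 * n%:R * sg * N.+1%:R)^-1 = 2 * (2 * (2 * n%:R * sg * N.+1%:R)^-1 +
    2 * (2 * n%:R * sg * N.+1%:R)^-1) by ring.
  apply: ler_pM; rewrite ?nrm_ge0 ?nrm_cis//; apply: (le_trans (nrmD _ _)).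
  have /andP[c0 c1] := m01 w.
  have NS : N.+2%:R = N.+1%:R + 1 :> R by rewrite -natr1.
  by apply: lerD; apply: dec; rewrite NS; lra.
have E w : cis (t * Q w) * (erfcC n t (- N.+2%:R + cm w) - erfcC n t (N.+2%:R + cm w)) =
   kap * cis (t * Q w) + (- 1) * e w.
  rewrite (_ : - N.+2%:R + cm w = - (N.+2%:R - cm w)) ?erfcCN' /e; first by ring.
  by rewrite opprB addrC.
have ie : Cintegrable P setT e by exact: Cintegrable_prob me be.
rewrite (eq_EC _ E) CintegralD//; last 2 first.
- split.
    have -> : (fun w => complex.Re (kap * cis (t * Q w))) = fun w =>
      Num.sqrt (pi / n%:R) * complex.Re (cis (t * Q w)).
      by apply/funext => w; rewrite ReM /= mul0r subr0.
    by apply: integrableZ_real => //; exact: icis.1.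
  have -> : (fun w => complex.Im (kap * cis (t * Q w))) = fun w =>
      Num.sqrt (pi / n%:R) * complex.Im (cis (t * Q w)).
    by apply/funext => w; rewrite ImM /= mul0r addr0.
  by apply: integrableZ_real => //; exact: icis.2.
- apply: (@Cintegrable_prob _ _ _ P _ (8 * (2 * n%:R * sg * N.+1%:R)^-1)).
    by apply: CmeasurableM => //; exact: Cmeasurable_cst.
  by move=> w; rewrite mulN1r nrmN.
rewrite !CintegralZ// -/(phi t) addrAC subrr add0r mulN1r nrmN.
have -> : 16 * (2 * n%:R * sg * N.+1%:R)^-1 =
  2 * \int[P]_w (8 * (2 * n%:R * sg * N.+1%:R)^-1).
  by rewrite Rintegral_prob_cst; ring.
apply: nrm_Cintegral => //.
by apply: (@integrable_prob _ _ _ P _ `|8 * (2 * n%:R * sg * N.+1%:R)^-1|).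
Qed.

Lemma psistar_measurable : Cmeasurable setT (fun u => s * psistar f t u ^+ n).
Proof.
have U : (setT : set R) = \bigcup_N (`[- N%:R, N%:R]%classic : set R).
  apply/seteqP; split => // x _; exists (Num.truncn `|x|).+1 => //=.
  by rewrite in_itv/= -ler_norml ltW// truncnS_gt.
have NN (N : nat) : - N%:R <= N%:R :> R by rewrite (@le_trans _ _ 0)// oppr_le0.
have h (N : nat) := (psistar_segment n0 mY Y01 fY indY t0 (NN N)).2.
by split; rewrite U; apply/measurable_fun_bigcup => // N; [exact: (h N).1 | exact: (h N).2].
Qed.

(** The integrals over growing segments have two limits: the line integral, by domination with the
    bound on psi*, and the constant times phi, by the tail bound. They must agree. *)
Lemma line_integral :
  Cintegral leb setT (fun u => s * psistar f t u ^+ n) = kap * phi t.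
Proof.
have [C C0 /(_ t (lexx _))[hC _]] := psi_powers_bound t0.
set G := fun u => s * psistar f t u ^+ n; set I := Cintegral leb setT G.
have [mG1 mG2] := psistar_measurable.
pose B := C * (Num.sqrt t)^-1 ^+ n.-1.
have key (r : R -> R) : measurable_fun setT r -> (forall u, `|r u| <= nrm (G u)) ->
   (fun N : nat => \int[leb]_(u in `[- N.+2%:R, N.+2%:R]) r u) @ \oo -->
   \int[leb]_u r u.
  move=> mr rG.
  pose S (N : nat) := (`[- N.+2%:R, N.+2%:R]%classic : set R).
  have -> : (fun N : nat => \int[leb]_(u in `[- N.+2%:R, N.+2%:R]) r u) =
     (fun N : nat => \int[leb]_u (r u * \1_(S N) u)).
    apply/funext => N; rewrite Rintegral_mkcond; apply: eq_Rintegral => u _.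
    by rewrite patchE indicE /S; case: ifPn => _; rewrite ?mulr1 ?mulr0.
  have [||||_] := @Rintegral_dct _ _ _ leb setT (fun N u => r u * \1_(S N) u) r
    (fun u => B * (1 + u ^+ 2)^-1) measurableT; last by [].
  - move=> N; apply: measurable_funM => //; apply: measurable_indic.
    by rewrite /S; exact: measurable_itv.
  - move=> u _; apply: cvg_near_cst; near=> N.
    rewrite indicE mem_set ?mulr1// /S /= in_itv/= -ler_norml.
    apply: (@le_trans _ _ N%:R); last by rewrite ler_nat -addn2 leq_addr.
    by near: N; exact: nbhs_infty_ger.
  - exact: integrable_cauchyZ.
  - move=> N u _; apply: (@le_trans _ _ `|r u|).
      by rewrite normrM ler_piMr// indic_norm_le1.
    exact: le_trans (rG u) (hC u).
have fin (F : R[i] -> R) : (forall z, `|F z| <= nrm z) -> (forall z w, F (z - w) = F z - F w) ->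
   (fun N : nat => F (Cintegral leb `[- N.+2%:R, N.+2%:R] G)) @ \oo --> F I ->
   F I = F (kap * phi t).
  move=> F1 F2 cF; apply/eqP; rewrite -subr_eq0 -normr_eq0; apply/eqP.
  pose D (N : nat) := `|F (Cintegral leb `[- N.+2%:R, N.+2%:R] G) - F (kap * phi t)|.
  have c1 : D @ \oo --> `|F I - F (kap * phi t)|.
    by apply: cvg_norm; apply: cvgB => //; exact: cvg_cst.
  have c2 : D @ \oo --> (0 : R).
    have a0 : 0 < 2 * n%:R * sg by rewrite !mulr_gt0.
    apply: (@squeeze_cvgr _ _ _ _ (fun=> 0) (fun N => 16 * (2 * n%:R * sg)^-1 * N.+1%:R^-1)).
    - apply: nearW => N; rewrite normr_ge0 /=.
      rewrite /D -F2; apply: (le_trans (F1 _)); apply: (le_trans (tail_bound N)).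
      by rewrite invfM mulrA.
    - exact: cvg_cst.
    - rewrite -[X in _ --> X](mulr0 (16 * (2 * n%:R * sg)^-1)).
      by apply: cvgMr; exact: cvg_harmonic.
  exact: (cvg_unique _ c1 c2).
have RB (z w : R[i]) : complex.Re (z - w) = complex.Re z - complex.Re w.
  by case: z => ? ?; case: w.
have IB (z w : R[i]) : complex.Im (z - w) = complex.Im z - complex.Im w.
  by case: z => ? ?; case: w.
have e1 := fin _ (@Re_le_nrm R) RB (key _ mG1 (fun u => Re_le_nrm _)).
have e2 := fin _ (@Im_le_nrm R) IB (key _ mG2 (fun u => Im_le_nrm _)).
have ext (z w : R[i]) : complex.Re z = complex.Re w -> complex.Im z = complex.Im w ->
    z = w by case: z => ? ?; case: w => ? ? /= -> ->.
exact: ext.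
Unshelve. all: by end_near.
Qed.

End Frequency.

(** The line integral is read backwards: phi is a multiple of an integral whose integrand has just
    been bounded. *)
Lemma phi_bound t1 : 0 < t1 -> exists2 C, 0 <= C & forall t, t1 <= t ->
  nrm (phi t) <= C * (Num.sqrt t)^-1 ^+ n.-1.
Proof.
move=> t10; have [C C0 hC] := psi_powers_bound t10.
pose k := Num.sqrt (pi / n%:R : R).
have k0 : 0 < k by rewrite sqrtr_gt0 divr_gt0// pi_gt0.
pose I := \int[leb]_u (1 + u ^+ 2)^-1.
have I0 : 0 <= I.
  by apply: Rintegral_ge0 => u _; exact: ltW (cauchyw_gt0 u).
exists (2 * I * C / k); first by rewrite divr_ge0 ?mulr_ge0// ltW.
move=> t t1t; have t0 : 0 < t by exact: lt_le_trans t1t.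
have [h _] := hC t t1t.
have := @nrm_Cintegral _ _ _ leb setT _
  (fun u => (C * (Num.sqrt t)^-1 ^+ n.-1) * (1 + u ^+ 2)^-1) measurableT
  (psistar_measurable t0) (fun u _ => h u) (integrable_cauchyZ _ measurableT).
rewrite line_integral// RintegralZl//; last exact: integrable_cauchy.
have -> : nrm (kap * phi t) = k * nrm (phi t).
  by rewrite /nrm ReM ImM /= !mul0r subr0 addr0 !normrM gtr0_norm// mulrDr.
rewrite -/I => hh.
have -> : 2 * I * C / k * (Num.sqrt t)^-1 ^+ n.-1 =
  (2 * (C * (Num.sqrt t)^-1 ^+ n.-1 * I)) / k by ring.
by rewrite ler_pdivlMr// mulrC.
Qed.

End Representations.

Lemma cvg_eqfun (R : realType) (u v : nat -> R) (l : R) : u =1 v ->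
  u @ \oo --> l -> v @ \oo --> l.
Proof. by move=> /funext ->. Qed.

Lemma cvg_eq_lim (R : realType) (u v : nat -> R) (a b : R) :
  u @ \oo --> a -> v @ \oo --> b -> u =1 v -> a = b.
Proof.
by move=> ua vb /funext uv; move: vb; rewrite -uv => vb; exact: (cvg_unique _ ua vb).
Qed.

(** * The maximum of Q on the unit cube *)

Section RangeOfQ.
Context {R : realType}.
Implicit Types (S y : R).

Lemma int_prod_succ_ge0 (m : int) : 0 <= m%:~R * (m%:~R + 1) :> R.
Proof.
have -> : m%:~R * (m%:~R + 1) = (m * (m + 1))%:~R :> R by rewrite rmorphM rmorphD.
by rewrite ler0z; nia.
Qed.

(* The bound is tight at 0-1 vectors; the case [n.+1] is the convex combination
   with weights [1 - x ord_max], [x ord_max] of the bounds at [m] and [m - 1]. *)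
Lemma sum_parabola_ge (n : nat) (x : 'I_n -> R) (m : int) :
  (forall i, 0 <= x i <= 1) ->
  0 <= \sum_(i < n) x i * (1 - x i) +
    (\sum_(i < n) x i - m%:~R) * (\sum_(i < n) x i - m%:~R - 1).
Proof.
elim: n x m => [|n IH] x m x01.
  rewrite !big_ord0 sub0r add0r.
  have -> : - m%:~R * (- m%:~R - 1) = m%:~R * (m%:~R + 1) :> R by ring.
  exact: int_prod_succ_ge0.
rewrite !big_ord_recr /=.
have x01' i : 0 <= x (widen_ord (leqnSn n) i) <= 1 by [].
have h1 := IH _ m x01'; have h2 := IH _ (m - 1) x01'; move: h1 h2.
set A := \sum_(i < n) _ * _; set S := \sum_(i < n) _.
have /andP[y0 y1] := x01 ord_max; set y := x ord_max in y0 y1 *.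
rewrite rmorphB /= => h1 h2.
have -> : A + y * (1 - y) + (S + y - m%:~R) * (S + y - m%:~R - 1) =
  (1 - y) * (A + (S - m%:~R) * (S - m%:~R - 1)) +
  y * (A + (S - (m%:~R - 1)) * (S - (m%:~R - 1) - 1)) by ring.
by rewrite addr_ge0// mulr_ge0// subr_ge0.
Qed.

Lemma QfunE (n : nat) (x : 'I_n -> R) : (0 < n)%N ->
  Qfun x = \sum_(i < n) x i ^+ 2 - (\sum_(i < n) x i) ^+ 2 / n%:R.
Proof.
move=> n0; rewrite /Qfun; set S := \sum_(j < n) x j.
have nR : (n%:R : R) != 0 by rewrite pnatr_eq0 -lt0n.
rewrite (eq_bigr (fun i => x i ^+ 2 + (- 2 * (S / n%:R) * x i + (S / n%:R) ^+ 2))); last first.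
  by move=> i _; ring.
rewrite !big_split /= -mulr_sumr sumr_const card_ord -/S -mulr_natr.
by field.
Qed.

Lemma Qfun_ge0 (n : nat) (x : 'I_n -> R) : 0 <= Qfun x.
Proof. by apply: sumr_ge0 => i _; exact: sqr_ge0. Qed.

(** 4 j (n - j) = n^2 - (n - 2j)^2. The square is nonnegative, and at least 1 when n is odd, because
    n - 2j is then an odd integer. The quotient is the value of Q at a 0-1 vector with j ones, if 0
    <= j <= n. *)
Lemma qsup_max (n : nat) (j : int) : (0 < n)%N ->
  j%:~R * (n%:R - j%:~R) / n%:R <= qsup n :> R.
Proof.
move=> n0; have nR : 0 < n%:R :> R by rewrite ltr0n.
rewrite ler_pdivrMr// /qsup; case: ifP => on.
  have -> : (n%:R ^+ 2 - 1) / (4 * n%:R) * n%:R = (n%:R ^+ 2 - 1) / 4 :> R.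
    by field; rewrite gt_eqF.
  have : 1 <= (n%:Z - j * 2) ^+ 2.
    have -> : n = (n./2 * 2 + 1)%N by rewrite muln2 addn1 -add1n -{1}[n]odd_double_half on.
    have -> : (n./2 * 2 + 1)%N%:Z - j * 2 = (n./2%:Z - j) * 2 + 1 by lia.
    move: (n./2%:Z - j) => z; have : 0 <= z * (z + 1) by nia.
    by rewrite expr2; nia.
  move=> h; have : 1 <= (n%:R - j%:~R * 2) ^+ 2 :> R.
    by have := h; rewrite -(ler_int R) rmorphXn rmorphB rmorphM /=.
  by rewrite ler_pdivlMr//; nra.
have := sqr_ge0 (n%:R - j%:~R * 2 : R).
have -> : n%:R / 4 * n%:R = n%:R ^+ 2 / 4 :> R by ring.
by rewrite ler_pdivlMr//; nra.
Qed.

(** With S the sum, m its integer part and a = S - m, Q is at most the interpolation between its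
    values at 0-1 vectors with m and with m + 1 ones: the slack is a (1 - a) (1 - 1/n). *)
Lemma Qfun_le_qsup (n : nat) (x : 'I_n -> R) : (0 < n)%N ->
  (forall i, 0 <= x i <= 1) -> Qfun x <= qsup n.
Proof.
move=> n0 x01; rewrite QfunE//; set S := \sum_(i < n) x i.
have nR : 0 < n%:R :> R by rewrite ltr0n.
pose m := Num.floor S.
have mS : m%:~R <= S by exact: floor_le_tmp.
have Sm : S < m%:~R + 1 by have := floorD1_gt S; rewrite rmorphD.
have := sum_parabola_ge m x01; rewrite -/S => h.
have sq : \sum_(i < n) x i ^+ 2 = S - \sum_(i < n) x i * (1 - x i).
  by rewrite /S -sumrB; apply: eq_bigr => i _; ring.
have b1 := qsup_max m n0.
have b2 : (m%:~R + 1) * (n%:R - (m%:~R + 1)) / n%:R <= qsup n :> R.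
  by have := qsup_max (m + 1) n0; rewrite rmorphD.
move: b1 b2 mS Sm h; set M := m%:~R => b1 b2 mS Sm h.
pose a := S - M.
have key : S + (S - M) * (S - M - 1) - S ^+ 2 / n%:R <=
   (1 - a) * (M * (n%:R - M) / n%:R) + a * ((M + 1) * (n%:R - (M + 1)) / n%:R).
  rewrite -subr_ge0.
  have -> : (1 - a) * (M * (n%:R - M) / n%:R) + a * ((M + 1) * (n%:R - (M + 1)) / n%:R) -
     (S + (S - M) * (S - M - 1) - S ^+ 2 / n%:R) = a * (1 - a) * (1 - n%:R^-1).
    by rewrite /a; field; rewrite gt_eqF.
  rewrite !mulr_ge0 ?subr_ge0 /a; try lra.
  by rewrite invf_le1// ler1n.
have : (1 - a) * (M * (n%:R - M) / n%:R) + a * ((M + 1) * (n%:R - (M + 1)) / n%:R) <=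
  (1 - a) * qsup n + a * qsup n.
  by apply: lerD; apply: ler_wpM2l => //; rewrite /a; lra.
by rewrite sq; lra.
Qed.

Lemma qsup_gt0 (n : nat) : (2 <= n)%N -> 0 < qsup n :> R.
Proof.
move=> n2; have nR : 2 <= n%:R :> R by rewrite (ler_nat _ 2).
rewrite /qsup; case: ifP => _; last by rewrite divr_gt0//; lra.
by rewrite divr_gt0//; [nra | lra].
Qed.

Lemma tk_gt0 (n k : nat) : (2 <= n)%N -> (0 < k)%N -> 0 < tk n k :> R.
Proof.
by move=> n2 k0; rewrite divr_gt0 ?qsup_gt0// mulr_gt0 ?ltr0n// pi_gt0.
Qed.

Lemma tk_mul1 (n k : nat) : tk n k = k%:R * tk n 1 :> R.
Proof. by rewrite /tk; ring. Qed.

Lemma tk1_le (n k : nat) : (2 <= n)%N -> (0 < k)%N -> tk n 1 <= tk n k :> R.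
Proof.
move=> n2 k0; rewrite [leRHS]tk_mul1 ler_peMl//; last by rewrite ler1n.
exact/ltW/tk_gt0.
Qed.

End RangeOfQ.

Section RepresentationOfSeries.
Context d (T : measurableType d) (R : realType) (P : probability T R).
Context (n : nat) (Y : 'I_n -> T -> R) (f : R -> R).
Context (n2 : (2 <= n)%N) (mY : forall i, measurable_fun setT (Y i))
  (Y01 : forall i w, 0 <= Y i w <= 1)
  (fY : forall i, is_density_of P (Y i) f) (indY : mutually_independent P Y).
Context (K L : R) (bf : bounded_var f K) (uf : unif_cont f) (L0 : 0 <= L)
  (fL : forall x, 0 <= x <= 1 -> `|f x| <= L).
Notation leb := (@lebesgue_measure R).
Local Notation unit_itv := (`[0, 1]%classic : set R).
Local Notation half_line := (`[0, +oo[%classic : set R).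
Local Notation Q := (sample_Q Y).
Local Notation phi t := (phiQ P Y t).

Let n0 : (0 < n)%N. Proof. exact: ltnW. Qed.
Let n0R : 0 < n%:R :> R. Proof. by rewrite ltr0n. Qed.
Let mQ := measurable_sample_Q mY.

(** The hypothesis on [w] is exactly what the exchange needs: the terms are O(k^(-3/2)). It covers
    the cdf weights for n >= 2 and the differentiated ones for n >= 4. *)
Lemma both_reprs_of_limit (w : nat -> R) (B l : R) : 0 <= B ->
  (forall k, (0 < k)%N -> `|w k| * (Num.sqrt (tk n k))^-1 ^+ n.-1 <=
     B * (Num.sqrt k%:R)^-1 ^+ 3) ->
  (fun N => \sum_(1 <= k < N) complex.Im (phi (tk n k)) * w k) @ \oo --> l ->
  both_reprs f n w (2 / pi * l).
Proof.
move=> B0 wB cl.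
have [C C0 hC] := psi_powers_bound n2 fY bf uf L0 fL (tk_gt0 n2 (ltn0Sn 0) : 0 < tk n 1 :> R).
pose b k := 2 * C * B * (Num.sqrt k%:R)^-1 ^+ 3.
have CB0 : 0 <= 2 * C * B by rewrite !mulr_ge0.
have b0 k : (0 < k)%N -> 0 <= b k.
  by move=> _; rewrite mulr_ge0// exprn_ge0// invr_ge0.
(* The factor 2 leaves room for the sum of two powers of psi in [a3]. *)
have gen D (G : nat -> R -> R[i]) : measurable D ->
    (forall k, (0 < k)%N -> Cmeasurable D (G k)) ->
    (forall k u, (0 < k)%N -> D u -> nrm (G k u) <=
       2 * (C * (Num.sqrt (tk n k))^-1 ^+ n.-1 * cauchyw u)) ->
    SI_ok D (fun u k => complex.Im (G k u) * w k) /\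
    (fun N => \sum_(1 <= k < N) complex.Im (Cintegral leb D (G k)) * w k) @ \oo -->
      SI D (fun u k => complex.Im (G k u) * w k).
  move=> mD mG bG.
  have [||||||h1 h2] := @SI_interchange _ D (fun u k => complex.Im (G k u) * w k) b
     (@cauchyw R) mD.
  - by move=> k k0; apply: measurable_funM => //; exact: (mG k k0).2.
  - have := @integrable_cauchyZ R 1 D mD; congr (integrable _ _ _).
    by apply/funext => u /=; rewrite mul1r.
  - by move=> u _; exact/ltW/cauchyw_gt0.
  - move=> u k Du k0; rewrite normrM.
    apply: (@le_trans _ _ (2 * (C * (Num.sqrt (tk n k))^-1 ^+ n.-1 * cauchyw u) * `|w k|)).
      by apply: ler_wpM2r => //; exact: le_trans (Im_le_nrm _) (bG k u k0 Du).
    have -> : 2 * (C * (Num.sqrt (tk n k))^-1 ^+ n.-1 * cauchyw u) * `|w k| =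
      2 * C * cauchyw u * (`|w k| * (Num.sqrt (tk n k))^-1 ^+ n.-1) by ring.
    have -> : b k * cauchyw u = 2 * C * cauchyw u * (B * (Num.sqrt k%:R)^-1 ^+ 3).
      by rewrite /b; ring.
    apply: ler_wpM2l; last exact: wB.
    by rewrite !mulr_ge0//; exact/ltW/cauchyw_gt0.
  - exact: b0.
  - exact: cvg_sum_three_halves.
  split => //; apply: (cvg_eqfun _ h2) => N.
  apply: eq_big_nat => k /andP[k0 _].
  rewrite /Cintegral /= RintegralZr//.
  apply: (@integrable_dom _ _ _ leb D _
    (fun u => (2 * (C * (Num.sqrt (tk n k))^-1 ^+ n.-1)) * (1 + u ^+ 2)^-1)) => //.
  - exact: (mG k k0).2.
  - move=> u Du; apply: (le_trans (Im_le_nrm _)).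
    by have := bG k u k0 Du; rewrite /cauchyw mulrA.
  - exact: integrable_cauchyZ.
pose kp := Num.sqrt (pi / n%:R) : R.
have cstE : Defs.cst n * kp = 2 / pi :> R.
  have p0 : 0 < pi :> R := pi_gt0 R.
  have sn : 0 < Num.sqrt n%:R :> R by rewrite sqrtr_gt0.
  have sp : 0 < Num.sqrt pi :> R by rewrite sqrtr_gt0.
  rewrite /Defs.cst /kp sqrtrM ?sqrtrV ?ltW//.
  have E (p u v : R) : 0 < p -> 0 < u -> 0 < v -> 2 / (p * u) * v * (u / v) = 2 / p.
    by move=> *; field; rewrite !gt_eqF.
  exact: E.
have ckp : (fun N => \sum_(1 <= k < N) kp * (complex.Im (phi (tk n k)) * w k)) @ \oo --> kp * l.
  have -> : (fun N => \sum_(1 <= k < N) kp * (complex.Im (phi (tk n k)) * w k)) =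
      (fun N => kp * \sum_(1 <= k < N) (complex.Im (phi (tk n k)) * w k)).
    by apply/funext => N; rewrite mulr_sumr.
  by apply: cvgMr.
have Imkp z : complex.Im ((Complex kp 0 : R[i]) * z) = kp * complex.Im z.
  by rewrite ImM /= mul0r addr0.
have tk0 k : (0 < k)%N -> 0 < tk n k :> R by exact: tk_gt0.
have tk1 k : (0 < k)%N -> tk n 1 <= tk n k :> R by exact: tk1_le.
have half x : 0 <= x -> x <= 2 * x :> R by move=> x0; lra.
have bnd0 k u : (0 < k)%N -> 0 <= C * (Num.sqrt (tk n k))^-1 ^+ n.-1 * cauchyw u.
  move=> k0; apply: mulr_ge0; last exact/ltW/cauchyw_gt0.
  by apply: mulr_ge0 => //; apply: exprn_ge0; rewrite invr_ge0.
split.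
  have [||h1 h2] := gen setT (fun k u => sqrt_mit (tk n k) * psistar f (tk n k) u ^+ n) measurableT.
  - by move=> k k0; exact: (psistar_measurable n2 mY Y01 fY indY (tk0 k k0)).
  - move=> k u k0 _; apply: le_trans ((hC _ (tk1 k k0)).1 u) _.
    by apply: half; exact: bnd0.
  split => //.
  have e : SI setT (a1 f n w) = kp * l.
    apply: (cvg_eq_lim h2 ckp) => N; apply: eq_big_nat => k /andP[k0 _].
    by rewrite (line_integral n2 mY Y01 fY indY bf uf L0 fL (tk0 k k0)) Imkp mulrA.
  by rewrite e mulrA cstE.
have [|||h1 h2] := gen unit_itv (fun k u => sqrt_mit (tk n k) * psistar f (tk n k) (- u) ^+ n).
- exact: measurable_itv.
- by move=> k k0; exact: (psistar_middle n0 mY Y01 fY indY (tk0 k k0)).2.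
- move=> k u k0 _; apply: le_trans ((hC _ (tk1 k k0)).1 (- u)) _.
  by rewrite /cauchyw sqrrN; apply: half; exact: bnd0.
have mh1 k (k0 : (0 < k)%N) := (psi_right_integral n0 mY Y01 fY indY (tk0 k k0)).2.
have mh2 k (k0 : (0 < k)%N) := (psi_left_integral n0 mY Y01 fY indY (tk0 k k0)).2.
have bh1 k u : (0 < k)%N -> half_line u -> nrm (psi f (tk n k) (Complex u 0) ^+ n) <=
   C * (Num.sqrt (tk n k))^-1 ^+ n.-1 * cauchyw u.
  by move=> k0; rewrite /= in_itv/= andbT => u0; exact: ((hC _ (tk1 k k0)).2 u u0).1.
have bh2 k u : (0 < k)%N -> half_line u ->
   nrm (psi f (tk n k) (- Complex u 0 - sqrt_mit (tk n k)) ^+ n) <=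
   C * (Num.sqrt (tk n k))^-1 ^+ n.-1 * cauchyw u.
  by move=> k0; rewrite /= in_itv/= andbT => u0; exact: ((hC _ (tk1 k k0)).2 u u0).2.
have [|||h3 h4] := gen half_line (fun k y => psi f (tk n k) (Complex y 0) ^+ n +
    psi f (tk n k) (- Complex y 0 - sqrt_mit (tk n k)) ^+ n).
- exact: measurable_itv.
- by move=> k k0; apply: CmeasurableD; [exact: mh1 | exact: mh2].
- move=> k u k0 u0; apply: (le_trans (nrmD _ _)).
  apply: (le_trans (lerD (bh1 k u k0 u0) (bh2 k u k0 u0))).
  by rewrite mulr_natl mulr2n.
split => //; split => //.
have e : SI unit_itv (a2 f n w) + SI half_line (a3 f n w) = kp * l.
  apply: (cvg_eq_lim (cvgD h2 h4) ckp) => N; rewrite fctE -big_split; apply: eq_big_nat => k /andP[k0 _].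
  have ih (g : R -> R[i]) : Cmeasurable half_line g -> (forall u, half_line u ->
      nrm (g u) <= C * (Num.sqrt (tk n k))^-1 ^+ n.-1 * cauchyw u) ->
      Cintegrable leb half_line g.
    move=> mg bg.
    have ii : leb.-integrable half_line (EFin \o
        (fun u => C * (Num.sqrt (tk n k))^-1 ^+ n.-1 * (1 + u ^+ 2)^-1)).
      by apply: integrable_cauchyZ; exact: measurable_itv.
    exact: (Cintegrable_dom _ _ _ ii).
  rewrite CintegralD; last 3 first.
  - exact: measurable_itv.
  - by apply: ih; [exact: mh1 | move=> u; exact: bh1].
  - by apply: ih; [exact: mh2 | move=> u; exact: bh2].
  rewrite -[LHS]/(complex.Im _ * w k + complex.Im _ * w k) -mulrDl -ImD.
  rewrite (split_line_integral n2 mY Y01 fY indY (tk0 k k0)).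
  by rewrite Imkp mulrA.
by rewrite -mulrDr e mulrA cstE.
Qed.

Lemma wcdf_bound x k : (0 < k)%N ->
  `|wcdf n x k| * (Num.sqrt (tk n k))^-1 ^+ n.-1 <=
  2 * (Num.sqrt (tk n 1))^-1 ^+ n.-1 * (Num.sqrt k%:R)^-1 ^+ 3 :> R.
Proof.
move=> k0; have kR : 0 < k%:R :> R by rewrite ltr0n.
have k1 : 1 <= k%:R :> R by rewrite ler1n.
rewrite tk_mul1 sqrtrM; last exact: ltW.
rewrite invfM exprMn.
set r := (Num.sqrt k%:R)^-1; set r1 := (Num.sqrt (tk n 1))^-1.
have r0 : 0 <= r by rewrite invr_ge0.
have r10 : 0 <= r1 by rewrite invr_ge0.
have r2 : r ^+ 2 = k%:R^-1 by rewrite exprVn sqr_sqrtr// ltW.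
have rle : r <= 1.
  by rewrite invf_le1 ?sqrtr_gt0// -[leLHS]sqrtr1 ler_sqrt// (le_trans ler01).
have rn : r ^+ n.-1 <= r.
  by rewrite -[leRHS]expr1; apply: ler_wiXn2l => //; case: (n) n2 => [|[]].
have w2 : `|wcdf n x k| <= 2 * r ^+ 2.
  rewrite /wcdf r2 normrM [`|k%:R^-1|]gtr0_norm ?invr_gt0// ler_wpM2r ?invr_ge0//.
  by have := cos_max (tk n k * x); rewrite !ler_norml; lra.
have -> : 2 * r1 ^+ n.-1 * r ^+ 3 = 2 * r ^+ 2 * (r * r1 ^+ n.-1) by ring.
apply: ler_pM => //; first by rewrite mulr_ge0 ?exprn_ge0.
by rewrite ler_wpM2r// exprn_ge0.
Qed.

(** This weight does not decay, so all three factors k^(-1/2) must come from t_k^((1-n)/2): this is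
    where n >= 4 enters. *)
Lemma wpdf_bound x k : (4 <= n)%N -> (0 < k)%N ->
  `|wpdf n x k| * (Num.sqrt (tk n k))^-1 ^+ n.-1 <=
  tk n 1 * (Num.sqrt (tk n 1))^-1 ^+ n.-1 * (Num.sqrt k%:R)^-1 ^+ 3 :> R.
Proof.
move=> n4 k0; have kR : 0 < k%:R :> R by rewrite ltr0n.
have t10 : 0 < tk n 1 :> R by exact: tk_gt0.
have w2 : `|wpdf n x k| <= tk n 1.
  rewrite /wpdf; set a := sin _.
  have -> : tk n k * a / k%:R = tk n 1 * a.
    by rewrite tk_mul1; field; rewrite gt_eqF.
  by rewrite normrM gtr0_norm// ler_piMr ?sin_max// ltW.
rewrite [tk n k]tk_mul1 sqrtrM; last exact: ltW.
rewrite invfM exprMn.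
set r := (Num.sqrt k%:R)^-1; set r1 := (Num.sqrt (tk n 1))^-1.
have r0 : 0 <= r by rewrite invr_ge0.
have r10 : 0 <= r1 by rewrite invr_ge0.
have rle : r <= 1.
  rewrite invf_le1 ?sqrtr_gt0// -[leLHS]sqrtr1 ler_sqrt// ?ler1n//.
have rn : r ^+ n.-1 <= r ^+ 3.
  by apply: ler_wiXn2l => //; case: (n) n4 => [|[|[|[]]]].
rewrite -mulrA [r1 ^+ _ * _]mulrC; apply: ler_pM => //.
  by rewrite mulr_ge0 ?exprn_ge0.
by rewrite ler_wpM2r// exprn_ge0.
Qed.

End RepresentationOfSeries.

(** * Fourier inversion of the cdf *)

Section BoundedExpectations.
Context d (T : measurableType d) (R : realType) (P : probability T R).

Lemma Rintegral_sum_prob (I : Type) (s : seq I) (F : I -> T -> R) (M : R) :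
  (forall i, measurable_fun setT (F i)) -> (forall i w, `|F i w| <= M) ->
  \int[P]_w \sum_(i <- s) F i w = \sum_(i <- s) \int[P]_w F i w.
Proof.
move=> mF FM; elim: s => [|i s IH].
  rewrite big_nil; under eq_Rintegral do rewrite big_nil.
  exact: Rintegral_prob_cst.
rewrite big_cons -IH; under eq_Rintegral do rewrite big_cons.
rewrite RintegralD//; first exact: integrable_prob (mF i) (FM i).
apply: (@integrable_prob _ _ _ _ _ (\sum_(j <- s) M)).
  exact: measurable_sum.
by move=> w; apply: (le_trans (ler_norm_sum _ _ _)); apply: ler_sum.
Qed.

Lemma Rintegral_prob_dct_ae (f_ : nat -> T -> R) (g : T -> R) (M : R) :
  (forall N, measurable_fun setT (f_ N)) -> measurable_fun setT g ->
  {ae P, forall w, (fun N => f_ N w) @ \oo --> g w} ->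
  (forall N w, `|f_ N w| <= M) ->
  (fun N => \int[P]_w f_ N w) @ \oo --> \int[P]_w g w.
Proof.
move=> mf mg fg fM.
have iM : P.-integrable setT (EFin \o (fun=> `|M|)).
  by apply: (@integrable_prob _ _ _ P _ `|M|) => // w; rewrite normr_id.
have [|||||h1 _ h2] := @dominated_convergence _ _ _ P setT measurableT
   (fun N => EFin \o f_ N) (EFin \o g) (EFin \o (fun=> `|M|)).
- by move=> N; exact/measurable_EFinP.
- exact/measurable_EFinP.
- apply: filterS fg => w h _; apply: cvg_EFin; first by near=> N.
  exact: h.
- exact: iM.
- by apply/aeW => w N _; rewrite lee_fin (le_trans (fM N w))// ler_norm.
apply: fine_cvg; rewrite fineK; first exact: h2.
exact: integrable_fin_num.
Unshelve. all: by end_near.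
Qed.

End BoundedExpectations.

Section Cdf.
Context d (T : measurableType d) (R : realType) (P : probability T R).
Context (n : nat) (Y : 'I_n -> T -> R) (f : R -> R).
Context (n2 : (2 <= n)%N) (mY : forall i, measurable_fun setT (Y i))
  (Y01 : forall i w, 0 <= Y i w <= 1)
  (fY : forall i, is_density_of P (Y i) f) (indY : mutually_independent P Y).
Context (K L : R) (bf : bounded_var f K) (uf : unif_cont f) (L0 : 0 <= L)
  (fL : forall x, 0 <= x <= 1 -> `|f x| <= L).
Local Notation Q := (sample_Q Y).
Local Notation phi t := (phiQ P Y t).

Let n0 : (0 < n)%N. Proof. exact: ltnW. Qed.
Let mQ := measurable_sample_Q mY.

Let mcosQ (a b : R) : measurable_fun setT (fun w => cos (a * Q w + b)).
Proof.
apply: (measurableT_comp (continuous_measurable_fun (@continuous_cos R))).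
by apply: measurable_funD => //; apply: measurable_funM.
Qed.

(** The left side is the modulus of the real part of exp(- i t x) phi(t). *)
Lemma normr_expectation_cos (t x : R) :
  `|\int[P]_w cos (t * Q w - t * x)| <= nrm (phi t).
Proof.
have [m1 m2] : Cmeasurable setT (fun w => cis (t * Q w)).
  by apply: Cmeasurable_cis; apply: measurable_funM.
have b w : nrm (cis (t * Q w)) <= 2 by exact: nrm_cis.
have [i1 i2] := @Cintegrable_prob _ _ _ P _ _ (conj m1 m2) b.
have -> : \int[P]_w cos (t * Q w - t * x) =
    cos (t * x) * \int[P]_w cos (t * Q w) + sin (t * x) * \int[P]_w sin (t * Q w).
  rewrite -!RintegralZl// -RintegralD//; try exact: integrableZ_real.
  by apply: eq_Rintegral => w _; rewrite cosB mulrC [X in _ + X = _]mulrC.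
apply: (le_trans (ler_normD _ _)); rewrite !normrM /nrm /phiQ /=.
by apply: lerD; rewrite ler_piMl// ?cos_max ?sin_max.
Qed.

(* The square of [|sum_(j < N) exp(i j N^2 (Q - x))|] is [N^2] where [Q = x], and its
   expectation is at most [N (1 + C)] by the decay of [phi]. *)
Lemma sample_Q_no_atom x : P [set w | Q w = x] = 0%E.
Proof.
pose A := Q @^-1` [set x].
have mA : measurable A by rewrite -[A]setTI; exact: mQ.
have -> : [set w | Q w = x] = A by [].
have fA : P A \is a fin_num by exact: fin_num_measure.
suff : fine (P A) = 0 by move=> h; rewrite -[P A]fineK// h.
have [C C0 hC] := phi_bound n2 mY Y01 fY indY bf uf L0 fL (ltr01 : 0 < 1 :> R).
set p := fine (P A).
have p0 : 0 <= p by exact: fine_ge0.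
have pE : p = \int[P]_w \1_[set x] (Q w) by rewrite Rintegral_indic_preimage.
(* For n = 2 the decay is only t^(-1/2), so frequencies of size N^2 are needed to gain 1/N. *)
have far (N : nat) (t : R) : (0 < N)%N -> N%:R ^+ 2 <= `|t| ->
    `|\int[P]_w cos (t * Q w - t * x)| <= C / N%:R.
  move=> N0 Nt; have NR : 1 <= N%:R :> R by rewrite ler1n.
  have N2 : 1 <= N%:R ^+ 2 :> R by rewrite expr_ge1// ler0n.
  have t1 : 1 <= `|t| by exact: le_trans Nt.
  have -> : \int[P]_w cos (t * Q w - t * x) = \int[P]_w cos (`|t| * Q w - `|t| * x).
    apply: eq_Rintegral => w _; have [t0|t0] := leP 0 t; first by rewrite ger0_norm.
    by rewrite ltr0_norm// -cosN; congr cos; ring.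
  apply: (le_trans (normr_expectation_cos _ _)); apply: (le_trans (hC _ t1)).
  rewrite ler_wpM2l//.
  have st1 : N%:R <= Num.sqrt `|t|.
    by rewrite -[leLHS]ger0_norm ?ler0n// -sqrtr_sqr ler_sqrt// (le_trans ler01).
  have st0 : 0 < Num.sqrt `|t| by apply: lt_le_trans st1; rewrite ltr0n.
  apply: (@le_trans _ _ (Num.sqrt `|t|)^-1).
    rewrite -[leRHS]expr1; apply: ler_wiXn2l; last by case: (n) n2 => [|[]].
      by rewrite invr_ge0 ltW.
    by rewrite invf_le1// (le_trans NR).
  by rewrite lef_pV2// ?posrE// ltr0n.
have key (N : nat) : (0 < N)%N -> N%:R * p <= 1 + C.
  move=> N0; have NR : 0 < N%:R :> R by rewrite ltr0n.
  rewrite -(ler_pM2l NR) mulrA -expr2.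
  pose th w (j : 'I_N) := (j%:R * N%:R ^+ 2) * Q w - (j%:R * N%:R ^+ 2) * x.
  pose S w := \sum_(j < N) \sum_(l < N) cos ((j%:R - l%:R) * N%:R ^+ 2 * Q w -
      (j%:R - l%:R) * N%:R ^+ 2 * x).
  have SE w : S w = (\sum_(j < N) cos (th w j)) ^+ 2 + (\sum_(j < N) sin (th w j)) ^+ 2.
    rewrite !expr2 !big_distrlr /= -big_split /=; apply: eq_bigr => j _.
    rewrite -big_split /=; apply: eq_bigr => l _; rewrite -cosB; congr cos.
    by rewrite /th; ring.
  have mS1 (j l : 'I_N) : measurable_fun setT (fun w =>
      cos ((j%:R - l%:R) * N%:R ^+ 2 * Q w - (j%:R - l%:R) * N%:R ^+ 2 * x)).
    exact: mcosQ.
  have mS2 (j : 'I_N) : measurable_fun setT (fun w => \sum_(l < N)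
      cos ((j%:R - l%:R) * N%:R ^+ 2 * Q w - (j%:R - l%:R) * N%:R ^+ 2 * x)).
    exact: measurable_sum.
  have bS2 (j : 'I_N) w : `|\sum_(l < N)
      cos ((j%:R - l%:R) * N%:R ^+ 2 * Q w - (j%:R - l%:R) * N%:R ^+ 2 * x)| <= N%:R.
    apply: (le_trans (ler_norm_sum _ _ _)).
    apply: (@le_trans _ _ (\sum_(l < N) 1)); last by rewrite sumr_const card_ord.
    by apply: ler_sum => l _; exact: cos_max.
  have mS : measurable_fun setT S by apply: measurable_sum => j; exact: mS2.
  have bS w : `|S w| <= \sum_(j < N) N%:R.
    by apply: (le_trans (ler_norm_sum _ _ _)); apply: ler_sum => j _; exact: bS2.
  apply: (@le_trans _ _ (\int[P]_w S w)).
    rewrite pE -RintegralZl//; last first.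
      apply: (@integrable_prob _ _ _ _ _ 1); first exact: measurable_indic_comp.
      by move=> w; exact: indic_norm_le1.
    apply: le_Rintegral => //.
    - apply: integrableZ_real => //.
      apply: (@integrable_prob _ _ _ _ _ 1); first exact: measurable_indic_comp.
      by move=> w; exact: indic_norm_le1.
    - exact: integrable_prob mS bS.
    move=> w _; rewrite SE indicE; case: (boolP (Q w \in _)) => [/set_mem /= Qx|_].
      rewrite mulr1 (eq_bigr (fun=> 1)); last by move=> j _; rewrite /th Qx subrr cos0.
      rewrite [X in _ <= _ + X ^+ 2]big1; last by move=> j _; rewrite /th Qx subrr sin0.
      by rewrite sumr_const card_ord expr0n addr0.
    by rewrite mulr0 addr_ge0 ?sqr_ge0.
  rewrite /S (Rintegral_sum_prob P _ mS2 bS2).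
  (* Every term costs at most C/N, the diagonal one 1 in addition; a row of N terms thus stays below
     1 + C. *)
  have row (j : 'I_N) : \int[P]_w (\sum_(l < N)
      cos ((j%:R - l%:R) * N%:R ^+ 2 * Q w - (j%:R - l%:R) * N%:R ^+ 2 * x)) <= 1 + C.
    rewrite (Rintegral_sum_prob P _ (mS1 j) (M := 1)); last by move=> l w; exact: cos_max.
    apply: (@le_trans _ _ (\sum_(l < N) ((j == l)%:R + C / N%:R))).
      apply: ler_sum => l _; have [->|jl] := eqVneq j l.
        under eq_Rintegral do rewrite subrr !mul0r subrr cos0.
        by rewrite Rintegral_prob_cst lerDl divr_ge0.
      rewrite add0r; apply: (le_trans (ler_norm _)); apply: far => //.
      rewrite normrM [X in _ <= _ * X]ger0_norm ?sqr_ge0// ler_peMl ?sqr_ge0//.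
      have := jl; rewrite -val_eqE /= neq_ltn => /orP[h|h].
        rewrite distrC ger0_norm; last by rewrite subr_ge0 ler_nat ltnW.
        by rewrite -natrB; [rewrite ler1n subn_gt0 | exact: ltnW].
      rewrite ger0_norm; last by rewrite subr_ge0 ler_nat ltnW.
      by rewrite -natrB; [rewrite ler1n subn_gt0 | exact: ltnW].
    rewrite big_split /= sumr_const card_ord -[_ *+ N]mulr_natr divfK ?gt_eqF//.
    rewrite (bigD1 j)//= eqxx big1 ?addr0// => l.
    by rewrite eq_sym => /negbTE ->.
  apply: (@le_trans _ _ (\sum_(j < N) (1 + C))); first by apply: ler_sum => j _; exact: row.
  by rewrite sumr_const card_ord mulr_natl.
apply/eqP; rewrite eq_le p0 andbT leNgt; apply/negP => pp.
have := key (Num.truncn ((1 + C) / p)).+1 isT.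
by rewrite leNgt -ltr_pdivrMr// truncnS_gt.
Qed.

Lemma sample_Q_ae_neq x : {ae P, forall w, Q w != x}.
Proof.
exists [set w | Q w = x]; split.
- have -> : [set w | Q w = x] = Q @^-1` [set x] by [].
  by rewrite -[_ @^-1` _]setTI; exact: mQ.
- exact: sample_Q_no_atom.
- by move=> w /= /negP; rewrite negbK => /eqP.
Qed.

Lemma fourier_cdf x : 0 <= x <= qsup n ->
  (fun N => \sum_(1 <= k < N) complex.Im (phi (tk n k)) * wcdf n x k) @ \oo -->
  pi / 2 * cdf_of P Q x.
Proof.
move=> /andP[x0 xq]; have q0 : 0 < qsup n :> R by exact: qsup_gt0.
have pi0 : 0 < pi :> R := pi_gt0 R.
pose a w := pi * Q w / qsup n; pose b := pi * x / qsup n.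
have a01 w : 0 <= a w <= pi.
  have Q0 : 0 <= Q w by exact: Qfun_ge0.
  have Qq : Q w <= qsup n by apply: Qfun_le_qsup => // i; exact: Y01.
  rewrite /a divr_ge0 ?mulr_ge0//=; try exact: ltW.
  by rewrite ler_pdivrMr// ler_pM2l.
have b01 : 0 <= b <= pi.
  rewrite /b divr_ge0 ?mulr_ge0//=; try exact: ltW.
  by rewrite ler_pdivrMr// ler_pM2l.
have ka k w : k%:R * a w = tk n k * Q w by rewrite /a /tk; ring.
have kb k : k%:R * b = tk n k * x by rewrite /b /tk; ring.
have mterm k : measurable_fun setT (fun w => sin (k%:R * a w) * wcdf n x k).
  apply: measurable_funM => //.
  apply: (measurableT_comp (continuous_measurable_fun (@continuous_sin R))).
  by apply: measurable_funM => //; apply: measurable_funM => //; apply: measurable_funM.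
have skE N w : step_kernel N (a w) b = \sum_(1 <= k < N.+1) sin (k%:R * a w) * wcdf n x k.
  by rewrite /step_kernel; apply: eq_bigr => k _; rewrite /wcdf kb.
rewrite -cvg_shiftS /=.
apply: (@cvg_eqfun _ (fun N => \int[P]_w step_kernel N (a w) b)).
  move=> N; under eq_Rintegral do rewrite skE.
  rewrite (Rintegral_sum_prob P _ mterm (M := 2)); last first.
    move=> k w; rewrite normrM -[leRHS]mul1r ler_pM// ?sin_max//.
    rewrite /wcdf normrM; case: k => [|k]; first by rewrite invr0 normr0 mulr0.
    have k1 : `|k.+1%:R^-1| <= 1 :> R.
      by rewrite ger0_norm ?invr_ge0// invf_le1 ?ltr0n// ler1n.
    rewrite -[leRHS]mulr1 ler_pM//.
    by have := cos_max (tk n k.+1 * x); rewrite !ler_norml; lra.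
  apply: eq_bigr => k _; rewrite /phiQ /Cintegral /=.
  under eq_Rintegral do rewrite ka.
  rewrite RintegralZr//; apply: (@integrable_prob _ _ _ _ _ 1).
    apply: (measurableT_comp (continuous_measurable_fun (@continuous_sin R))).
    exact: measurable_funM.
  by move=> w; exact: sin_max.
have mx : measurable [set r : R | r <= x].
  rewrite (_ : [set r : R | r <= x] = `]-oo, x]%classic); first exact: measurable_itv.
  by apply/seteqP; split => r /=; rewrite in_itv.
have -> : pi / 2 * cdf_of P Q x =
    \int[P]_w (pi / 2 * \1_[set r : R | r <= x] (Q w)).
  rewrite RintegralZl//; first by rewrite Rintegral_indic_preimage.
  apply: (@integrable_prob _ _ _ _ _ 1); last by move=> w; exact: indic_norm_le1.
  exact: measurable_indic_comp.
apply: (@Rintegral_prob_dct_ae _ _ _ P _ _ (2 * (pi + 17))).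
- move=> N; under eq_fun do rewrite skE.
  by apply: measurable_sum => k; exact: mterm.
- by apply: measurable_funM => //; exact: measurable_indic_comp.
(* Besides Q = x, the values 0 and q are excluded because the kernel converges to the step only for
   angles strictly between 0 and pi. *)
- have ae0 := sample_Q_ae_neq 0; have aeq := sample_Q_ae_neq (qsup n).
  have aex := sample_Q_ae_neq x.
  apply: filterS3 ae0 aeq aex => w Q0 Qq Qx.
  have := a01 w; rewrite !le_eqVlt => /andP[/orP[/eqP a0|a0] /orP[/eqP ap|ap]].
  - by move: ap a0 => -> p0; move: pi0; rewrite -p0 ltxx.
  - case/eqP: Q0; move: a0 => /esym/eqP; rewrite /a !mulf_eq0 invr_eq0.
    by rewrite (gt_eqF pi0) (gt_eqF q0) orbF => /eqP.
  - case/eqP: Qq; apply: (mulfI (negbT (gt_eqF pi0))).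
    apply: (mulIf (invr_neq0 (negbT (gt_eqF q0)))).
    by rewrite -/(a w) ap mulfK// gt_eqF.
  have ab : a w != b.
    apply: contra Qx => /eqP h; apply/eqP; apply: (mulfI (negbT (gt_eqF pi0))).
    by apply: (mulIf (invr_neq0 (negbT (gt_eqF q0)))); exact: h.
  have := @step_kernel_cvg _ (a w) b; rewrite a0 ap => /(_ isT b01 ab).
  congr (_ --> _).
  have -> : (a w < b) = (Q w < x).
    by rewrite /a /b ltr_pM2r ?invr_gt0// ltr_pM2l.
  rewrite indicE; case: ifPn => h.
    by rewrite mem_set ?mulr1//=; exact: ltW.
  rewrite memNset ?mulr0//=; apply/negP; rewrite -ltNge lt_neqAle eq_sym Qx /=.
  by rewrite leNgt.
- by move=> N w; exact: step_kernel_bound.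
Qed.

Lemma cdf_representation x : 0 <= x <= qsup n ->
  both_reprs f n (wcdf n x) (cdf_of P Q x).
Proof.
move=> xq; have -> : cdf_of P Q x = 2 / pi * (pi / 2 * cdf_of P Q x).
  by rewrite mulrA -[2 / pi]invf_div mulVf ?mul1r// gt_eqF// divr_gt0// pi_gt0.
apply: (@both_reprs_of_limit _ _ _ P n Y f n2 mY Y01 fY indY K L bf uf L0 fL _
  (2 * (Num.sqrt (tk n 1))^-1 ^+ n.-1)).
- by rewrite mulr_ge0// exprn_ge0// invr_ge0.
- by move=> k; exact: wcdf_bound.
- exact: fourier_cdf.
Qed.

End Cdf.

(** * The density for n >= 4 *)

Section DensityMeasure.
Context (R : realType) (h : R -> R).
Notation leb := (@lebesgue_measure R).

(* The unused proofs are arguments so that the measure instance can be inferred. *)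
Definition density_measure (_ : forall x, 0 <= h x) (_ : measurable_fun setT h)
  (A : set (measurableTypeR R)) : \bar R := (\int[leb]_(x in A) (h x)%:E)%E.

Context (h0 : forall x, 0 <= h x) (mh : measurable_fun setT h).
Local Notation dm := (density_measure h0 mh).

Let dm0 : dm set0 = 0%E. Proof. exact: integral_set0. Qed.

Let dm_ge0 A : (0 <= dm A)%E.
Proof. by apply: integral_ge0 => x _; rewrite lee_fin. Qed.

Let dm_sigma_additive : semi_sigma_additive dm.
Proof.
move=> /= F mF tF mUF; rewrite /density_measure ge0_integral_bigcup//.
- apply: is_cvg_ereal_nneg_natsum_cond => n _ _.
  by apply: integral_ge0 => x _; rewrite lee_fin.
- by apply: measurable_funTS; exact/measurable_EFinP.
- by move=> x _; rewrite lee_fin.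
Qed.

HB.instance Definition _ := isMeasure.Build _ _ _ dm dm0 dm_ge0 dm_sigma_additive.

End DensityMeasure.

Section DensityFromCdf.
Context d (T : measurableType d) (R : realType) (P : probability T R).
Notation leb := (@lebesgue_measure R).
Context (Z : T -> R) (mZ : measurable_fun setT Z).

Lemma measurable_ray (x : R) : measurable [set r : R | r <= x].
Proof.
rewrite (_ : [set r : R | r <= x] = `]-oo, x]%classic); first exact: measurable_itv.
by apply/seteqP; split => r /=; rewrite in_itv.
Qed.

Lemma probability_itvoc (a b : R) : a <= b ->
  fine (P (Z @^-1` `]a, b]%classic)) = cdf_of P Z b - cdf_of P Z a.
Proof.
move=> ab; rewrite /cdf_of.
have mpre B : measurable B -> measurable (Z @^-1` B).
  by move=> mB; rewrite -[_ @^-1` _]setTI; exact: mZ.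
have -> : [set w | Z w <= b] = [set w | Z w <= a] `|` (Z @^-1` `]a, b]%classic).
  apply/seteqP; split => w /=; rewrite in_itv/=.
    by move=> zb; have [za|za] := leP (Z w) a; [left|right].
  by case=> [za|/andP[]//]; exact: le_trans za ab.
have m1 : measurable [set w | Z w <= a] by apply: (mpre [set r | r <= a]); exact: measurable_ray.
have m2 : measurable (Z @^-1` `]a, b]%classic) by apply: mpre; exact: measurable_itv.
rewrite measureU//; last first.
  by apply/seteqP; split => w //= [za]; rewrite in_itv/= ltNge za.
by rewrite fineD ?fin_num_measure// addrAC subrr add0r.
Qed.

(* A signed density cannot be compared with P_Z by uniqueness of measures;
   adding the nonnegative density [1 - k g] to [k P_Z] gives Lebesgue measure. *)
Lemma density_of_cdf (g : R -> R) (M lo hi : R) : lo <= hi ->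
  measurable_fun setT g -> (forall x, `|g x| <= M) ->
  (forall w, lo <= Z w <= hi) -> (forall x, ~~ (lo <= x <= hi) -> g x = 0) ->
  (forall x, \int[leb]_(u in `]-oo, x]) g u = cdf_of P Z x) ->
  is_density_of P Z g.
Proof.
move=> lohi mg gM Z01 g0 gH; split => // A mA.
pose k := (`|M| + 1)^-1.
have k0 : 0 < k by rewrite invr_gt0 ltr_pwDr.
pose D := `[lo, hi]%classic : set R.
have mD : measurable D by exact: measurable_itv.
have Doo : (leb D < +oo)%E.
  have lD : leb D = (hi - lo)%:E by exact: lebesgue_itvcc.
  by rewrite lD ltry.
have ig : leb.-integrable setT (EFin \o g).
  have -> : g = g \_ D.
    apply/funext => x; rewrite patchE; case: ifPn => // /negP xD.
    by apply: g0; apply/negP => h; apply: xD; rewrite inE /D /= in_itv.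
  rewrite -restrict_EFin; apply/(@integrable_mkcond _ _ _ leb D (EFin \o g) mD).
  apply: (@integrable_bd _ _ _ leb _ _ M) => //.
  exact: measurable_funTS.
have igS B : measurable B -> leb.-integrable B (EFin \o g).
  by move=> mB; apply: integrableS ig.
have h0 x : 0 <= 1 - k * g x.
  have kM : k * (`|M| + 1) = 1 by rewrite mulVf// gt_eqF// ltr_pwDr.
  rewrite subr_ge0 -kM; apply: ler_wpM2l; first exact: ltW.
  by have := gM x; rewrite ler_norml => /andP[_]; have := ler_norm M; lra.
have mh : measurable_fun setT (fun x => 1 - k * g x).
  by apply: measurable_funB => //; exact: measurable_funM.
have mZ' : @measurable_fun _ _ T (measurableTypeR R) setT Z by exact: mZ.
pose X : {mfun T >-> measurableTypeR R} :=
  @mfun_Sub _ _ T (measurableTypeR R) Z (mem_set mZ').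
pose nu : probability (measurableTypeR R) R := distribution P X.
pose kn : {nonneg R} := NngNum (ltW k0).
pose mu : {measure set (measurableTypeR R) -> \bar R} :=
  measure_add (mscale kn nu) (density_measure h0 mh).
have finint B : measurable B -> (leb B < +oo)%E ->
    density_measure h0 mh B = (fine (leb B) - k * \int[leb]_(x in B) g x)%:E.
  move=> mB Boo.
  have i1 : leb.-integrable B (EFin \o (fun=> 1 : R)).
    by apply: (@integrable_bd _ _ _ leb _ _ 1) => // x _; rewrite normr1.
  have i2 : leb.-integrable B (EFin \o (fun x => k * g x)).
    by apply: integrableZ_real => //; exact: igS.
  have i3 : leb.-integrable B (EFin \o (fun x => 1 - k * g x)) by exact: integrableB_real.
  have -> : fine (leb B) - k * \int[leb]_(x in B) g x = \int[leb]_(x in B) (1 - k * g x).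
    rewrite RintegralB// RintegralZl//; last exact: igS.
    by rewrite Rintegral_cst// mul1r.
  by rewrite /density_measure /Rintegral fineK//; exact: integrable_fin_num.
have muE B : (mu B = mscale kn nu B + density_measure h0 mh B)%E.
  exact: measure_addE.
have mu_itv a b : a < b -> leb `]a, b] = mu `]a, b]%classic.
  move=> ab.
  have mab : measurable (`]a, b]%classic : set R) by exact: measurable_itv.
  have lab : leb `]a, b] = (b - a)%:E by rewrite lebesgue_measure_itv/= lte_fin ab EFinB.
  rewrite muE finint//; last by rewrite lab ltry.
  have -> : mscale kn nu `]a, b] = (k * (cdf_of P Z b - cdf_of P Z a))%:E.
    rewrite /mscale -probability_itvoc; last exact: ltW.
    rewrite EFinM fineK//; apply: fin_num_measure.
    by rewrite -[_ @^-1` _]setTI; exact: mZ.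
  have -> : \int[leb]_(x in `]a, b]) g x = cdf_of P Z b - cdf_of P Z a.
    rewrite -!gH.
    have -> : `]-oo, b]%classic = `]-oo, a] `|` `]a, b] :> set R.
      by rewrite -itv_bndbnd_setU//= bnd_simp ltW.
    rewrite Rintegral_setU//.
    - by rewrite addrAC subrr add0r.
    - by apply: igS; exact: measurableU.
    - apply/disj_set2P; apply/seteqP; split => x //= []; rewrite !in_itv/= => xa.
      by rewrite ltNge xa.
  by rewrite lab -EFinD; congr EFin => /=; ring.
have mu_eq B : measurable B -> leb B = mu B.
  apply: lebesgue_measure_unique => _ [[a b] _ <-].
  have [ba|ab] := leP b a; last exact: mu_itv.
  by rewrite set_itv_ge ?measure0// bnd_simp -leNgt.
(* Restricting to the bounded range of [Z] makes the Lebesgue measure finite, so that it can be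
   cancelled from the identity of measures. *)
pose A' := A `&` D.
have mA' : measurable A' by exact: measurableI.
have A'oo : (leb A' < +oo)%E.
  apply: (@le_lt_trans _ _ (leb D)); last exact: Doo.
  by apply: le_measure; rewrite ?inE//; exact: subIsetr.
have -> : Z @^-1` A = Z @^-1` A'.
  by apply/seteqP; split => w /= => [Aw|[]//]; split => //; rewrite /D /= in_itv/= Z01.
have -> : (\int[leb]_(x in A) (g x)%:E = \int[leb]_(x in A') (g x)%:E)%E.
  rewrite integral_mkcond [RHS]integral_mkcond; apply: eq_integral => x _.
  rewrite !patchE /A' in_setI; case: (x \in A) => //=; case: ifPn => // /negP xD.
  by rewrite g0//; apply/negP => h; apply: xD; rewrite inE /D /= in_itv.
have := mu_eq A' mA'; rewrite muE finint// => e.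
have {}e : (leb A' = k%:E * P (Z @^-1` A') +
  (fine (leb A') - k * \int[leb]_(x in A') g x)%:E)%E by exact: e.
move: e.
have fP : P (Z @^-1` A') \is a fin_num.
  by apply: fin_num_measure; rewrite -[_ @^-1` _]setTI; exact: mZ.
have fl : leb A' \is a fin_num by rewrite ge0_fin_numE.
rewrite -[X in X = _]fineK// -[P (Z @^-1` A')]fineK// /= -EFinM -EFinD => -[e].
have eG : (\int[leb]_(x in A') (g x)%:E = (\int[leb]_(x in A') g x)%:E)%E.
  by rewrite /Rintegral fineK//; apply: integrable_fin_num => //; exact: igS.
rewrite eG; congr EFin; apply: (mulfI (negbT (gt_eqF k0))).
by move: e; set p := fine (P _); set l := fine (leb _); set G := Rintegral _ _ _; lra.
Qed.

End DensityFromCdf.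

Section PdfSeries.
Context d (T : measurableType d) (R : realType) (P : probability T R).
Context (n : nat) (Y : 'I_n -> T -> R) (f : R -> R).
Context (n4 : (4 <= n)%N) (mY : forall i, measurable_fun setT (Y i))
  (Y01 : forall i w, 0 <= Y i w <= 1)
  (fY : forall i, is_density_of P (Y i) f) (indY : mutually_independent P Y).
Context (K L : R) (bf : bounded_var f K) (uf : unif_cont f) (L0 : 0 <= L)
  (fL : forall x, 0 <= x <= 1 -> `|f x| <= L).
Notation leb := (@lebesgue_measure R).
Local Notation Q := (sample_Q Y).
Local Notation phi t := (phiQ P Y t).
Local Notation q := (qsup n).

Let n2 : (2 <= n)%N. Proof. exact: leq_trans n4. Qed.
Let n0 : (0 < n)%N. Proof. exact: ltnW. Qed.
Let mQ := measurable_sample_Q mY.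
Let q0 : 0 < q :> R. Proof. exact: qsup_gt0. Qed.

Let term x k := complex.Im (phi (tk n k)) * wpdf n x k.
Let g x := 2 / pi * sum1 (term x).

(** The sine series is odd and periodic with period 2q, so it has to be cut off outside the range of
    Q. *)
Definition pdf_series x := if 0 <= x <= q then g x else 0.

Let term_bound : exists2 b : nat -> R, cvgn (fun N => \sum_(1 <= k < N) b k) &
  forall x k, (0 < k)%N -> `|term x k| <= b k.
Proof.
have t10 : 0 < tk n 1 :> R by exact: tk_gt0.
have [C C0 hC] := phi_bound n2 mY Y01 fY indY bf uf L0 fL t10.
pose B : R := tk n 1 * (Num.sqrt (tk n 1))^-1 ^+ n.-1.
have B0 : 0 <= B by apply: mulr_ge0; [exact: ltW | apply: exprn_ge0; rewrite invr_ge0].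
exists (fun k => C * B * (Num.sqrt k%:R)^-1 ^+ 3).
  by apply: cvg_sum_three_halves; exact: mulr_ge0.
move=> x k k0; rewrite /term normrM.
have h1 : `|complex.Im (phi (tk n k))| <= C * (Num.sqrt (tk n k))^-1 ^+ n.-1.
  by apply: le_trans (Im_le_nrm _) (hC _ _); exact: tk1_le.
apply: (@le_trans _ _ (C * (Num.sqrt (tk n k))^-1 ^+ n.-1 * `|wpdf n x k|)).
  exact: ler_wpM2r.
rewrite -2!(mulrA C); apply: ler_wpM2l => //; rewrite [leLHS]mulrC.
exact: wpdf_bound.
Qed.

Let cvg_term x : cvgn (fun N => \sum_(1 <= k < N) term x k).
Proof. by have [b cb tb] := term_bound; apply: (sum1_dom_cvg _ cb) => k; exact: tb. Qed.

Let mterm k : measurable_fun setT (fun u => term u k).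
Proof.
apply: measurable_funM => //; rewrite /wpdf; apply: measurable_funM => //.
apply: measurable_funM => //.
apply: (measurableT_comp (continuous_measurable_fun (@continuous_sin R))).
exact: measurable_funM.
Qed.

Let g_bound : exists M, forall x, `|g x| <= M.
Proof.
have [b cb tb] := term_bound.
have b0 k : (0 < k)%N -> 0 <= b k by move=> k0; exact: le_trans (tb 0 k k0).
exists (2 / pi * sum1 b) => x.
have p0 : 0 < 2 / pi :> R by rewrite divr_gt0// pi_gt0.
rewrite normrM gtr0_norm// ler_pM2l//.
have c : (fun N => `|\sum_(1 <= k < N) term x k|) @ \oo --> `|sum1 (term x)|.
  by apply: cvg_norm; exact: cvg_term.
have <- := cvg_lim (@Rhausdorff R) c.
apply: limr_le; first by apply: cvgP c.
apply: nearW => N; apply: (le_trans (ler_norm_sum _ _ _)).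
apply: le_trans (sum1_le_lim N b0 cb).
by apply: ler_sum_nat => k /andP[k0 _]; exact: tb.
Qed.

Let mg : measurable_fun setT g.
Proof.
apply: measurable_funM => //; apply/measurable_EFinP.
apply: (@emeasurable_fun_cvg _ _ _ _ (fun N => EFin \o (fun u => \sum_(1 <= k < N) term u k))).
  by move=> N; apply/measurable_EFinP; apply: measurable_sum => k; exact: mterm.
move=> x _; apply: cvg_EFin; first by near=> N.
exact: cvg_term.
Unshelve. all: by end_near.
Qed.

Lemma integral_wpdf x k : 0 <= x -> \int[leb]_(u in `[0, x]) wpdf n u k = wcdf n x k.
Proof.
move=> x0; set t : R := tk n k.
have dF (u : R) : is_derive u 1 (fun u => - cos (t * u) / k%:R) (t * sin (t * u) / k%:R).
  by der; ring.
have -> : (fun u => wpdf n u k) = (fun u => t * sin (t * u) / k%:R) by [].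
rewrite (Rintegral_FTC x0 _ dF); last by move=> u; eapply der_continuous; repeat der1.
by rewrite mulr0 cos0 /wcdf -/t; ring.
Qed.

Let g_integral x : 0 <= x <= q -> \int[leb]_(u in `[0, x]) g u = cdf_of P Q x.
Proof.
move=> /andP[x0 xq]; have [b cb tb] := term_bound.
have b0 k : (0 < k)%N -> 0 <= b k by move=> k0; exact: le_trans (tb 0 k k0).
pose D := `[0, x]%classic : set R.
have mD : measurable D by exact: measurable_itv.
have Doo : (leb D < +oo)%E.
  have lD : leb D = (x - 0)%:E by exact: lebesgue_itvcc.
  by rewrite lD ltry.
have i1 (c : R) : leb.-integrable D (EFin \o (fun=> c)).
  by apply: integrable_itvcc; apply: cont_within => u; exact: cvg_cst.
have [||||||[_ iS] cS] := @SI_interchange _ D term b (fun=> 1) mD.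
- by move=> k _; apply: measurable_funTS; exact: mterm.
- exact: i1.
- by [].
- by move=> u k _ k0; rewrite mulr1; exact: tb.
- exact: b0.
- exact: cb.
rewrite /g RintegralZl//.
have -> : cdf_of P Q x = 2 / pi * (pi / 2 * cdf_of P Q x).
  by rewrite mulrA -[2 / pi]invf_div mulVf ?mul1r// gt_eqF// divr_gt0// pi_gt0.
congr (_ * _).
have hF := fourier_cdf n2 mY Y01 fY indY bf uf L0 fL (introT andP (conj x0 xq)).
apply: (cvg_eq_lim cS hF) => N; apply: eq_big_nat => k /andP[k0 _].
rewrite /term RintegralZl//; first by rewrite integral_wpdf.
apply: (@integrable_bd _ _ _ leb _ _ (tk n 1)) => //.
- have -> : (fun u => wpdf n u k) = (fun u : R => tk n k / k%:R * sin (tk n k * u)).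
    by apply/funext => u; rewrite /wpdf; ring.
  by apply: cont_meas => u; eapply der_continuous; repeat der1.
- move=> u _; have -> : wpdf n u k = tk n k / k%:R * sin (tk n k * u).
    by rewrite /wpdf; ring.
  have -> : tk n k / k%:R = tk n 1 :> R.
    by rewrite tk_mul1 mulrAC mulfV ?mul1r// pnatr_eq0 -lt0n.
  have t10 : 0 < tk n 1 :> R by exact: tk_gt0.
  by rewrite normrM gtr0_norm// ler_piMr ?sin_max// ltW.
Qed.

Lemma pdf_series_bounded : exists M, forall x, `|pdf_series x| <= M.
Proof.
have [M hM] := g_bound; exists M => x; rewrite /pdf_series; case: ifP => // _.
by rewrite normr0; exact: le_trans (hM 0).
Qed.

Lemma pdf_series_density : is_density_of P Q pdf_series.
Proof.
have [M hM] := pdf_series_bounded.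
pose D := `[0, q]%classic : set R.
have mD : measurable D by exact: measurable_itv.
have gD : pdf_series = g \_ D.
  by apply/funext => x; rewrite patchE /pdf_series mem_setE in_itv.
have Q01 w : 0 <= Q w <= q.
  by rewrite Qfun_ge0 Qfun_le_qsup// => i; exact: Y01.
apply: (density_of_cdf mQ (ltW q0) (M := M)) => //.
- by rewrite gD; apply/(measurable_restrictT _ _).1 => //; exact: measurable_funTS.
- by move=> x /negbTE h; rewrite /pdf_series h.
move=> x; have [x0|x0] := ltP x 0.
  rewrite /cdf_of (_ : [set w | Q w <= x] = set0) ?measure0; last first.
    apply/seteqP; split => w //= h; have /andP[h' _] := Q01 w.
    by have := le_lt_trans (le_trans h' h) x0; rewrite ltxx.
  transitivity (\int[leb]_(u in `]-oo, x]) (0 : R)).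
    apply: eq_Rintegral => u; rewrite inE /= in_itv/= => ux.
    by rewrite /pdf_series leNgt (le_lt_trans ux x0).
  by rewrite Rintegral_cst//= mul0r.
pose y := Num.min x q.
have y0q : 0 <= y <= q by rewrite /y le_min x0 (ltW q0) ge_min lexx orbT.
have -> : cdf_of P Q x = cdf_of P Q y.
  rewrite /cdf_of /y; case: (leP x q) => // qx; congr (fine (P _)).
  apply/seteqP; split => w /= _; have /andP[_ h] := Q01 w => //.
  by apply: le_trans h _; exact: ltW.
rewrite -g_integral// Rintegral_mkcond [RHS]Rintegral_mkcond.
apply: eq_Rintegral => u _; rewrite !patchE !mem_setE !in_itv/= /pdf_series /y le_min.
by case: (u <= x); case: (0 <= u); case: (u <= q).
Qed.

Lemma pdf_series_representation x : 0 < x < q ->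
  both_reprs f n (wpdf n x) (pdf_series x).
Proof.
move=> /andP[x0 xq]; rewrite /pdf_series (ltW x0) (ltW xq) /=.
apply: (@both_reprs_of_limit _ _ _ P n Y f n2 mY Y01 fY indY K L bf uf L0 fL _
  (tk n 1 * (Num.sqrt (tk n 1))^-1 ^+ n.-1)).
- apply: mulr_ge0; last by apply: exprn_ge0; rewrite invr_ge0.
  exact/ltW/tk_gt0.
- by move=> k k0; exact: wpdf_bound.
- exact: cvg_term.
Qed.

End PdfSeries.

(** * The density for n = 3 *)

Section LipschitzDistribution.
Context (R : realType).
Notation leb := (@lebesgue_measure R).

(** Lebesgue measure is an infimum over countable covers by half-open intervals, and [nu] is
    subadditive on each cover. *)
Lemma measure_le_lebesgue (nu : {measure set (measurableTypeR R) -> \bar R}) :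
  (forall a b : R, a < b -> (nu `]a, b]%classic <= (b - a)%:E)%E) ->
  forall A, measurable A -> (nu A <= leb A)%E.
Proof.
move=> nuab A mA.
apply: le_ereal_inf_tmp => _ [F [mF AF] <-].
have mF' k : measurable (F k : set (measurableTypeR R)).
  exact: (@sub_sigma_algebra _ _ (@ocitv R) (F k) (mF k)).
apply: (@le_trans _ _ (\sum_(k <oo) nu (F k))%E).
  exact: (@measure_sigma_subadditive _ _ _ nu A (fun k => F k : set (measurableTypeR R)) mF' mA AF).
apply: lee_nneseries => // k _; have := mF k => -[[a b] _ <-] /=.
have [ba|ab] := leP b a; first by rewrite set_itv_ge ?measure0 ?bnd_simp -?leNgt.
by rewrite wlength_itv_bnd; [exact: nuab | exact: ltW].
Qed.

Context d (T : measurableType d) (P : probability T R) (Z : T -> R).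
Context (mZ : measurable_fun setT Z).

(** The law is at most C times Lebesgue measure, hence absolutely continuous, and its Radon-Nikodym
    derivative stays below C + 1 almost everywhere on the set [D] of finite measure. *)
Lemma density_of_lipschitz (C : R) (D : set R) : 0 < C ->
  measurable D -> (leb D < +oo)%E ->
  (forall a b : R, a < b -> (P (Z @^-1` `]a, b]) <= (C * (b - a))%:E)%E) ->
  exists g : R -> R, is_density_of P Z g /\
    (\int[leb]_(x in D) ((g x) ^+ 2)%:E < +oo)%E.
Proof.
move=> C0 mD Doo PZ.
have mZ' : @measurable_fun _ _ T (measurableTypeR R) setT Z by exact: mZ.
pose X : {mfun T >-> measurableTypeR R} :=
  @mfun_Sub _ _ T (measurableTypeR R) Z (mem_set mZ').
pose nu : probability (measurableTypeR R) R := distribution P X.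
pose leb' : {sigma_finite_measure set (measurableTypeR R) -> \bar R} := leb.
have Ci0 : 0 < C^-1 by rewrite invr_gt0.
pose k : {nonneg R} := NngNum (ltW Ci0).
have nu_le A : measurable A -> (nu A <= C%:E * leb A)%E.
  move=> mA; have : (mscale k nu A <= leb A)%E.
    apply: measure_le_lebesgue => // a b ab.
    rewrite /mscale; apply: le_trans (lee_wpmul2l _ (PZ a b ab)) _ => //.
    by rewrite -EFinM lee_fin mulKf// gt_eqF.
  rewrite /mscale /= => h; apply: le_trans (lee_wpmul2l _ h); last by rewrite lee_fin ltW.
  by rewrite muleA -EFinM mulfV ?gt_eqF// mul1e.
have dom : nu `<< leb'.
  apply/null_content_dominatesP => A mA A0.
  by apply/eqP; rewrite eq_le measure_ge0 andbT (le_trans (nu_le A mA))// A0 mule0.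
have [g [g0 gfin ig nug]] := @radon_nikodym_sigma_finite _ _ _ leb' nu dom.
pose h x := fine (g x).
have gE x : g x = (h x)%:E by rewrite /h fineK.
have h0 x : 0 <= h x by rewrite /h fine_ge0.
have mg : measurable_fun setT g := measurable_int _ ig.
have mh : measurable_fun setT h.
  by apply/measurable_EFinP; apply: (eq_measurable_fun g) => // x _; rewrite gE.
exists h; split.
  split => // A mA; transitivity (nu A); first by [].
  by rewrite nug//; apply: eq_integral => x _; rewrite gE.
(* On E the density is at least C + 1, so (C + 1) |E| <= nu(E) <= C |E|. The gap of 1 forces |E| =
   0. *)
pose E := D `&` [set x | C + 1 <= h x].
have mE : measurable E.
  apply: measurableI => //.
  have := mh measurableT `[C + 1, +oo[%classic (measurable_itv _).
  rewrite setTI; congr measurable; apply/seteqP.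
  by split => x /=; rewrite in_itv/= andbT.
have E0 : leb E = 0%E.
  have Eoo : (leb E < +oo)%E.
    by apply: le_lt_trans Doo; apply: le_measure; rewrite ?inE//; exact: subIsetl.
  have h1 : ((C + 1)%:E * leb E <= C%:E * leb E)%E.
    apply: le_trans (nu_le E mE); rewrite nug// -integral_cst//.
    apply: ge0_le_integral => //.
    - by move=> x _; rewrite lee_fin addr_ge0// ltW.
    - exact: measurable_funTS.
    - by move=> x [_]; rewrite gE lee_fin.
  have fE : leb E \is a fin_num by rewrite ge0_fin_numE.
  move: h1; rewrite -(fineK fE) -!EFinM lee_fin mulrDl mul1r gerDl => h1.
  by congr EFin; apply/eqP; rewrite eq_le h1 fine_ge0.
have mh2 B : measurable_fun B (fun x => ((h x) ^+ 2)%:E).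
  by apply: measurable_funTS; apply/measurable_EFinP; exact: measurable_funX.
have h2 x : D x -> (0 <= ((h x) ^+ 2)%:E)%E by rewrite lee_fin sqr_ge0.
rewrite (@ge0_negligible_integral _ _ _ leb D E (fun x => ((h x) ^+ 2)%:E) mE mD (mh2 D) h2 E0).
apply: (@le_lt_trans _ _ (\int[leb]_(x in D `\` E) (((C + 1) ^+ 2)%:E))%E).
  apply: ge0_le_integral => //.
  - exact: measurableD.
  - by move=> x _; rewrite lee_fin sqr_ge0.
  move=> x [Dx /not_andP[//|/negP]]; rewrite -ltNge lee_fin => hC.
  by rewrite !expr2; have := h0 x; nra.
rewrite integral_cst//; last exact: measurableD.
apply: lte_mul_pinfty; rewrite ?lee_fin ?sqr_ge0//.
apply: le_lt_trans Doo; apply: le_measure; rewrite ?inE//; exact: measurableD.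
Qed.

End LipschitzDistribution.

(** * Product laws and independence of pairs *)

Section JointLaw.
Context d1 d2 (T1 : measurableType d1) (T2 : measurableType d2).
Context d (T : measurableType d) (R : realType) (P : probability T R).

Lemma finite_measure_unique_prod (m1 m2 : {measure set (T1 * T2) -> \bar R}) :
  (m1 setT < +oo)%E ->
  (forall A B, measurable A -> measurable B -> m1 (A `*` B) = m2 (A `*` B)) ->
  forall X, measurable X -> m1 X = m2 X.
Proof.
move=> moo m12; pose C : set (set (T1 * T2)) :=
  [set C | exists A, measurable A /\ exists B, measurable B /\ C = A `*` B].
have CI : setI_closed C.
  move=> /= _ _ [X1 [mX1 [X2 [mX2 ->]]]] [Y1 [mY1 [Y2 [mY2 ->]]]].
  rewrite -setXI; exists (X1 `&` Y1); split; first exact: measurableI.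
  by exists (X2 `&` Y2); split => //; exact: measurableI.
move=> X mX; apply: (measure_unique C (fun=> setT)) => //.
- rewrite measurable_prod_measurableType //; congr (<<s _ >>).
  rewrite predeqE; split => [[A mA [B mB <-]]|[A [mA [B [mB ->]]]]].
    by exists A; split => //; exists B.
  by exists A => //; exists B.
- by move=> i; exists setT; split => //; exists setT; split => //; rewrite setXTT.
- by apply/seteqP; split => // x _; exists 0%N.
- by move=> A [A1 [mA1 [A2 [mA2 ->]]]]; exact: m12.
Qed.

Definition indep_pair (U : T -> T1) (V : T -> T2) := forall A B,
  measurable A -> measurable B ->
  P (U @^-1` A `&` V @^-1` B) = (P (U @^-1` A) * P (V @^-1` B))%E.

(** The law of (U, V) is a product, so Tonelli integrates V first with U frozen. The inner bound is
    required only at values taken by U, which is how the range [0, 1] of the variables can be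
    used. *)
Lemma expectation_le_freeze (U : T -> T1) (V : T -> T2) (h : T1 * T2 -> R) (H : T1 -> R) :
  measurable_fun setT U -> measurable_fun setT V -> indep_pair U V ->
  measurable_fun setT h -> (forall z, 0 <= h z) -> measurable_fun setT H ->
  (forall u, 0 <= H u) ->
  (forall w0, (\int[P]_w (h (U w0, V w))%:E <= (H (U w0))%:E)%E) ->
  (\int[P]_w (h (U w, V w))%:E <= \int[P]_w (H (U w))%:E)%E.
Proof.
move=> mU mV UV mh h0 mH H0 hH.
pose U' : {mfun T >-> T1} := @mfun_Sub _ _ T T1 U (mem_set mU).
pose V' : {mfun T >-> T2} := @mfun_Sub _ _ T T2 V (mem_set mV).
have mUV : measurable_fun setT (fun w => (U w, V w)) by exact: measurable_fun_pair.
pose W' : {mfun T >-> (T1 * T2)%type} := @mfun_Sub _ _ T _ (fun w => (U w, V w)) (mem_set mUV).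
pose pU : probability T1 R := distribution P U'.
pose pV : probability T2 R := distribution P V'.
pose pW : probability (T1 * T2)%type R := distribution P W'.
have mhE : measurable_fun setT (EFin \o h) by exact/measurable_EFinP.
have mHE : measurable_fun setT (EFin \o H) by exact/measurable_EFinP.
have law X : measurable X -> (pU \x pV)%E X = pW X.
  by apply: product_measure_unique => A B mA mB; exact: UV.
have -> : (\int[P]_w (h (U w, V w))%:E = \int[pW]_z (EFin \o h) z)%E.
  by rewrite ge0_integral_distribution// => z; rewrite lee_fin.
have -> : (\int[pW]_z (EFin \o h) z = \int[(pU \x pV)%E]_z (EFin \o h) z)%E.
  by apply: eq_measure_integral => A mA _; exact/esym/law.
rewrite fubini_tonelli1//.
have inner w0 : (fubini_F pV (EFin \o h) (U w0) <= (H (U w0))%:E)%E.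
  rewrite /fubini_F; have := hH w0; congr (_ <= _)%E.
  rewrite ge0_integral_distribution//.
    exact: (measurableT_comp mhE (measurable_pair1 _)).
  by move=> y; rewrite lee_fin.
have mF : measurable_fun setT (fubini_F pV (EFin \o h)).
  by apply: measurable_fun_fubini_tonelli_F => // z; rewrite lee_fin.
rewrite ge0_integral_distribution//; last first.
  by move=> x; apply: integral_ge0 => y _; rewrite lee_fin.
apply: ge0_le_integral => //.
- by move=> w _; apply: integral_ge0 => y _; rewrite lee_fin.
- exact: measurableT_comp.
- exact: (measurableT_comp mHE mU).
- by move=> w _; exact: inner.
Qed.

End JointLaw.

Section ThreeIndependent.
Context d (T : measurableType d) (R : realType) (P : probability T R).
Context (Y : 'I_3 -> T -> R) (mY : forall i, measurable_fun setT (Y i))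
  (indY : mutually_independent P Y).

Let i0 : 'I_3 := ord0.
Let i1 : 'I_3 := lift ord0 ord0.
Let i2 : 'I_3 := lift ord0 (lift ord0 ord0).

Let mpre i B : measurable B -> measurable (Y i @^-1` B).
Proof. by move=> mB; rewrite -[_ @^-1` _]setTI; exact: mY. Qed.

Let prod3 (A B C : set R) : measurable A -> measurable B -> measurable C ->
  P (Y i0 @^-1` A `&` Y i2 @^-1` B `&` Y i1 @^-1` C) =
  (P (Y i0 @^-1` A) * P (Y i2 @^-1` B) * P (Y i1 @^-1` C))%E.
Proof.
move=> mA mB mC.
pose F (i : 'I_3) := nth setT [:: A; C; B] i.
have mF i : measurable (F i) by case: i => -[|[|[|]]].
have := indY mF; rewrite !big_ord_recl big_ord0 mule1 /F /= => e.
have -> : Y i0 @^-1` A `&` Y i2 @^-1` B `&` Y i1 @^-1` C =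
    \bigcap_(i in [set: 'I_3]) (Y i @^-1` F i).
  apply/seteqP; split => w /=.
    move=> [[w0 w2] w1] i _; rewrite /F.
    have [->|] := eqVneq i i0; first by [].
    have [->|] := eqVneq i i1; first by [].
    have [->|] := eqVneq i i2; first by [].
    by case: i => -[|[|[|]]].
  by move=> h; split; [split|]; [exact: (h i0)|exact: (h i2)|exact: (h i1)].
by rewrite e -muleA [X in (_ * X)%E]muleC.
Qed.

Lemma indep_pair02 : indep_pair P (Y i0) (Y i2).
Proof.
move=> A B mA mB; have := prod3 mA mB measurableT.
by rewrite preimage_setT setIT probability_setT mule1.
Qed.

(** For fixed C, both sides are finite measures in X. They agree on rectangles by independence of
    the three variables, hence everywhere. The middle variable is singled out because it is
    integrated first. *)
Lemma indep_pair02_1 : indep_pair P (fun w => (Y i0 w, Y i2 w)) (Y i1).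
Proof.
move=> X C mX mC.
have mS := mpre i1 mC; set S := Y i1 @^-1` C in mS *.
have mU : measurable_fun setT (fun w => (Y i0 w, Y i2 w)) by exact: measurable_fun_pair.
pose U : {mfun T >-> (R * R)%type} := @mfun_Sub _ _ T _ (fun w => (Y i0 w, Y i2 w)) (mem_set mU).
have S0 : 0 <= fine (P S) by exact: fine_ge0.
pose k : {nonneg R} := NngNum S0.
pose m0 : {measure set (R * R) -> \bar R} := pushforward (mrestr P mS) U.
pose m1 := m0 mU.
pose m2 : {measure set (R * R) -> \bar R} := mscale k (distribution P U).
have fS : P S \is a fin_num by exact: fin_num_measure.
have m1E Z : m1 Z = P (U @^-1` Z `&` S) by [].
have m2E Z : m2 Z = (P S * P (U @^-1` Z))%E by rewrite -[in RHS](fineK fS).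
have key : forall X, measurable X -> m1 X = m2 X.
  apply: finite_measure_unique_prod.
    apply: le_lt_trans (ltry 1); rewrite m1E.
    by rewrite preimage_setT setTI; exact: probability_le1.
  move=> A B mA mB; rewrite m1E m2E.
  have -> : U @^-1` (A `*` B) = Y i0 @^-1` A `&` Y i2 @^-1` B by [].
  rewrite indep_pair02// prod3// muleC.
  by [].
by rewrite muleC -m2E -key.
Qed.

End ThreeIndependent.

(** * Chords of an ellipse and the area of elliptic annuli *)

Section Chords.
Context {R : realType}.
Notation leb := (@lebesgue_measure R).
Implicit Types (a b c v m x y z r : R).

Lemma Rintegral_subset_le (D1 D2 : set R) (g : R -> R) : measurable D1 -> measurable D2 ->
  D1 `<=` D2 -> (forall x, 0 <= g x) -> leb.-integrable D2 (EFin \o g) ->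
  \int[leb]_(x in D1) g x <= \int[leb]_(x in D2) g x.
Proof.
move=> mD1 mD2 D12 g0 ig; have ig1 : leb.-integrable D1 (EFin \o g) by exact: integrableS ig.
rewrite /Rintegral fine_le//; try exact: integrable_fin_num.
apply: ge0_subset_integral => //; first exact: measurable_int ig.
by move=> x _; rewrite lee_fin.
Qed.

Lemma affine_substitution (G : R -> R) c r a b : 0 < r -> a <= b -> continuous G ->
  \int[leb]_(x in `[c + r * a, c + r * b]) G x =
  r * \int[leb]_(x in `[a, b]) G (c + r * x).
Proof.
move=> r0 ab cG; pose F x := c + r * x.
have dF x : is_derive x 1 F r.
  by rewrite /F; der; ring.
have F' : derive1 F = fun=> r.
  by apply/funext => x; rewrite derive1E derive_val.
have cF : continuous F by move=> x; exact: der_continuous (dF x).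
have iG : leb.-integrable `[a, b] (EFin \o (fun x => G (F x))).
  apply: integrable_itvcc; apply: cont_within => x.
  by apply: continuous_comp; [exact: cF | exact: cG].
rewrite -RintegralZl// /Rintegral; congr fine.
have -> := @integration_by_substitution_increasing R F G a b ab.
- by apply: eq_integral => x _; rewrite F' /= fctE mulrC.
- by move=> x y _ _ xy; rewrite /F ltrD2l ltr_pM2l.
- by rewrite F' => x _; exact: cvg_cst.
- by rewrite F'; exact: is_cvg_cst.
- by rewrite F'; exact: is_cvg_cst.
- split; first by move=> x _; exact: ex_derive.
    exact: cvg_at_right_filter (cF a).
  exact: cvg_at_left_filter (cF b).
- exact: cont_within.
Qed.

(** Half the length of the chord at height v of the ellipse 2/3 y^2 + v^2/2 <= c. Where the chord is
    empty the argument is negative and [Num.sqrt] returns 0, as it should. *)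
Definition half_chord c v := Num.sqrt (3 / 2 * (c - v ^+ 2 / 2)).

Lemma half_chord_ge0 c v : 0 <= half_chord c v. Proof. exact: sqrtr_ge0. Qed.

Lemma half_chord_le a b v : a <= b -> half_chord a v <= half_chord b v.
Proof. by move=> ab; apply: ler_wsqrtr; lra. Qed.

Lemma half_chord_continuous c : continuous (half_chord c).
Proof.
move=> v; apply: continuous_comp; last exact: sqrt_continuous.
by eapply der_continuous; repeat der1.
Qed.

Lemma half_chord_integrable c a b : leb.-integrable `[a, b] (EFin \o half_chord c).
Proof. by apply: integrable_itvcc; apply: cont_within; exact: half_chord_continuous. Qed.

Lemma indic_itv_le (p q : R) : p <= q ->
  \int[leb]_(y in `[0, 1]) \1_(`[p, q] : set R) y <= q - p.
Proof.
move=> pq; rewrite /Rintegral integral_indic//.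
have -> : q - p = fine (leb `[p, q]) by rewrite lebesgue_itvcc.
have lpq : leb `[p, q] \is a fin_num by rewrite lebesgue_itvcc.
have le : (leb (`[p, q] `&` `[0%R, 1%R]) <= leb `[p, q])%E.
  by apply: le_measure; rewrite ?inE//; exact: measurableI.
apply: fine_le => //; rewrite ge0_fin_numE//; apply: le_lt_trans le _.
by rewrite lebesgue_itvcc// ltry.
Qed.

(* The values of [y] with [2/3 (y - m)^2 + v^2/2] in [(a, b]] form two
   intervals placed symmetrically about [m]. *)
Lemma slice_bound a b v m : a <= b ->
  \int[leb]_(y in `[0, 1])
    \1_[set y | a < 2 / 3 * (y - m) ^+ 2 + v ^+ 2 / 2 <= b] y <=
  2 * (half_chord b v - half_chord a v).
Proof.
move=> ab; pose S := [set y | a < 2 / 3 * (y - m) ^+ 2 + v ^+ 2 / 2 <= b]; rewrite -/S.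
set B := half_chord b v; set A := half_chord a v.
have AB : A <= B by exact: half_chord_le.
have m1 : measurable_fun setT (\1_(`[m - B, m - A] : set R) : R -> R) by exact: measurable_indic.
have m2 : measurable_fun setT (\1_(`[m + A, m + B] : set R) : R -> R) by exact: measurable_indic.
have itvoo : (leb `[0%R, 1%R] < +oo)%E by rewrite lebesgue_itvcc// ltry.
have i1 : leb.-integrable `[0, 1] (EFin \o (\1_(`[m - B, m - A] : set R) : R -> R)).
  apply: (@integrable_bd _ _ _ leb _ _ 1) => //.
  by move=> y _; exact: indic_norm_le1.
have i2 : leb.-integrable `[0, 1] (EFin \o (\1_(`[m + A, m + B] : set R) : R -> R)).
  apply: (@integrable_bd _ _ _ leb _ _ 1) => //.
  by move=> y _; exact: indic_norm_le1.
have mS : measurable S.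
  have mG : measurable_fun setT (fun y => 2 / 3 * (y - m) ^+ 2 + v ^+ 2 / 2).
    by apply: cont_meas => y; eapply der_continuous; repeat der1.
  have := mG measurableT `]a, b]%classic (measurable_itv _).
  by rewrite setTI.
have iS : leb.-integrable `[0, 1] (EFin \o (\1_S : R -> R)).
  apply: (@integrable_bd _ _ _ leb _ _ 1) => //.
  by move=> y _; exact: indic_norm_le1.
apply: (@le_trans _ _ (\int[leb]_(y in `[0, 1])
   (\1_(`[m - B, m - A] : set R) y + \1_(`[m + A, m + B] : set R) y))).
  apply: le_Rintegral => //; first exact: integrableD_real.
  move=> y _; rewrite !indicE.
  have pos (b' : bool) : 0 <= b'%:R :> R by case: b'.
  have [/set_mem Sy|_] := boolP (y \in S); last by rewrite addr_ge0.
  have /andP[h1 h2] := Sy.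
  have yB : `|y - m| <= B.
    by rewrite -sqrtr_sqr; apply: ler_wsqrtr; lra.
  have yA : A <= `|y - m|.
    by rewrite -sqrtr_sqr; apply: ler_wsqrtr; lra.
  have [my|ym] := leP m y.
    have -> : y \in (`[m + A, m + B]%classic : set R).
      apply/mem_set; rewrite /= in_itv/=; move: yA yB.
      by rewrite ger0_norm ?subr_ge0//; lra.
    by rewrite lerDr.
  have -> : y \in (`[m - B, m - A]%classic : set R).
    apply/mem_set; rewrite /= in_itv/=; move: yA yB.
    by rewrite ltr0_norm ?subr_lt0//; lra.
  by rewrite lerDl.
rewrite RintegralD//.
have h1 := @indic_itv_le (m - B) (m - A); have h2 := @indic_itv_le (m + A) (m + B).
have {}h1 : \int[leb]_(y in `[0, 1]) \1_(`[m - B, m - A] : set R) y <= B - A.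
  by apply: le_trans (h1 _) _; lra.
have {}h2 : \int[leb]_(y in `[0, 1]) \1_(`[m + A, m + B] : set R) y <= B - A.
  by apply: le_trans (h2 _) _; lra.
by apply: le_trans (lerD h1 h2) _; lra.
Qed.

(** Half the area of the ellipse for 0 <= c <= 2, since its heights satisfy |v| <= sqrt(2c) <= 2. *)
Definition chord_integral c := \int[leb]_(v in `[- 2, 2]) half_chord c v.

Lemma chord_integral_ge0 c : 0 <= chord_integral c.
Proof. by apply: Rintegral_ge0 => v _; exact: half_chord_ge0. Qed.

Lemma half_chord_scale a b v : 0 < b -> 0 <= a ->
  half_chord a (Num.sqrt (a / b) * v) = Num.sqrt (a / b) * half_chord b v.
Proof.
move=> b0 a0; rewrite /half_chord -sqrtrM ?divr_ge0// ?ltW//; congr Num.sqrt.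
rewrite exprMn sqr_sqrtr; first by field; rewrite gt_eqF.
by rewrite divr_ge0// ltW.
Qed.

(** Dilation by r = sqrt(a/b) maps the ellipse of level b to that of level a and multiplies areas by
    r^2. The image of [-2, 2] is a smaller interval, hence an inequality; this direction bounds
    increments from above. *)
Lemma chord_integral_scale a b : 0 < b -> 0 <= a -> a <= b ->
  a / b * chord_integral b <= chord_integral a.
Proof.
move=> b0; rewrite le_eqVlt => /orP[/eqP <- _|a0 ab].
  by rewrite mul0r mul0r; exact: chord_integral_ge0.
set r := Num.sqrt (a / b).
have ab0 : 0 < a / b by rewrite divr_gt0.
have r0 : 0 < r by rewrite sqrtr_gt0.
have r1 : r <= 1.
  by rewrite -[leRHS]sqrtr1; apply: ler_wsqrtr; rewrite ler_pdivrMr// mul1r.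
have <- : r ^+ 2 = a / b by rewrite sqr_sqrtr// ltW.
have e := @affine_substitution (half_chord a) 0 r (- 2) 2 r0 _ (@half_chord_continuous a).
have {}e : \int[leb]_(x in `[r * - 2, r * 2]) half_chord a x = r ^+ 2 * chord_integral b.
  have := e _; rewrite !add0r => -> //; last by lra.
  rewrite expr2 -mulrA; congr (_ * _); rewrite /chord_integral -RintegralZl//; last first.
    exact: half_chord_integrable.
  by apply: eq_Rintegral => v _; rewrite add0r half_chord_scale// ltW.
rewrite -e; apply: Rintegral_subset_le => //.
- by move=> v /=; rewrite !in_itv/= => /andP[h1 h2]; apply/andP; split; nra.
- by move=> v; exact: half_chord_ge0.
- exact: half_chord_integrable.
Qed.

(** The chords vanish for |v| > p = sqrt(2b), and each half chord is at most p: a rectangle of area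
    2p times p. *)
Lemma chord_integral_le b : 0 < b -> b <= 2 -> chord_integral b <= 4 * b.
Proof.
move=> b0 b2; pose p := Num.sqrt (b * 2).
have p0 : 0 <= p by exact: sqrtr_ge0.
have pp : p ^+ 2 = b * 2 by rewrite sqr_sqrtr// mulr_ge0// ltW.
have p2 : p <= 2 by nra.
have -> : chord_integral b = \int[leb]_(v in `[- p, p]) half_chord b v.
  rewrite /chord_integral Rintegral_mkcond [RHS]Rintegral_mkcond.
  apply: eq_Rintegral => v _; rewrite !patchE !mem_setE !in_itv/=.
  have [h|h] := boolP (- p <= v <= p).
    by have /andP[h1 h2] := h; rewrite ifT//; lra.
  have -> : half_chord b v = 0; last by case: ifP.
  apply/eqP; rewrite sqrtr_eq0.
  have : p ^+ 2 <= v ^+ 2.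
    by move: h; rewrite -ler_norml -ltNge => /ltW h; rewrite -[v ^+ 2]real_normK ?num_real// ler_pXn2r ?nnegrE.
  by rewrite pp; lra.
apply: (@le_trans _ _ (\int[leb]_(v in `[- p, p]) p)).
  apply: le_Rintegral => //.
  - exact: half_chord_integrable.
  - by apply: integrable_itvcc; apply: cont_within => v; exact: cvg_cst.
  move=> v _; apply: ler_wsqrtr; have := sqr_ge0 v; lra.
by rewrite Rintegral_itv_cst; nra.
Qed.

(** By scaling, the increment is at most (b - a)/b times the value at b, which is at most 4b. *)
Lemma chord_integralB a b : a < b -> 0 <= b -> b <= 2 ->
  chord_integral b - chord_integral a <= 4 * (b - a).
Proof.
move=> ab; rewrite le_eqVlt => /orP[/eqP b0 _|b0 b2].
  have -> : chord_integral b = 0; last by have := chord_integral_ge0 a; lra.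
  transitivity (\int[leb]_(v in `[- 2, 2]) (0 : R)); last first.
    by rewrite Rintegral_cst//= mul0r.
  apply: eq_Rintegral => v _; apply/eqP; rewrite sqrtr_eq0 -b0.
  by have := sqr_ge0 v; lra.
have h := chord_integral_le b0 b2.
have [a0|a0] := leP 0 a.
  have h2 := chord_integral_scale b0 a0 (ltW ab).
  have h3 : chord_integral b - a / b * chord_integral b <= 4 * (b - a).
    have -> : chord_integral b - a / b * chord_integral b = (b - a) / b * chord_integral b.
      by field; rewrite gt_eqF.
    have -> : 4 * (b - a) = (b - a) / b * (4 * b) by field; rewrite gt_eqF.
    by apply: ler_wpM2l => //; rewrite divr_ge0 ?ltW// subr_gt0.
  by lra.
by have := chord_integral_ge0 a; lra.
Qed.

End Chords.
Section DensityThree.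
Context d (T : measurableType d) (R : realType) (P : probability T R).
Notation leb := (@lebesgue_measure R).
Context (f : R -> R) (L : R) (L0 : 0 <= L)
  (fL : forall x, 0 <= x <= 1 -> `|f x| <= L).

Lemma expectation_le_density (Y : T -> R) (h : R -> R) (N : R) :
  measurable_fun setT Y -> (forall w, 0 <= Y w <= 1) -> is_density_of P Y f ->
  measurable_fun setT h -> (forall x, 0 <= h x <= N) ->
  (\int[P]_w (h (Y w))%:E <= (L * \int[leb]_(x in `[0, 1]) h x)%:E)%E.
Proof.
move=> mY Y01 fY mh h0N.
have hN x : `|h x| <= N by have /andP[h0 hN] := h0N x; rewrite ger0_norm.
have N0 : 0 <= N by have /andP[h0 hN'] := h0N 0; exact: le_trans hN'.
have mf : measurable_fun setT f by case: fY.
have ihY : P.-integrable setT (EFin \o (fun w => h (Y w))).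
  by apply: (@integrable_prob _ _ _ P _ N) => //; exact: measurableT_comp.
have -> : (\int[P]_w (h (Y w))%:E = (\int[P]_w h (Y w))%:E)%E.
  by rewrite /Rintegral fineK//; exact: integrable_fin_num.
rewrite lee_fin.
pose D := `[0%R, 1%R]%classic : set R.
pose h' x := h x * \1_D x.
have -> : \int[P]_w h (Y w) = \int[P]_w h' (Y w).
  apply: eq_Rintegral => w _.
  by rewrite /h' indicE mem_set ?mulr1//= /D /= in_itv/= Y01.
have mD : measurable D by exact: measurable_itv.
have mh' : measurable_fun setT h' by apply: measurable_funM => //; exact: measurable_indic.
rewrite (expectation_density (N := N) mY fY mh'); last first.
  move=> x; rewrite /h' normrM -[leRHS]mulr1 ler_pM//; exact: indic_norm_le1.
have -> : \int[leb]_x (f x * h' x) = \int[leb]_(x in D) (f x * h x).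
  rewrite [RHS]Rintegral_mkcond; apply: eq_Rintegral => x _.
  by rewrite /h' patchE indicE; case: ifPn => _; rewrite ?mulr1 ?mulr0.
have Doo : (leb D < +oo)%E.
  have lD : leb D = (1 - 0)%:E by exact: lebesgue_itvcc.
  by rewrite lD ltry.
have ih : leb.-integrable D (EFin \o h).
  apply: (@integrable_bd _ _ _ leb _ _ N) => //; exact: measurable_funTS.
rewrite -RintegralZl//; apply: (le_trans (ler_norm _)).
apply: normr_Rintegral_le => //.
- by apply: measurable_funM; exact: measurable_funTS.
- move=> x; rewrite /D /= in_itv/= => x01; have /andP[h0 _] := h0N x.
  by rewrite normrM (ger0_norm h0); apply: ler_wpM2r => //; exact: fL.
- exact: integrableZ_real.
Qed.

Context (Y : 'I_3 -> T -> R) (mY : forall i, measurable_fun setT (Y i))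
  (Y01 : forall i w, 0 <= Y i w <= 1)
  (fY : forall i, is_density_of P (Y i) f) (indY : mutually_independent P Y).
Local Notation Q := (sample_Q Y).

Let i0 : 'I_3 := ord0.
Let i1 : 'I_3 := lift ord0 ord0.
Let i2 : 'I_3 := lift ord0 (lift ord0 ord0).

(** Orthogonal coordinates for deviations from the mean: the difference of two variables, and the
    distance of the third from their midpoint. Freezing the first two turns the event into a
    condition on the third alone. *)
Lemma sample_Q3E w : Q w = 2 / 3 * (Y i1 w - (Y i0 w + Y i2 w) / 2) ^+ 2 +
  (Y i0 w - Y i2 w) ^+ 2 / 2.
Proof.
rewrite /sample_Q /Qfun !big_ord_recl !big_ord0.
by rewrite -/i0 -/i1 -/i2; field.
Qed.

Let chord_gap a b (v : R) := half_chord b v - half_chord a v.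

Let chord_gap_bound a b : 0 <= b -> b <= 2 -> a < b -> forall x, 0 <= x <= 1 ->
  \int[leb]_(z in `[0, 1]) chord_gap a b (x - z) <= 4 * (b - a).
Proof.
move=> b0 b2 ab x /andP[x0 x1].
have cg : continuous (chord_gap a b).
  by move=> v; apply: continuousB; exact: half_chord_continuous.
have g0 v : 0 <= chord_gap a b v by rewrite subr_ge0 half_chord_le// ltW.
have ig p q : leb.-integrable `[p, q] (EFin \o chord_gap a b).
  by apply: integrable_itvcc; apply: cont_within.
have e := @affine_substitution R (chord_gap a b) (- x) 1 0 1 ltr01 ler01 cg.
(* Chords depend on v^2 only, so x - z may be replaced by - x + z, an increasing substitution in
   z. *)
have -> : \int[leb]_(z in `[0, 1]) chord_gap a b (x - z) =
    \int[leb]_(z in `[0, 1]) chord_gap a b (- x + 1 * z).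
  apply: eq_Rintegral => z _; rewrite mul1r /chord_gap /half_chord.
  by have -> : (x - z) ^+ 2 = (- x + z) ^+ 2 by ring.
rewrite [RHS]mul1r in e; rewrite -e.
apply: (@le_trans _ _ (\int[leb]_(z in `[- 2, 2]) chord_gap a b z)).
  apply: Rintegral_subset_le => //.
  by move=> z /=; rewrite !in_itv/= => /andP[h1 h2]; apply/andP; split; lra.
rewrite /chord_gap RintegralB//; try exact: half_chord_integrable.
exact: chord_integralB.
Qed.

Let half_chord_max (c v : R) : half_chord c v <= Num.sqrt (3 / 2 * c).
Proof. by apply: ler_wsqrtr; have := sqr_ge0 v; lra. Qed.

(** The slice costs 2L times the gap of half chords, integrating the gap against the next density
    costs L times 4 (b - a); together 8 L^2 (b - a). The added 1 keeps the constant positive when L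
    = 0. *)
Lemma sample_Q3_lipschitz_small a b : 0 <= b -> b <= 2 -> a < b ->
  (P (Q @^-1` `]a, b]) <= ((8 * L ^+ 2 + 1) * (b - a))%:E)%E.
Proof.
move=> b0 b2 ab; pose S := `]a, b]%classic : set R.
have mS : measurable S by exact: measurable_itv.
pose G (z : (R * R) * R) : R := 2 / 3 * (z.2 - (z.1.1 + z.1.2) / 2) ^+ 2 +
   (z.1.1 - z.1.2) ^+ 2 / 2.
have m11 : measurable_fun setT (fun z : (R * R) * R => z.1.1).
  exact: (measurableT_comp measurable_fst measurable_fst).
have m12 : measurable_fun setT (fun z : (R * R) * R => z.1.2).
  exact: (measurableT_comp measurable_snd measurable_fst).
have mG : measurable_fun setT G.
  apply: measurable_funD; apply: measurable_funM => //.
    apply: measurable_funX; apply: measurable_funB; first exact: measurable_snd.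
    by apply: measurable_funM => //; exact: measurable_funD.
  by apply: measurable_funX; exact: measurable_funB.
have mU : measurable_fun setT (fun w => (Y i0 w, Y i2 w)) by exact: measurable_fun_pair.
pose N := Num.sqrt (3 / 2 * b).
have gN v : 0 <= chord_gap a b v <= N.
  have le := half_chord_le v (ltW ab); rewrite subr_ge0 le /=; apply: le_trans (half_chord_max b v).
  by rewrite gerBl half_chord_ge0.
have mgap : measurable_fun setT (chord_gap a b).
  by apply: cont_meas => v; apply: continuousB; exact: half_chord_continuous.
pose H (u : R * R) := 2 * L * chord_gap a b (u.1 - u.2).
have mH : measurable_fun setT H.
  apply: measurable_funM => //; apply: (measurableT_comp mgap).
  by apply: measurable_funB; [exact: measurable_fst | exact: measurable_snd].
have H0 u : 0 <= H u.
  by have /andP[h _] := gN (u.1 - u.2); rewrite mulr_ge0// mulr_ge0.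
have step1 : (\int[P]_w (\1_S (G ((Y i0 w, Y i2 w), Y i1 w)))%:E <=
    \int[P]_w (H (Y i0 w, Y i2 w))%:E)%E.
  apply: (@expectation_le_freeze _ _ _ _ _ _ _ P (fun w => (Y i0 w, Y i2 w)) (Y i1)
    (fun z => \1_S (G z)) H) => //.
  - exact: indep_pair02_1.
  - by apply: (measurableT_comp _ mG); exact: measurable_indic.
  move=> w0; set x := Y i0 w0; set z := Y i2 w0.
  have mh : measurable_fun setT (fun y => \1_S (G ((x, z), y)) : R).
    exact: (measurableT_comp (measurable_indic mS) (measurableT_comp mG (measurable_pair1 (x, z)))).
  apply: le_trans (expectation_le_density (N := 1) (mY i1) (Y01 i1) (fY i1) mh _) _.
    by move=> y; rewrite indicE; case: (_ \in _); rewrite ?lexx ?ler01.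
  rewrite lee_fin /H /= [2 * L]mulrC -mulrA; apply: ler_wpM2l => //.
  apply: le_trans (slice_bound (x - z) ((x + z) / 2) (ltW ab)).
  rewrite le_eqVlt; apply/orP; left; apply/eqP; apply: eq_Rintegral => y _.
  by rewrite !indicE; congr (_%:R); congr nat_of_bool.
have step2 : (\int[P]_w (H (Y i0 w, Y i2 w))%:E <=
    \int[P]_w ((8 * L ^+ 2 * (b - a))%:E))%E.
  apply: (@expectation_le_freeze _ _ _ _ _ _ _ P (Y i0) (Y i2) H
    (fun=> 8 * L ^+ 2 * (b - a))) => //.
  - exact: indep_pair02.
  - by move=> _; rewrite !mulr_ge0 ?sqr_ge0// subr_ge0 ltW.
  move=> w0; set x := Y i0 w0.
  have mh : measurable_fun setT (fun z => H (x, z)).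
    exact: (measurableT_comp mH (measurable_pair1 x)).
  apply: le_trans (expectation_le_density (N := 2 * L * N) (mY i2) (Y01 i2) (fY i2) mh _) _.
    move=> z; rewrite H0 /H /=; apply: ler_wpM2l; first by rewrite mulr_ge0.
    by have /andP[] := gN (x - z).
  rewrite lee_fin.
  have -> : 8 * L ^+ 2 * (b - a) = L * (2 * L * (4 * (b - a))) by ring.
  apply: ler_wpM2l => //; rewrite /H /= RintegralZl//.
    apply: ler_wpM2l; first by rewrite mulr_ge0.
    by apply: chord_gap_bound => //; exact: Y01.
  apply: integrable_itvcc; apply: cont_within => z.
  apply: (@continuous_comp _ _ _ (fun z => x - z) (chord_gap a b)).
    by eapply der_continuous; repeat der1.
  by apply: continuousB; exact: half_chord_continuous.
have -> : P (Q @^-1` S) = (\int[P]_w (\1_S (G ((Y i0 w, Y i2 w), Y i1 w)))%:E)%E.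
  have -> : (fun w => (\1_S (G ((Y i0 w, Y i2 w), Y i1 w)))%:E) =
     (fun w => (\1_(Q @^-1` S) w)%:E) :> (T -> \bar R).
    apply/funext => w; have <- : Q w = G ((Y i0 w, Y i2 w), Y i1 w) := sample_Q3E w.
    by rewrite !indicE.
  rewrite integral_indic ?setIT//.
  by rewrite -[_ @^-1` _]setTI; exact: measurable_sample_Q.
apply: le_trans step1 _; apply: le_trans step2 _.
have K0 : 0 <= 8 * L ^+ 2 * (b - a) by rewrite !mulr_ge0 ?sqr_ge0// subr_ge0 ltW.
rewrite integral_cst//; apply: (@le_trans _ _ ((8 * L ^+ 2 * (b - a))%:E * 1)%E).
  by apply: lee_wpmul2l; [rewrite lee_fin | exact: probability_le1].
rewrite mule1 lee_fin.
by apply: ler_wpM2r; [rewrite subr_ge0 ltW | rewrite lerDl].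
Qed.

Lemma density_three : exists g : R -> R, is_density_of P Q g /\
  (\int[leb]_(x in (`]0%R, qsup 3[ : set R)) ((g x) ^+ 2)%:E < +oo)%E.
Proof.
have mQ := measurable_sample_Q mY.
apply: (@density_of_lipschitz R _ _ P Q mQ (8 * L ^+ 2 + 1)).
- by rewrite ltr_wpDl// mulr_ge0// sqr_ge0.
- exact: measurable_itv.
- rewrite lebesgue_measure_itv/= lte_fin; case: ifP => _; last by rewrite ltry.
  by rewrite -EFinB ltry.
have Q2 w : 0 <= Q w <= 2.
  have h : Q w <= qsup 3 by apply: Qfun_le_qsup => // i; exact: Y01.
  rewrite Qfun_ge0 (le_trans h)// /qsup /=.
  have -> : (3 ^+ 2 - 1) / (4 * 3) = 2 / 3 :> R by field.
  lra.
have C0 : 0 <= 8 * L ^+ 2 + 1 by rewrite addr_ge0// mulr_ge0// sqr_ge0.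
move=> a b ab.
have zero : Q @^-1` `]a, b] = set0 ->
    (P (Q @^-1` `]a, b]) <= ((8 * L ^+ 2 + 1) * (b - a))%:E)%E.
  by move=> ->; rewrite measure0 lee_fin mulr_ge0// subr_ge0 ltW.
have [b0|b0] := ltP b 0.
  apply: zero; apply/seteqP; split => w //=; rewrite in_itv/= => /andP[_ h].
  by have /andP[h' _] := Q2 w; have := le_lt_trans (le_trans h' h) b0; rewrite ltxx.
have [a2|a2] := leP 2 a.
  apply: zero; apply/seteqP; split => w //=; rewrite in_itv/= => /andP[h _].
  by have /andP[_ h'] := Q2 w; have := lt_le_trans h (le_trans h' a2); rewrite ltxx.
(* Q never exceeds 2, so the level can be capped at 2, the range in which [-2, 2] contains all
   heights of the ellipse. *)
pose b' := Num.min b 2.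
have ab' : a < b' by rewrite lt_min ab a2.
have -> : Q @^-1` `]a, b] = Q @^-1` `]a, b'].
  apply/seteqP; split => w /=; rewrite !in_itv/= => /andP[-> /=]; rewrite le_min.
    by move=> ->; have /andP[_ ->] := Q2 w.
  by case/andP.
apply: (le_trans (sample_Q3_lipschitz_small _ _ ab')).
- by rewrite /b' le_min b0 /=.
- by rewrite /b' ge_min lexx orbT.
by rewrite lee_fin ler_wpM2l// lerD2r /b' ge_min lexx.
Qed.

End DensityThree.

(** * Reduction to variables with values in [0, 1] *)

Section Truncation.
Context d (T : measurableType d) (R : realType) (P : probability T R).
Notation leb := (@lebesgue_measure R).

Lemma eq_probability_mod_null (N E E' : set T) : measurable N -> P N = 0%E ->
  measurable E -> measurable E' -> (forall w, ~ N w -> E w <-> E' w) -> P E = P E'.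
Proof.
move=> mN N0; have le A B : measurable A -> measurable B ->
    (forall w, ~ N w -> A w <-> B w) -> (P A <= P B)%E.
  move=> mA mB AB; apply: (@le_trans _ _ (P (B `|` N))).
    apply: le_measure; rewrite ?inE//; first exact: measurableU.
    by move=> w Aw; have [Nw|Nw] := pselect (N w); [right | left; exact/(AB w Nw)].
  apply: (le_trans (measureU2 _ _ _)) => //; rewrite -[leRHS]adde0.
  by apply: leeD2l; rewrite le_eqVlt; apply/orP; left; apply/eqP; exact: N0.
move=> mE mE' EE'; apply/eqP; rewrite eq_le !le// => w Nw; split => /(EE' w Nw) //.
Qed.

Context (n : nat) (X : 'I_n -> T -> R) (f : R -> R).
Context (mX : forall i, measurable_fun setT (X i))
  (f0 : forall x, x < 0 \/ 1 < x -> f x = 0)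
  (fX : forall i, is_density_of P (X i) f).

(** Clamping moves no value inside [0, 1], so it alters each variable only on a null event. It makes
    the range condition hold at every sample point, and densities, independence and the law of Q are
    preserved. *)
Definition truncate (x : R) : R := Num.min (Num.max x 0) 1.
Let Y i w := truncate (X i w).

Lemma truncate01 x : 0 <= truncate x <= 1.
Proof. by rewrite /truncate le_min ge_min lexx orbT le_max lexx orbT ler01. Qed.

Lemma truncate_id x : 0 <= x <= 1 -> truncate x = x.
Proof. by move=> /andP[x0 x1]; rewrite /truncate (max_idPl x0) (min_idPl x1). Qed.

Lemma measurable_truncate i : measurable_fun setT (Y i).
Proof.
apply: (@measurable_minr _ _ _ setT (fun w => Num.max (X i w) 0) (fun=> 1)) => //.
exact: (@measurable_maxr _ _ _ setT (X i) (fun=> 0)).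
Qed.

Let out i := X i @^-1` (~` `[0, 1]%classic).
Let N := \bigcup_(i in [set: 'I_n]) out i.

Let mout i : measurable (out i).
Proof.
rewrite /out -[_ @^-1` _]setTI; apply: mX => //; apply: measurableC.
exact: measurable_itv.
Qed.

Let out0 i : P (out i) = 0%E.
Proof.
have [_ ->] := fX i; last by apply: measurableC; exact: measurable_itv.
rewrite integral0_eq// => x /=; rewrite in_itv/= => /negP.
by rewrite negb_and -!ltNge => /orP h; rewrite f0.
Qed.

Let mN : measurable N.
Proof. by apply: fin_bigcup_measurable => // i _; exact: mout. Qed.

Let N0 : P N = 0%E.
Proof.
have -> : N = \big[setU/set0]_(i <- enum 'I_n) out i.
  rewrite -bigcup_seq; apply/seteqP; split => w [i _ h]; exists i => //.
  by rewrite /= mem_enum.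
elim: (enum _) => [|i s IH]; first by rewrite big_nil measure0.
have ms : measurable (\big[setU/set0]_(j <- s) out j) by exact: bigsetU_measurable.
rewrite big_cons; apply/eqP; rewrite eq_le measure_ge0 andbT.
apply: (le_trans (measureU2 _ (mout i) ms)).
by rewrite le_eqVlt; apply/orP; left; apply/eqP; rewrite [X in (X + _)%E]out0 add0e; exact: IH.
Qed.

Let XY i w : ~ N w -> Y i w = X i w.
Proof.
move=> Nw; apply: truncate_id; apply: contra_notT Nw => h.
by exists i => //; rewrite /out /= in_itv/=; exact/negP.
Qed.

Let mpre (Z : T -> R) B : measurable_fun setT Z -> measurable B -> measurable (Z @^-1` B).
Proof. by move=> mZ mB; rewrite -[_ @^-1` _]setTI; exact: mZ. Qed.

Let preY i B : measurable B -> P (Y i @^-1` B) = P (X i @^-1` B).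
Proof.
move=> mB; apply: (eq_probability_mod_null mN N0).
- by apply: mpre => //; exact: measurable_truncate.
- exact: mpre.
- by move=> w Nw /=; rewrite XY.
Qed.

Lemma truncate_density i : is_density_of P (Y i) f.
Proof. by have [mf fd] := fX i; split => // A mA; rewrite preY// fd. Qed.

Lemma truncate_independent : mutually_independent P X -> mutually_independent P Y.
Proof.
move=> indX B mB; rewrite (eq_bigr (fun i => P (X i @^-1` B i))); last by move=> i _; exact: preY.
rewrite -indX//; apply: (eq_probability_mod_null mN N0).
- apply: fin_bigcap_measurable => // i _.
  by apply: mpre => //; exact: measurable_truncate.
- by apply: fin_bigcap_measurable => // i _; exact: mpre.
- move=> w Nw; split => h i _; have := h i I; rewrite /= ?XY//.
Qed.

Let preQ B : measurable B -> P (sample_Q X @^-1` B) = P (sample_Q Y @^-1` B).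
Proof.
move=> mB; apply: (eq_probability_mod_null mN N0).
- by apply: mpre => //; exact: measurable_sample_Q.
- by apply: mpre => //; apply: measurable_sample_Q; exact: measurable_truncate.
move=> w Nw /=; have -> : sample_Q Y w = sample_Q X w; last by [].
by rewrite /sample_Q; congr Qfun; apply/funext => i; exact: XY.
Qed.

Lemma cdf_truncate x : cdf_of P (sample_Q X) x = cdf_of P (sample_Q Y) x.
Proof. by rewrite /cdf_of; congr fine; apply: (preQ (measurable_ray x)). Qed.

Lemma density_truncate g : is_density_of P (sample_Q Y) g -> is_density_of P (sample_Q X) g.
Proof. by move=> [mg gd]; split => // A mA; rewrite preQ// gd. Qed.

End Truncation.

Lemma bounded_square_integral (R : realType) (g : R -> R) (M q : R) : 0 <= q ->
  measurable_fun setT g -> (forall x, `|g x| <= M) ->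
  (\int[lebesgue_measure]_(x in (`]0%R, q[ : set R)) ((g x) ^+ 2)%:E < +oo)%E.
Proof.
move=> q0 mg gM; pose D := `]0%R, q[%classic : set R.
have mD : measurable D by exact: measurable_itv.
have Doo : (lebesgue_measure D < +oo)%E.
  rewrite /D lebesgue_measure_itv/=; case: ifP => _; last by rewrite ltry.
  by rewrite -EFinB ltry.
apply: (@le_lt_trans _ _ (\int[lebesgue_measure]_(x in D) (M ^+ 2)%:E)%E).
  apply: ge0_le_integral => //.
  - by move=> x _; rewrite lee_fin sqr_ge0.
  - by apply: measurable_funTS; apply/measurable_EFinP; exact: measurable_funX.
  move=> x _; rewrite lee_fin -[leLHS]real_normK ?num_real// ler_pXn2r ?nnegrE//.
  exact: le_trans (gM x).
rewrite integral_cst//; apply: lte_mul_pinfty; rewrite ?lee_fin ?sqr_ge0//.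
Qed.

Theorem theorem1 (R : realType) (d : measure_display) (T : measurableType d)
    (P : probability T R) (n : nat) (X : 'I_n -> {RV P >-> R}) (f : R -> R) :
  (2 <= n)%N ->
  BVC 0 1 f ->
  (forall x : R, x < 0 \/ 1 < x -> f x = 0) ->
  (forall i, is_density_of P (X i) f) ->
  mutually_independent P (fun i => (X i : T -> R)) ->
  let Q := fun w => Qfun (fun i => X i w) in
  let q := qsup n in
  (forall x, 0 <= x <= q -> both_reprs f n (wcdf n x) (cdf_of P Q x)) /\
  ((3 <= n)%N -> exists fQ : R -> R, is_density_of P Q fQ /\
     (\int[lebesgue_measure]_(x in (`]0%R, q[ : set R)) ((fQ x) ^+ 2)%:E < +oo)%E) /\
  ((4 <= n)%N -> exists fQ : R -> R, is_density_of P Q fQ /\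
     forall x, 0 < x < q -> both_reprs f n (wpdf n x) (fQ x)).
Proof.
move=> n2 [cf acf] f0 fX indX Q q.
pose X' i : T -> R := X i.
have mX i : measurable_fun setT (X' i) by exact: measurable_funP.
pose Y i w := truncate (X' i w).
have mY i : measurable_fun setT (Y i) by exact: measurable_truncate.
have Y01 i w : 0 <= Y i w <= 1 by exact: truncate01.
have fY i : is_density_of P (Y i) f := truncate_density mX f0 fX i.
have indY : mutually_independent P Y := truncate_independent mX f0 fX indX.
have [L L0 fL] := within_cont_bounded cf.
have uf := abs_cont_unif_cont acf.
have [K bf] := abs_cont_bounded_var acf.
have dY g : is_density_of P (sample_Q Y) g -> is_density_of P Q g.
  exact: density_truncate mX f0 fX _.
split; [|split].
- move=> x xq; have -> : cdf_of P Q x = cdf_of P (sample_Q Y) x by exact: (cdf_truncate mX f0 fX).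
  exact: (cdf_representation n2 mY Y01 fY indY bf uf L0 fL).
- move=> n3; have [n3E|n3E] := eqVneq n 3.
    subst n; have [g [gd g2]] := density_three L0 fL mY Y01 fY indY.
    by exists g; split => //; exact: dY.
  have n4 : (4 <= n)%N by rewrite ltn_neqAle eq_sym n3E.
  have gd := pdf_series_density n4 mY Y01 fY indY bf uf L0 fL.
  exists (pdf_series P Y); split; first exact: dY.
  have [M gM] := pdf_series_bounded n4 mY Y01 fY indY bf uf L0 fL.
  by apply: bounded_square_integral gM; [exact/ltW/qsup_gt0 | case: gd].
- move=> n4; exists (pdf_series P Y); split.
    exact/dY/(pdf_series_density n4 mY Y01 fY indY bf uf L0 fL).
  move=> x xq; exact: (pdf_series_representation n4 mY Y01 fY indY bf uf L0 fL).
Qed.
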